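(* There exist at least $13$ dichotomial $5$-spheres, distinct already on the level of their $1$-skeleta (i.e. with pairwise non-isomorphic $1$-skeleta), of which $10$ have non-simplicial $2$-skeleta.
   Context: Posets are finite. For a poset $P$, $|P|$ denotes its order complex: the polyhedron triangulated by the simplicial complex of nonempty chains of $P$. For $p\in P$ put $\downarrow p=\{q\in P:q\le p\}$ and $\partial(\downarrow p)=\{q:q<p\}$. A cell complex is a poset $P$ such that $|\partial(\downarrow p)|$ is PL homeomorphic to a sphere for each $p\in P$ (including $S^{-1}=\emptyset$). Its elements are the cells, $\dim p=\dim|\downarrow p|$, the vertices are the minimal elements (atoms); the $k$-skeleton is the set of cells of dimension $\le k$. It is simplicial if it is the poset of nonempty simplices of a simplicial complex. $A(P)$ is the set of atoms; $P$ is atomistic if every element is the least upper bound of some set of atoms. A cell complex $B$ is dichotomial if it is atomistic and for each cell $A\in B$ there is a (unique) cell $\bar A\in B$ whose vertices are precisely all the vertices of $B$ that are not in $A$, i.e. $A(\downarrow\bar A)=A(B)\setminus A(\downarrow A)$. A dichotomial $5$-sphere here means a $5$-dimensional dichotomial cell complex (its order complex is PL homeomorphic to $S^5$). *)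

(* Defs.v *)
From HB Require Import structures.
From mathcomp Require Import all_boot all_order all_algebra.
From mathcomp Require Import classical_sets reals.

Set Implicit Arguments.
Unset Strict Implicit.
Unset Printing Implicit Defensive.

Import Order.TTheory GRing.Theory Num.Theory.
Local Open Scope classical_set_scope.
Local Open Scope ring_scope.

(* Polyhedra live in Euclidean spaces R^I = {ffun I -> R}, I a finite type. *)
Section PiecewiseLinear.
Variable R : realType.

(* The closed convex polyhedron cut out by the inequalities
   sum_i a_i x_i <= b, for (a, b) in s. *)
Definition convex_polyhedron (I : finType) (s : seq ({ffun I -> R} * R)) :
    set {ffun I -> R} :=
  [set x | forall h, h \in s -> \sum_i h.1 i * x i <= h.2].

Definition affine_on (I J : finType) (C : set {ffun I -> R})
    (f : {ffun I -> R} -> {ffun J -> R}) : Prop :=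
  exists (M : J -> I -> R) (c : J -> R),
    forall x, C x -> forall j, f x j = \sum_i M j i * x i + c j.

(* f is affine on each member of a finite cover of X by closed convex
   polyhedra contained in X.  Continuity of f on X is automatic, the cover
   being finite and closed; the values of f outside X are irrelevant. *)
Definition pl_map (I J : finType) (X : set {ffun I -> R})
    (f : {ffun I -> R} -> {ffun J -> R}) : Prop :=
  exists cover : seq (seq ({ffun I -> R} * R)),
    (forall x, X x <-> exists2 s, s \in cover & convex_polyhedron s x) /\
    (forall s, s \in cover -> affine_on (convex_polyhedron s) f).

Definition pl_homeomorphic (I J : finType)
    (X : set {ffun I -> R}) (Y : set {ffun J -> R}) : Prop :=
  exists (f : {ffun I -> R} -> {ffun J -> R})
         (g : {ffun J -> R} -> {ffun I -> R}),
    [/\ pl_map X f, pl_map Y g,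
        forall x, X x -> Y (f x) /\ g (f x) = x
      & forall y, Y y -> X (g y) /\ f (g y) = y].

(* The boundary of the standard n-simplex in R^(n+1): the standard
   PL (n-1)-sphere.  It is empty for n = 0, in accordance with the
   convention that the (-1)-sphere is empty. *)
Definition simplex_boundary (n : nat) : set {ffun 'I_n.+1 -> R} :=
  [set x | [/\ forall i, 0 <= x i, \sum_i x i = 1 & exists i, x i = 0]].

(* X is a PL (n-1)-sphere: note the shift, which accommodates the
   (-1)-sphere. *)
Definition pl_sphere (I : finType) (n : nat) (X : set {ffun I -> R}) : Prop :=
  pl_homeomorphic X (@simplex_boundary n).

End PiecewiseLinear.

Local Close Scope classical_set_scope.

(* Subposets of P are represented by their underlying sets A : {set P}. *)
Section Posets.
Variables (disp : Order.disp_t) (P : finPOrderType disp).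
Implicit Types (p q : P) (A C : {set P}).

Definition down p : {set P} := [set q | (q <= p)%O].
Definition bdown p : {set P} := [set q | (q < p)%O].

Definition is_chain C : bool :=
  [forall x in C, forall y in C, (x >=< y)%O].

(* One less than the largest cardinality of a chain; -1 when A is empty. *)
Definition poset_dim A : int :=
  (\max_(C : {set P} | is_chain C && (C \subset A)) #|C|)%:Z - 1.

Definition skeleton (k : nat) : {set P} := [set p | poset_dim (down p) <= k%:Z].

Definition atoms A : {set P} :=
  [set a in A | [forall b in A, ~~ (b < a)%O]].

Definition is_lub (S : {set P}) p : Prop :=
  (forall a, a \in S -> (a <= p)%O) /\
  (forall q, (forall a, a \in S -> (a <= q)%O) -> (p <= q)%O).

Definition atomistic : Prop :=
  forall p, exists2 S : {set P}, S \subset atoms [set: P] & is_lub S p.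

(* Barycentric coordinates: the vertex p of |A| is the p-th basis vector of
   R^P, so a point of R^P lies in |A| iff it is a convex combination of the
   elements of some chain of A. *)
Definition order_complex (R : realType) A : set {ffun P -> R} :=
  fun x => [/\ forall p, 0 <= x p, \sum_p x p = 1,
               [set p | x p != 0] \subset A
             & is_chain [set p | x p != 0]].
Arguments order_complex : clear implicits.

Definition cell_complex (R : realType) : Prop :=
  forall p, exists n : nat, pl_sphere n (order_complex R (bdown p)).

Definition dichotomial (R : realType) : Prop :=
  [/\ cell_complex R,
      atomistic
    & forall p, exists! q,
        atoms (down q) = atoms [set: P] :\: atoms (down p)].

Definition dichotomial_sphere (R : realType) (n : nat) : Prop :=
  [/\ dichotomial R, poset_dim [set: P] = n%:Z
    & pl_sphere n.+1 (order_complex R [set: P])].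

End Posets.

Arguments order_complex {disp P} R A.
Arguments skeleton {disp} P k.
Arguments dichotomial_sphere {disp} P R n.

Definition rel_isomorphic (S T : finType) (A : {set S}) (B : {set T})
    (leS : rel S) (leT : rel T) : Prop :=
  exists f : {x | x \in A} -> {y | y \in B},
    bijective f /\ forall x y, leT (val (f x)) (val (f y)) = leS (val x) (val y).

Definition poset_isomorphic (dispP dispQ : Order.disp_t)
    (P : finPOrderType dispP) (Q : finPOrderType dispQ)
    (A : {set P}) (B : {set Q}) : Prop :=
  rel_isomorphic A B <=%O <=%O.

Definition simplicial_complex (V : finType) (K : {set {set V}}) : Prop :=
  finset.set0 \notin K /\
  forall s t : {set V}, s \in K -> t \subset s -> t != finset.set0 -> t \in K.

Definition simplicial (disp : Order.disp_t) (P : finPOrderType disp)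
    (A : {set P}) : Prop :=
  exists (V : finType) (K : {set {set V}}),
    simplicial_complex K /\
    rel_isomorphic A K <=%O (fun s t : {set V} => s \subset t).

(* Main.v *)
Require Import Defs.
From HB Require Import structures.
From mathcomp Require Import all_boot all_order all_algebra.
From mathcomp Require Import boolp reals ring zify.

(* A dichotomial sphere is the proper part of a family F of subsets of a finite
   set, closed under complement, in which the open intervals (0, p) are spheres
   of dimension rk p - 2.  If s1 and s2 are monotone two-valued functions on two
   families, their fiber product {a + b | s1 a = s2 b} is again such a family: the
   innermost elements of a chain, those where a or b is last on the low side or
   first on the high side, identify each lower interval, linearly on simplices,
   with the join of lower intervals of the factors, or with the join of a
   0-sphere and two of these.  Self-dual weighted majority functions preserve
   the closure under complement, and fiber products of Boolean cubes over such
   functions give twelve of the spheres (the simplex boundary included).  The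
   thirteenth is the product of a Boolean algebra of rank one with the family P8,
   whose 1-skeleton is the 8-vertex graph P_8 of the Petersen family; its
   intervals are turned into boundaries of simplices by explicit stellar
   exchanges.  The 1-skeleta are told apart by the sum over the cells of the
   cube of the number of cells above, and a quadrangle rules out a simplicial
   2-skeleton. *)

Set Implicit Arguments.
Unset Strict Implicit.
Unset Printing Implicit Defensive.

Import Order.TTheory GRing.Theory Num.Theory.
Local Open Scope ring_scope.

(** * Conic piecewise linear maps *)

(** Apart from products, inverses and composites, every homeomorphism below is an instance of one
    criterion, [bary_homeo]: send each vertex to the barycenter of a face, extend linearly over
    faces, and let each nonempty target face select a source vertex. Starring a face, joining two
    simplex boundaries, passing from a fiber product to its factors and renaming vertices differ
    only in the vertex that is selected. Cones replace polyhedra because a join of cones is a plain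
    product and because linear pieces compose by linear algebra alone. The rank is forced by the two
    shapes of a lower interval: the 0-sphere raises the dimension by one on the low side and is
    absent on the high side, so a high cell has rank one less than the sum of the ranks of its
    components. Monotonicity guarantees that only low elements lie below a low one. [P8] is cut out
    by two such conditions whose blocks of coordinates cross; it is not presented as an iterated
    fiber product, and its intervals are checked one by one. *)

Section ConicPL.
Variable R : realType.

Section Linear.
Variables I J : finType.

Definition lin (h x : {ffun I -> R}) : R := \sum_i h i * x i.

Definition app (M : {ffun J -> {ffun I -> R}}) (x : {ffun I -> R}) :
    {ffun J -> R} := [ffun j => lin (M j) x].

Definition cut (s : seq {ffun I -> R}) : ({ffun I -> R} -> Prop) :=
  fun x => forall h, h \in s -> lin h x <= 0.

(** The homogeneous form of [pl_map]: no constant terms, neither in the inequalities nor in the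
    maps. Each piece carries its matrix, ready to be composed with another one. *)
Definition cpl_map (X : ({ffun I -> R} -> Prop))
    (f : {ffun I -> R} -> {ffun J -> R}) : Prop :=
  exists cover : seq (seq {ffun I -> R} * {ffun J -> {ffun I -> R}}),
    (forall x, X x <-> exists2 c, c \in cover & cut c.1 x) /\
    (forall c, c \in cover -> forall x, cut c.1 x -> f x = app c.2 x).

Definition supp (x : {ffun I -> R}) : {set I} := [set i | x i != 0].

(** The origin has empty support, so the cone contains its apex exactly when [K] contains the empty
    face. *)
Definition cone (K : pred {set I}) : ({ffun I -> R} -> Prop) :=
  fun x => (forall i, 0 <= x i) /\ K (supp x).

End Linear.

(* A PL homeomorphism extended homogeneously to cones: as coordinate sums are
   preserved, it can be restricted to the points of coordinate sum 1. *)
Definition chomeo (I J : finType) (X : ({ffun I -> R} -> Prop))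
    (Y : ({ffun J -> R} -> Prop)) : Prop :=
  exists (f : {ffun I -> R} -> {ffun J -> R})
         (g : {ffun J -> R} -> {ffun I -> R}),
    [/\ cpl_map X f, cpl_map Y g,
        forall x, X x -> Y (f x) /\ g (f x) = x,
        forall y, Y y -> X (g y) /\ f (g y) = y
      & forall x, X x -> \sum_j f x j = \sum_i x i].

Lemma lin_addr (I : finType) (h x y : {ffun I -> R}) :
  lin h (x + y) = lin h x + lin h y.
Proof. by rewrite /lin -big_split; apply: eq_bigr => i _; rewrite ffunE mulrDr. Qed.

Lemma lin_oppr (I : finType) (h x : {ffun I -> R}) : lin h (- x) = - lin h x.
Proof. by rewrite /lin -sumrN; apply: eq_bigr => i _; rewrite ffunE mulrN. Qed.

Lemma app_add (I J : finType) (M : {ffun J -> {ffun I -> R}}) x y :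
  app M (x + y) = app M x + app M y.
Proof. by apply/ffunP => j; rewrite !ffunE lin_addr. Qed.

Lemma app_opp (I J : finType) (M : {ffun J -> {ffun I -> R}}) x :
  app M (- x) = - app M x.
Proof. by apply/ffunP => j; rewrite !ffunE lin_oppr. Qed.

Lemma app0 (I J : finType) (M : {ffun J -> {ffun I -> R}}) : app M 0 = 0.
Proof.
by apply/ffunP => j; rewrite !ffunE /lin big1 // => i _; rewrite ffunE mulr0.
Qed.

Definition pull (I J : finType) (h : {ffun J -> R})
    (M : {ffun J -> {ffun I -> R}}) : {ffun I -> R} :=
  [ffun i => \sum_j h j * M j i].

Lemma lin_pull (I J : finType) (h : {ffun J -> R})
    (M : {ffun J -> {ffun I -> R}}) x : lin (pull h M) x = lin h (app M x).
Proof.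
rewrite /lin; under eq_bigr => i _ do rewrite ffunE mulr_suml.
rewrite exchange_big /=; apply: eq_bigr => j _.
by rewrite ffunE mulr_sumr; apply: eq_bigr => i _; rewrite mulrA.
Qed.

Lemma app_comp (I J L : finType) (N : {ffun L -> {ffun J -> R}})
    (M : {ffun J -> {ffun I -> R}}) x :
  app [ffun k => pull (N k) M] x = app N (app M x).
Proof. by apply/ffunP => k; rewrite !ffunE lin_pull. Qed.

(** A piece of the composite is a piece of [f] met with the preimage of a piece of [g] under the
    matrix of the first; the preimage of a half-space is again one, with normal vector
    [pull h M]. *)
Lemma cpl_comp (I J L : finType) (X : ({ffun I -> R} -> Prop)) (Y : ({ffun J -> R} -> Prop))
    (f : {ffun I -> R} -> {ffun J -> R}) (g : {ffun J -> R} -> {ffun L -> R}) :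
  cpl_map X f -> cpl_map Y g -> (forall x, X x -> Y (f x)) ->
  cpl_map X (g \o f).
Proof.
move=> [cf [Xc fc]] [cg [Yc gc]] XY.
pose pulled (c : seq {ffun I -> R} * {ffun J -> {ffun I -> R}})
    (d : seq {ffun J -> R} * {ffun L -> {ffun J -> R}}) : seq {ffun I -> R} :=
  c.1 ++ [seq pull h c.2 | h <- d.1].
pose mat (c : seq {ffun I -> R} * {ffun J -> {ffun I -> R}})
    (d : seq {ffun J -> R} * {ffun L -> {ffun J -> R}}) :
    {ffun L -> {ffun I -> R}} := [ffun k => pull (d.2 k) c.2].
exists [seq (pulled c d, mat c d) | c <- cf, d <- cg].
have cutE c d x : cut (pulled c d) x <-> cut c.1 x /\ cut d.1 (app c.2 x).
  split=> [h|[h1 h2] h].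
    split=> k kc; first by apply: h; rewrite mem_cat kc.
    by rewrite -lin_pull; apply: h; rewrite mem_cat (map_f (fun h => pull h c.2)) ?orbT.
  rewrite mem_cat => /orP[/h1 //|/mapP[k kd ->]].
  by rewrite lin_pull; apply: h2.
split=> [x|e].
  split=> [Xx|[e /allpairsP[[c d] /= [ci di ->]] /cutE[h1 _]]]; last first.
    by apply/Xc; exists c.
  have [c ci cx] := (Xc x).1 Xx.
  have [d di dx] := (Yc _).1 (XY _ Xx).
  exists (pulled c d, mat c d); first exact: allpairs_f.
  by apply/cutE; split=> //; rewrite -(fc c ci x cx).
case/allpairsP=> [[c d] /= [ci di ->]] x /cutE[h1 h2] /=.
by rewrite app_comp (fc _ ci _ h1) (gc _ di _ h2).
Qed.

Lemma chomeo_sym (I J : finType) (X : ({ffun I -> R} -> Prop)) (Y : ({ffun J -> R} -> Prop)) :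
  chomeo X Y -> chomeo Y X.
Proof.
move=> [f [g [cf cg fX gY s]]]; exists g, f; split=> // y Yy.
by have [Xg fg] := gY y Yy; rewrite -{2}fg s.
Qed.

Lemma chomeo_trans (I J L : finType) (X : ({ffun I -> R} -> Prop))
    (Y : ({ffun J -> R} -> Prop)) (Z : ({ffun L -> R} -> Prop)) :
  chomeo X Y -> chomeo Y Z -> chomeo X Z.
Proof.
move=> [f [g [cf cg fX gY s]]] [f' [g' [cf' cg' fY gZ s']]].
exists (f' \o f), (g \o g'); split.
- by apply: cpl_comp cf cf' _ => x /fX[].
- by apply: cpl_comp cg' cg _ => x /gZ[].
- move=> x Xx /=; have [Yf gf] := fX _ Xx; have [Zf gf'] := fY _ Yf.
  by rewrite gf' gf.
- move=> z Zz /=; have [Yg fg] := gZ _ Zz; have [Xg fg'] := gY _ Yg.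
  by rewrite fg' fg.
- by move=> x Xx /=; have [Yf gf] := fX _ Xx; rewrite s' // s.
Qed.

(** * Products of maps and joins of complexes *)

Section Product.
Variables I1 I2 : finType.

Definition fstf (z : {ffun I1 + I2 -> R}) : {ffun I1 -> R} :=
  [ffun i => z (inl i)].
Definition sndf (z : {ffun I1 + I2 -> R}) : {ffun I2 -> R} :=
  [ffun i => z (inr i)].
Definition pairf (x : {ffun I1 -> R}) (y : {ffun I2 -> R}) :
    {ffun I1 + I2 -> R} :=
  [ffun k => match k with inl i => x i | inr i => y i end].

Lemma fstf_pair x y : fstf (pairf x y) = x.
Proof. by apply/ffunP => i; rewrite !ffunE. Qed.
Lemma sndf_pair x y : sndf (pairf x y) = y.
Proof. by apply/ffunP => i; rewrite !ffunE. Qed.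
Lemma pairf_eta z : pairf (fstf z) (sndf z) = z.
Proof. by apply/ffunP => -[i|i]; rewrite !ffunE. Qed.

Lemma sum_pairf (F : I1 + I2 -> R) :
  \sum_k F k = \sum_i F (inl i) + \sum_i F (inr i).
Proof. exact: big_sumType. Qed.

Lemma lin_pairl h z : lin (pairf h 0) z = lin h (fstf z).
Proof.
rewrite /lin sum_pairf [X in _ + X]big1 ?addr0 => [|i _].
  by apply: eq_bigr => i _; rewrite !ffunE.
by rewrite !ffunE mul0r.
Qed.

Lemma lin_pairr h z : lin (pairf 0 h) z = lin h (sndf z).
Proof.
rewrite /lin sum_pairf [X in X + _]big1 ?add0r => [|i _].
  by apply: eq_bigr => i _; rewrite !ffunE.
by rewrite !ffunE mul0r.
Qed.

Definition prodX (X : ({ffun I1 -> R} -> Prop)) (Y : ({ffun I2 -> R} -> Prop)) :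
  ({ffun I1 + I2 -> R} -> Prop) := fun z => X (fstf z) /\ Y (sndf z).

End Product.

Lemma cpl_prod (I1 I2 J1 J2 : finType) (X1 : ({ffun I1 -> R} -> Prop))
    (X2 : ({ffun I2 -> R} -> Prop)) (f1 : {ffun I1 -> R} -> {ffun J1 -> R})
    (f2 : {ffun I2 -> R} -> {ffun J2 -> R}) :
  cpl_map X1 f1 -> cpl_map X2 f2 ->
  cpl_map (prodX X1 X2) (fun z => pairf (f1 (fstf z)) (f2 (sndf z))).
Proof.
move=> [c1 [X1c fc1]] [c2 [X2c fc2]].
pose cc (a : seq {ffun I1 -> R} * {ffun J1 -> {ffun I1 -> R}})
        (b : seq {ffun I2 -> R} * {ffun J2 -> {ffun I2 -> R}}) :
     seq {ffun I1 + I2 -> R} :=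
  [seq pairf h 0 | h <- a.1] ++ [seq pairf 0 h | h <- b.1].
pose mm (a : seq {ffun I1 -> R} * {ffun J1 -> {ffun I1 -> R}})
        (b : seq {ffun I2 -> R} * {ffun J2 -> {ffun I2 -> R}}) :
     {ffun J1 + J2 -> {ffun I1 + I2 -> R}} :=
  [ffun k => match k with inl j => pairf (a.2 j) 0 | inr j => pairf 0 (b.2 j) end].
have cutE a b z : cut (cc a b) z <-> cut a.1 (fstf z) /\ cut b.1 (sndf z).
  split=> [h|[h1 h2] h].
    split=> k kc.
      by rewrite -lin_pairl; apply: h; rewrite mem_cat (map_f (fun h => pairf h 0)).
    by rewrite -lin_pairr; apply: h; rewrite mem_cat (map_f (fun h => pairf 0 h)) ?orbT.
  rewrite mem_cat => /orP[] /mapP[k kd ->].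
    by rewrite lin_pairl; apply: h1.
  by rewrite lin_pairr; apply: h2.
exists [seq (cc a b, mm a b) | a <- c1, b <- c2]; split=> [z|e].
  split=> [[/X1c[a ai az] /X2c[b bi bz]]|].
    by exists (cc a b, mm a b); [apply: allpairs_f | apply/cutE].
  case=> e /allpairsP[[a b] /= [ai bi ->]] /cutE[h1 h2].
  by split; [apply/X1c; exists a | apply/X2c; exists b].
case/allpairsP=> [[a b] /= [ai bi ->]] z /cutE[h1 h2] /=.
rewrite (fc1 _ ai _ h1) (fc2 _ bi _ h2).
apply/ffunP => -[j|j]; first by rewrite !ffunE lin_pairl.
by rewrite !ffunE lin_pairr.
Qed.

Lemma chomeo_prod (I1 I2 J1 J2 : finType) (X1 : ({ffun I1 -> R} -> Prop))
    (X2 : ({ffun I2 -> R} -> Prop)) (Y1 : ({ffun J1 -> R} -> Prop)) (Y2 : ({ffun J2 -> R} -> Prop)) :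
  chomeo X1 Y1 -> chomeo X2 Y2 -> chomeo (prodX X1 X2) (prodX Y1 Y2).
Proof.
move=> [f1 [g1 [cf1 cg1 fX1 gY1 s1]]] [f2 [g2 [cf2 cg2 fX2 gY2 s2]]].
exists (fun z => pairf (f1 (fstf z)) (f2 (sndf z))),
       (fun z => pairf (g1 (fstf z)) (g2 (sndf z))); split.
- exact: cpl_prod.
- exact: cpl_prod.
- move=> z [z1 z2]; have [h1 e1] := fX1 _ z1; have [h2 e2] := fX2 _ z2.
  by rewrite /prodX !fstf_pair !sndf_pair e1 e2 pairf_eta.
- move=> z [z1 z2]; have [h1 e1] := gY1 _ z1; have [h2 e2] := gY2 _ z2.
  by rewrite /prodX !fstf_pair !sndf_pair e1 e2 pairf_eta.
- move=> z [z1 z2]; rewrite !sum_pairf; congr (_ + _).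
    under eq_bigr => i _ do rewrite ffunE.
    by rewrite s1 //; apply: eq_bigr => i _; rewrite ffunE.
  under eq_bigr => i _ do rewrite ffunE.
  by rewrite s2 //; apply: eq_bigr => i _; rewrite ffunE.
Qed.

Definition joinK (I1 I2 : finType) (K1 : pred {set I1}) (K2 : pred {set I2}) :
    pred {set I1 + I2} :=
  fun s => K1 [set i | inl i \in s] && K2 [set i | inr i \in s].

(** A point of a join is a weighted mean of one point of each side. On cones the weights are
    absorbed in the coordinates, so no join parameter appears. *)
Lemma cone_join (I1 I2 : finType) (K1 : pred {set I1}) (K2 : pred {set I2}) :
  cone (joinK K1 K2) = prodX (cone K1) (cone K2).
Proof.
apply: funext => z; apply: propext; rewrite /cone /prodX /joinK.
have -> : [set i | inl i \in supp z] = supp (fstf z).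
  by apply/setP => i; rewrite !inE ffunE.
have -> : [set i | inr i \in supp z] = supp (sndf z).
  by apply/setP => i; rewrite !inE ffunE.
split=> [[z0 /andP[k1 k2]]|[[z1 k1] [z2 k2]]].
  by split; split=> // i; rewrite ffunE.
split; last exact/andP.
move=> [i|i]; first by have := z1 i; rewrite ffunE.
by have := z2 i; rewrite ffunE.
Qed.

Lemma chomeo_join (I1 I2 J1 J2 : finType) (K1 : pred {set I1})
    (K2 : pred {set I2}) (L1 : pred {set J1}) (L2 : pred {set J2}) :
  chomeo (cone K1) (cone L1) -> chomeo (cone K2) (cone L2) ->
  chomeo (cone (joinK K1 K2)) (cone (joinK L1 L2)).
Proof. by rewrite !cone_join; apply: chomeo_prod. Qed.

(** Injectivity on a coordinate subspace makes the corresponding matrix row free, hence invertible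
    on one side. The left inverse lives on the whole target space, which later allows the image of a
    face to be described by linear inequalities. *)
Lemma left_inverse (I J : finType) (M : {ffun J -> {ffun I -> R}}) (s : {set I}) :
  (forall u, supp u \subset s -> app M u = 0 -> u = 0) ->
  exists N : {ffun I -> {ffun J -> R}},
    (forall u, supp u \subset s -> app N (app M u) = u) /\
    (forall y i, i \notin s -> app N y i = 0).
Proof.
move=> inj.
have sumE (F : J -> R) : \sum_j F j = \sum_k F (@enum_val J J k).
  by rewrite -big_enum_val; apply: eq_bigl => j; rewrite inE.
pose A : 'M[R]_(#|s|, #|J|) := \matrix_(k, l) M (enum_val l) (enum_val k).
pose ext (v : 'rV[R]_#|s|) : {ffun I -> R} :=
  [ffun i => \sum_k (if enum_val k == i then v 0 k else 0)].
have extE v k : ext v (enum_val k) = v 0 k.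
  rewrite ffunE (bigD1 k) //= eqxx big1 ?addr0 // => l lk.
  by rewrite (inj_eq enum_val_inj) (negPf lk).
have ext0 v i : i \notin s -> ext v i = 0.
  move=> is0; rewrite ffunE big1 // => k _; case: eqP => // e.
  by rewrite -e enum_valP in is0.
have sum_s (F : I -> R) : (forall i, i \notin s -> F i = 0) ->
    \sum_i F i = \sum_(k < #|s|) F (enum_val k).
  move=> F0; rewrite (bigID (mem s)) /= [X in _ + X]big1 ?addr0; last first.
    by move=> i; apply: F0.
  by rewrite big_enum_val.
have free : row_free A.
  apply: inj_row_free => v vA.
  have : ext v = 0.
    apply: inj.
      apply/subsetP => i; rewrite inE; apply: contraR => /ext0 ->.
      by rewrite eqxx.
    apply/ffunP => j; rewrite !ffunE /lin sum_s => [|i /ext0 ->]; last first.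
      by rewrite mulr0.
    have := congr1 (fun w : 'rV[R]_#|J| => w 0 (enum_rank j)) vA.
    rewrite !mxE => e; rewrite -[RHS]e; apply: eq_bigr => k _.
    by rewrite !mxE extE enum_rankK mulrC.
  by move=> e; apply/rowP => k; rewrite -extE e ffunE mxE.
have /row_freeP[B AB] := free.
pose N : {ffun I -> {ffun J -> R}} :=
  [ffun i => [ffun j => \sum_k (if enum_val k == i then B (enum_rank j) k else 0)]].
have NE y k : app N y (enum_val k) = \sum_j B (enum_rank j) k * y j.
  rewrite ffunE /lin; apply: eq_bigr => j _; rewrite !ffunE; congr (_ * _).
  rewrite (bigD1 k) //= eqxx big1 ?addr0 // => l lk.
  by rewrite (inj_eq enum_val_inj) (negPf lk).
have N0 y i : i \notin s -> app N y i = 0.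
  move=> is0; rewrite ffunE /lin big1 // => j _.
  rewrite !ffunE big1 ?mul0r // => k _; case: eqP => // e.
  by rewrite -e enum_valP in is0.
exists N; split=> // u us; apply/ffunP => i.
case: (boolP (i \in s)) => [is1|is0]; last first.
  rewrite N0 //; apply/esym/eqP; apply: contraR is0 => ui.
  by apply: (subsetP us); rewrite inE.
have -> : i = enum_val (enum_rank_in is1 i) by rewrite enum_rankK_in.
set k := enum_rank_in _ _.
have ABk l : \sum_j A l j * B j k = (l == k)%:R.
  by have := congr1 (fun X : 'M_#|s| => X l k) AB; rewrite !mxE.
have uE j : app M u (enum_val j) = \sum_l A l j * u (enum_val l).
  rewrite ffunE /lin sum_s => [|i0 i0s]; last first.
    suff -> : u i0 = 0 by rewrite mulr0.
    by apply/eqP; apply: contraR i0s => ?; apply: (subsetP us); rewrite inE.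
  by apply: eq_bigr => l _; rewrite mxE.
rewrite NE sumE.
transitivity (\sum_l u (enum_val l) * \sum_j A l j * B j k).
  under eq_bigr => j _ do rewrite enum_valK uE mulr_sumr.
  rewrite exchange_big /=; apply: eq_bigr => l _.
  by rewrite mulr_sumr; apply: eq_bigr => j _; ring.
rewrite (bigD1 k) //= ABk eqxx mulr1 big1 ?addr0 // => l lk.
by rewrite ABk (negPf lk) mulr0.
Qed.

End ConicPL.

(** * Barycentric maps and joins of spheres *)

Definition down_closed (I : finType) (K : pred {set I}) : Prop :=
  forall s t : {set I}, t \subset s -> K s -> K t.

Definition covc (I J : finType) (c : I -> {set J}) (s : {set I}) : {set J} :=
  \bigcup_(i in s) c i.

Section Barycentric.
Variables (R : realType) (I J : finType) (K : pred {set I}) (L : pred {set J}).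
Variable c : I -> {set J}.

Definition bary (s : {set J}) : {ffun J -> R} :=
  [ffun j => if j \in s then #|s|%:R^-1 else 0].

Definition baryM : {ffun J -> {ffun I -> R}} :=
  [ffun j => [ffun i => bary (c i) j]].

Definition dl (T : finType) (i : T) (t : R) : {ffun T -> R} :=
  [ffun k => if k == i then t else 0].

Lemma dlE (T : finType) (i : T) t k : dl i t k = if k == i then t else 0.
Proof. by rewrite ffunE. Qed.

Lemma lin_dl (T : finType) (i : T) t x : lin (dl i t) x = t * x i.
Proof.
rewrite /lin (bigD1 i) //= dlE eqxx big1 ?addr0 // => k ki.
by rewrite dlE (negPf ki) mul0r.
Qed.

Lemma bary_ge0 s j : 0 <= bary s j.
Proof. by rewrite ffunE; case: ifP => // _; rewrite invr_ge0 ler0n. Qed.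

Lemma bary_gt0 (s : {set J}) j : (0 < bary s j) = (j \in s).
Proof.
rewrite ffunE; case: ifP => js; last by rewrite ltxx.
by rewrite invr_gt0 ltr0n; apply/card_gt0P; exists j.
Qed.

Lemma bary_sum s : s != set0 -> \sum_j bary s j = 1.
Proof.
move=> s0; have n0 : #|s|%:R != 0 :> R by rewrite pnatr_eq0 cards_eq0.
rewrite (bigID (mem s)) /= [X in _ + X]big1 ?addr0 => [|j /negPf js].
  rewrite (eq_bigr (fun _ => #|s|%:R^-1)) => [|j js]; last by rewrite ffunE js.
  by rewrite sumr_const -[_ *+ _]mulr_natr mulVf.
by rewrite ffunE js.
Qed.

Lemma app_baryM x j : app baryM x j = \sum_i bary (c i) j * x i.
Proof. by rewrite ffunE /lin; apply: eq_bigr => i _; rewrite !ffunE. Qed.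

Lemma app_dl i t j : app baryM (dl i t) j = t * bary (c i) j.
Proof.
rewrite app_baryM (bigD1 i) //= dlE eqxx big1 ?addr0; first by rewrite mulrC.
by move=> k ki; rewrite dlE (negPf ki) mulr0.
Qed.

Lemma app_ge0 (x : {ffun I -> R}) : (forall i, 0 <= x i) -> forall j, 0 <= app baryM x j.
Proof.
by move=> x0 j; rewrite app_baryM sumr_ge0 // => i _; rewrite mulr_ge0 ?bary_ge0.
Qed.

Lemma supp_app (x : {ffun I -> R}) : (forall i, 0 <= x i) -> supp (app baryM x) = covc c (supp x).
Proof.
move=> x0; apply/setP => j; rewrite inE app_baryM psumr_neq0 => [|i _]; last first.
  by rewrite mulr_ge0 ?bary_ge0.
apply/hasP/bigcupP => [[i _ /andP[_ h]]|[i]].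
  exists i; first by rewrite inE; apply: contraTneq h => ->; rewrite mulr0 ltxx.
  by rewrite -bary_gt0 lt0r bary_ge0 andbT; apply: contraTneq h => ->; rewrite mul0r ltxx.
rewrite inE => xi ji; exists i; rewrite ?mem_index_enum //=.
by rewrite mulr_gt0 ?bary_gt0 // lt0r xi x0.
Qed.

Lemma supp0 (T : finType) : supp (0 : {ffun T -> R}) = set0.
Proof. by apply/setP => i; rewrite !inE ffunE eqxx. Qed.

Lemma supp_eq0 (T : finType) (x : {ffun T -> R}) : supp x = set0 -> x = 0.
Proof.
by move=> e; apply/ffunP => i; rewrite ffunE; have := in_set0 i; rewrite -e inE =>
  /negbFE/eqP.
Qed.

Hypotheses (dK : down_closed K) (dL : down_closed L) (K0 : K set0).
Hypothesis c_neq0 : forall s i, K s -> i \in s -> c i != set0.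
Hypothesis KL : forall s, K s -> L (covc c s).
(* A face of the target selects a vertex of the source: that vertex can be split
   off any point of the open face, and it occurs in any preimage. *)
Hypothesis sel : forall t, L t -> t != set0 ->
  exists i, [/\ c i \subset t, forall s, K s -> covc c s \subset t -> K (i |: s)
              & forall s, K s -> covc c s = t -> i \in s].

(** Greedy decomposition: the largest possible multiple of the barycenter of [c i] is subtracted,
    with [i] selected by the support of [z]. The rest has smaller support and a preimage by
    induction, and [i] can be added to that preimage because the latter is still covered by the
    support of [z]. *)
Lemma bary_surj z : cone L z -> exists2 x, cone K x & app baryM x = z.
Proof.
have [n] := ubnP #|supp z|; elim: n z => // n IHn z zn [z0 Lz].
have [e|nz] := eqVneq (supp z) set0.
  exists 0; last by rewrite app0 (supp_eq0 e).
  by split=> [i|]; rewrite ?ffunE // supp0.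
have [i [cz iK _]] := sel Lz nz.
have Ki : K [set i] by rewrite -[[set i]]setU0; apply: iK; rewrite // /covc big_set0 sub0set.
have ci0 : c i != set0 by apply: (c_neq0 Ki); rewrite inE.
have [j1 j1c] := set0Pn _ ci0.
(* [q j] is the multiple at which coordinate [j] vanishes; the least of these keeps all coordinates
   nonnegative and kills [j0]. *)
pose q j := z j / bary (c i) j.
case: (arg_minP q j1c) => j0 j0c j0min.
pose t := q j0.
have b0 j : j \in c i -> 0 < bary (c i) j by rewrite bary_gt0.
have t0 : 0 < t.
  rewrite divr_gt0 ?b0 // lt0r z0 andbT.
  by have := subsetP cz _ j0c; rewrite inE.
pose z' : {ffun J -> R} := [ffun j => z j - t * bary (c i) j].
have z'0 j : 0 <= z' j.
  rewrite ffunE subr_ge0; have [jc|jc] := boolP (j \in c i).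
    by rewrite -ler_pdivlMr ?b0 // j0min.
  by rewrite ffunE (negPf jc) mulr0.
have sz' : supp z' \subset supp z :\ j0.
  apply/subsetP => j; rewrite !inE ffunE => h; apply/andP; split.
    by apply: contraNneq h => ->; rewrite /t /q divfK ?subrr // gt_eqF ?b0.
  apply: contraNneq h => zj; rewrite zj ffunE.
  case: ifP => jc; last by rewrite mulr0 subr0.
  by have := subsetP cz _ jc; rewrite inE zj eqxx.
have [||x' [x'0 Kx'] x'z] := IHn z'.
- have j0z : j0 \in supp z by apply: (subsetP cz).
  apply: leq_ltn_trans (subset_leq_card sz') _.
  by move: zn; rewrite (cardsD1 j0 (supp z)) j0z.
- split=> //; apply: dL Lz; apply: subset_trans sz' _; exact: subD1set.
have suppx' : covc c (supp x') \subset supp z.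
  by rewrite -supp_app // x'z; apply: subset_trans sz' _; apply: subD1set.
exists (x' + dl i t).
  split=> [k|]; first by rewrite ffunE dlE addr_ge0 //; case: ifP => _ //; apply: ltW.
  apply: dK (iK _ Kx' suppx'); apply/subsetP => k; rewrite !inE ffunE dlE.
  by case: (k == i) => //=; rewrite addr0.
by rewrite app_add x'z; apply/ffunP => j; rewrite [LHS]ffunE app_dl ffunE subrK.
Qed.

(** Two preimages of a point cover the same face, so both contain the vertex it selects. Subtracting
    the smaller of the two coefficients from both keeps the images equal and removes the vertex from
    at least one support, which drives the induction. *)
Lemma bary_inj x y : cone K x -> cone K y -> app baryM x = app baryM y -> x = y.
Proof.
have [n] := ubnP (#|supp x| + #|supp y|); elim: n x y => // n IHn x y xyn Kx Ky e.
have [x0 Kx1] := Kx; have [y0 Ky1] := Ky.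
have e' : covc c (supp x) = covc c (supp y) by rewrite -!supp_app // e.
have [ex|nx] := eqVneq (supp x) set0.
  rewrite (supp_eq0 ex); have [->|] := eqVneq y 0 => //.
  have [ey|/set0Pn[i iy]] := eqVneq (supp y) set0; first by rewrite (supp_eq0 ey) eqxx.
  have /set0Pn[j jc] := c_neq0 Ky1 iy.
  suff: j \in covc c (supp y) by rewrite -e' ex /covc big_set0 inE.
  by apply/bigcupP; exists i.
have nt : covc c (supp x) != set0.
  have [i ix] := set0Pn _ nx; have /set0Pn[j jc] := c_neq0 Kx1 ix.
  by apply/set0Pn; exists j; apply/bigcupP; exists i.
have [i [_ _ ui]] := sel (KL Kx1) nt.
have ix := ui _ Kx1 erefl; have iy := ui _ Ky1 (esym e').
pose t := Num.min (x i) (y i).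
have sub (w : {ffun I -> R}) : cone K w -> t <= w i -> cone K (w + dl i (- t)).
  move=> [w0 Kw] tw; split=> [k|].
    by rewrite ffunE dlE; have [->|_] := eqVneq k i; rewrite ?subr_ge0 ?addr0.
  apply: dK Kw; apply/subsetP => k; rewrite !inE ffunE dlE; have [->|_] := eqVneq k i.
    move=> h; apply: contraNneq h => wi; rewrite wi in tw *.
    have : 0 <= t by rewrite le_min x0 y0.
    by move=> t0; have /eqP -> : t == 0 by [rewrite eq_le tw]; rewrite subrr.
  by rewrite addr0.
have ssub (w : {ffun I -> R}) : cone K w -> t <= w i ->
    supp (w + dl i (- t)) \subset supp w.
  move=> [w0 Kw] tw; apply/subsetP => k; rewrite !inE ffunE dlE; have [->|_] := eqVneq k i.
    move=> h; apply: contraNneq h => wi; rewrite wi in tw *.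
    have : 0 <= t by rewrite le_min x0 y0.
    by move=> t0; have /eqP -> : t == 0 by [rewrite eq_le tw]; rewrite subrr.
  by rewrite addr0.
have tx : t <= x i by rewrite ge_min lexx.
have ty : t <= y i by rewrite ge_min lexx orbT.
suff: x + dl i (- t) = y + dl i (- t) by move/addIr.
apply: IHn; rewrite ?app_add ?e //; try exact: sub.
have strict (w : {ffun I -> R}) : i \in supp w -> cone K w -> t = w i ->
    (#|supp (w + dl i (- t))%R| < #|supp w|)%N.
  move=> iw Kw tw; apply: proper_card; apply/properP; split.
    by apply: ssub; rewrite ?tw.
  by exists i; rewrite // !inE ffunE dlE eqxx tw subrr eqxx.
rewrite -ltnS; apply: leq_trans xyn; rewrite ltnS.
have [xy|xy] := leP (x i) (y i).
  have tE : t = x i by rewrite /t min_l.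
  rewrite -addSn leq_add ?strict ?subset_leq_card ?ssub //.
have tE : t = y i by rewrite /t min_r // ltW.
by rewrite -addnS leq_add ?strict ?subset_leq_card ?ssub.
Qed.

Lemma cone_in x : cone K x -> cone L (app baryM x).
Proof. by move=> [x0 Kx]; split; [exact: app_ge0 | rewrite supp_app //; apply: KL]. Qed.

Lemma sum_app x : cone K x -> \sum_j app baryM x j = \sum_i x i.
Proof.
move=> [x0 Kx]; under eq_bigr => j _ do rewrite app_baryM.
rewrite exchange_big /=; apply: eq_bigr => i _; rewrite -mulr_suml.
have [->|xi] := eqVneq (x i) 0; first by rewrite mulr0.
by rewrite bary_sum ?mul1r // (c_neq0 Kx) // inE.
Qed.

(** Injectivity on the cone passes to the linear span of a face: the positive and the negative part
    of [u] both lie in the cone and have the same image. *)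
Lemma span_inj s u : K s -> supp u \subset s -> app baryM u = 0 -> u = 0.
Proof.
move=> Ks us u0.
pose p : {ffun I -> R} := [ffun i => Num.max (u i) 0].
pose m : {ffun I -> R} := [ffun i => Num.max (- u i) 0].
have upm : u = p - m.
  apply/ffunP => i; rewrite !ffunE; have [ui|nui] := boolP (0 <= u i).
    have nu : - u i <= 0 by rewrite oppr_le0.
    by rewrite (max_l ui) (max_r nu) subr0.
  have ui : u i < 0 by rewrite ltNge.
  have nu : 0 <= - u i by rewrite oppr_ge0 ltW.
  by rewrite (max_r (ltW ui)) (max_l nu) sub0r opprK.
have Kp : cone K p.
  split=> [i|]; first by rewrite ffunE le_max lexx orbT.
  apply: dK Ks; apply: subset_trans us; apply/subsetP => i; rewrite !inE ffunE.
  by apply: contraNneq => ->; rewrite maxxx.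
have Km : cone K m.
  split=> [i|]; first by rewrite ffunE le_max lexx orbT.
  apply: dK Ks; apply: subset_trans us; apply/subsetP => i; rewrite !inE ffunE.
  by apply: contraNneq => ->; rewrite oppr0 maxxx.
suff pm : p = m by rewrite upm pm subrr.
by apply: bary_inj => //; apply/eqP; rewrite -subr_eq0 -app_opp -app_add -upm u0.
Qed.

(** On the span of a face the map is linear and injective, so a single matrix inverts it on the
    image. That image is polyhedral, which makes the chosen inverse [g] piecewise linear. *)
Lemma bary_homeo : chomeo (cone K : {ffun I -> R} -> Prop) (cone L).
Proof.
have /choice[g gP] : forall y : {ffun J -> R}, exists x : {ffun I -> R},
    cone L y -> cone K x /\ app baryM x = y.
  move=> y; have [Ly|nLy] := pselect (cone L y); last by exists 0.
  by have [x Kx xy] := bary_surj Ly; exists x.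
have /choice[N NP] : forall s : {set I}, exists N : {ffun I -> {ffun J -> R}},
    K s -> (forall u, supp u \subset s -> app N (app baryM u) = u) /\
           (forall y i, i \notin s -> app N y i = 0).
  move=> s; have [Ks|nKs] := boolP (K s); last first.
    by exists [ffun=> 0].
  have [N NP] := left_inverse (fun u => @span_inj s u Ks); by exists N.
exists (app baryM), g; split.
(* The cone over the face [s]: all coordinates nonnegative, those outside [s] also nonpositive. *)
- pose cs (s : {set I}) : seq {ffun I -> R} :=
    [seq dl i (-1) | i : I] ++ [seq dl i 1 | i in [set j | j \notin s]].
  have csE s x : cut (cs s) x <-> (forall i, 0 <= x i) /\ supp x \subset s.
    split=> [h|[x0 xs] h].
      have x0 i : 0 <= x i.
        rewrite -oppr_le0 -mulN1r -lin_dl; apply: h.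
        by rewrite mem_cat; apply/orP; left; apply: image_f.
      split=> //; apply/subsetP => i; rewrite inE; apply: contraR => is0.
      rewrite eq_le x0 andbT -[x i]mul1r -lin_dl; apply: h.
      by rewrite mem_cat; apply/orP; right; apply: image_f; rewrite inE.
    rewrite mem_cat => /orP[] /imageP[i ic ->]; rewrite lin_dl.
      by rewrite mulN1r oppr_le0.
    rewrite mul1r; move: ic; rewrite inE => is0.
    suff -> : x i = 0 by [].
    by apply/eqP; apply: contraR is0 => xi; apply: (subsetP xs); rewrite inE.
  exists [seq (cs s, baryM) | s in [set s | K s]]; split=> [x|e].
    split=> [[x0 Kx]|[e /imageP[s sK ->] /csE[x0 xs]]].
      exists (cs (supp x), baryM); first by apply: (image_f (fun s => (cs s, baryM))); rewrite inE.
      exact/csE.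
    by split=> //; apply: dK xs _; move: sK; rewrite inE.
  by case/imageP=> s _ ->.
(* The image of that cone: the points [y] whose candidate preimage under [N s] is nonnegative and
   maps back to [y], this equation being written as two inequalities. *)
- pose ds (s : {set I}) : seq {ffun J -> R} :=
    [seq - N s i | i : I] ++ [seq pull (baryM j) (N s) - dl j 1 | j : J]
      ++ [seq dl j 1 - pull (baryM j) (N s) | j : J].
  have linB (T : finType) (h k x : {ffun T -> R}) : lin (h - k) x = lin h x - lin k x.
    rewrite /lin -sumrB; apply: eq_bigr => i _.
    by rewrite !ffunE mulrBl.
  have linN (T : finType) (h x : {ffun T -> R}) : lin (- h) x = - lin h x.
    by rewrite -[- h]sub0r linB /lin big1 ?sub0r // => i _; rewrite ffunE mul0r.
  have dsE s y : cut (ds s) y <->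
      (forall i, 0 <= app (N s) y i) /\ app baryM (app (N s) y) = y.
    split=> [h|[h1 h2] h].
      split=> [i|].
        rewrite ffunE -oppr_le0 -linN; apply: h; rewrite mem_cat; apply/orP; left.
        by apply: (image_f (fun i => - N s i)).
      apply/ffunP => j.
      have a : lin (pull (baryM j) (N s) - dl j 1) y <= 0.
        apply: h; rewrite !mem_cat; apply/orP; right; apply/orP; left.
        by apply: (image_f (fun j => pull (baryM j) (N s) - dl j 1)).
      have b : lin (dl j 1 - pull (baryM j) (N s)) y <= 0.
        apply: h; rewrite !mem_cat; apply/orP; right; apply/orP; right.
        by apply: (image_f (fun j => dl j 1 - pull (baryM j) (N s))).
      move: a b; rewrite !linB lin_dl mul1r lin_pull !subr_le0 => a b.
      by apply/eqP; rewrite ffunE eq_le a b.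
    rewrite !mem_cat => /or3P[] /imageP[i _ ->].
    - by rewrite linN oppr_le0; have := h1 i; rewrite ffunE.
    - rewrite linB lin_pull lin_dl mul1r -{2}h2 [X in _ - X]ffunE subrr //.
    - rewrite linB lin_pull lin_dl mul1r -{1}h2 [X in X - _]ffunE subrr //.
  have supN s y : K s -> supp (app (N s) y) \subset s.
    move=> Ks; apply/subsetP => i; rewrite inE; apply: contraR => is0.
    by rewrite (NP s Ks).2.
  exists [seq (ds s, N s) | s in [set s | K s]]; split=> [y|e].
    split=> [Ly|[e /imageP[s sK ->] /dsE[h1 h2]]].
      have [[x0 Kx] xy] := gP y Ly.
      exists (ds (supp (g y)), N (supp (g y))).
        by apply: (image_f (fun s => (ds s, N s))); rewrite inE.
      have Ng : app (N (supp (g y))) y = g y.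
        by rewrite -{2}xy (NP _ Kx).1.
      by apply/dsE; rewrite Ng.
    rewrite inE in sK; rewrite -h2; apply: cone_in; split=> //.
    by apply: dK (supN s y sK) sK.
  case/imageP=> s; rewrite inE => sK -> y /dsE[h1 h2].
  have KN : cone K (app (N s) y) by split=> //; apply: dK (supN s y sK) sK.
  have Ly : cone L y by rewrite -h2; apply: cone_in.
  have [Kg gy] := gP y Ly.
  by apply: bary_inj => //=; rewrite gy h2.
- move=> x Kx; have Lx := cone_in Kx; split=> //.
  by have [Kg gy] := gP _ Lx; apply: bary_inj.
- by move=> y /gP.
- exact: sum_app.
Qed.

End Barycentric.

(** * Boundaries of simplices and joins of spheres *)

Definition bd (n : nat) : pred {set 'I_n.+1} := fun s => s != setT.

Lemma down_bd n : down_closed (@bd n).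
Proof. by move=> s t ts; apply: contraNneq => tT; rewrite -subTset -tT. Qed.

Lemma down_join (I1 I2 : finType) (K1 : pred {set I1}) (K2 : pred {set I2}) :
  down_closed K1 -> down_closed K2 -> down_closed (joinK K1 K2).
Proof.
move=> d1 d2 s t ts /andP[k1 k2]; apply/andP; split.
  by apply: d1 k1; apply/subsetP => i; rewrite !inE; apply: (subsetP ts).
by apply: d2 k2; apply/subsetP => i; rewrite !inE; apply: (subsetP ts).
Qed.

(** Shifted by one: the boundary of the simplex with [n.+1] vertices has dimension n - 1. With this
    index joins add, and index 0 is the empty sphere. *)
Definition sph (R : realType) (n : nat) (I : finType) (K : pred {set I}) : Prop :=
  chomeo (cone K : {ffun I -> R} -> Prop) (cone (@bd n)).

Section JoinSpheres.
Variables (R : realType) (m n : nat).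

(* The join of the two boundaries is the boundary of the simplex on
   'I_(m.+1 + n), starred at the face 'I_m.+1 with the vertex 0 of 'I_n.+1. *)
Definition star_vertex (k : 'I_m.+1 + 'I_n.+1) : {set 'I_(m.+1 + n)} :=
  match k with
  | inl i => [set lshift n i]
  | inr j => if unlift ord0 j is Some k then [set rshift m.+1 k]
             else [set lshift n i | i : 'I_m.+1]
  end.

Lemma lshift_star s i :
  (lshift n i \in covc star_vertex s) = (inl i \in s) || (inr ord0 \in s).
Proof.
apply/bigcupP/orP => [[[i'|j] ks]|[h|h]].
- by rewrite inE (inj_eq (@lshift_inj _ _)) => /eqP->; left.
- rewrite /=; case: unliftP => [k _|jE _]; last by right; rewrite -jE.
  by rewrite inE eq_lrshift.
- by exists (inl i); rewrite //= inE.
- by exists (inr ord0); rewrite //= unlift_none imset_f.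
Qed.

Lemma rshift_star s k :
  (rshift m.+1 k \in covc star_vertex s) = (inr (lift ord0 k) \in s).
Proof.
apply/bigcupP/idP => [[[i'|j] ks]|h].
- by rewrite inE eq_rlshift.
- rewrite /=; case: unliftP => [k' jE|_].
    by rewrite inE (inj_eq (@rshift_inj _ _)) => /eqP->; rewrite -jE.
  by case/imsetP => i _ /eqP; rewrite eq_rlshift.
- by exists (inr (lift ord0 k)); rewrite //= liftK inE.
Qed.

(** A target face that contains the whole starred face selects the starring vertex [inr ord0]: no
    face of the join contains all the vertices [inl i], so only the starring vertex can cover the
    missing one. Any other target face lacks some [lshift n i0], so none of its preimages uses
    [inr ord0], and each of its vertices is covered by its own namesake only. *)
Lemma bd_join :
  chomeo (cone (joinK (@bd m) (@bd n)) : {ffun _ -> R} -> Prop)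
         (cone (@bd (m + n))).
Proof.
have neqT (T : finType) (s : {set T}) : reflect (exists x, x \notin s) (s != setT).
  apply: (iffP idP) => [|[x xs]]; last by apply: contraNneq xs => ->; rewrite inE.
  by rewrite -subTset => /subsetPn[x _ xs]; exists x.
apply: (@bary_homeo R _ 'I_(m.+1 + n) _ (fun s => s != setT) star_vertex).
- apply: down_join; exact: down_bd.
- exact: (@down_bd (m + n)).
- by apply/andP; split; apply/neqT; exists ord0; rewrite !inE.
- move=> s [i|j] _ _; apply/set0Pn; first by exists (lshift n i); rewrite inE.
  rewrite /=; case: unliftP => [k _|_]; first by exists (rshift m.+1 k); rewrite inE.
  by exists (lshift n ord0); apply: imset_f.
- move=> s /andP[/neqT[i]]; rewrite inE => is1 /neqT[j]; rewrite inE => js.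
  apply/neqT; have [h|h] := boolP (inr ord0 \in s).
    move: js; case: (unliftP ord0 j) => [k ->|->] js; last by rewrite h in js.
    by exists (rshift m.+1 k); rewrite rshift_star.
  by exists (lshift n i); rewrite lshift_star (negPf is1).
- move=> t /neqT[k0 k0t] /set0Pn[k1 k1t].
  have [all|/forallPn[i0 i0t]] := boolP [forall i, lshift n i \in t].
    exists (inr ord0); split.
    + by rewrite /= unlift_none; apply/subsetP => _ /imsetP[i _ ->]; apply: (forallP all).
    + move=> s /andP[k1s k2s] st; apply/andP; split.
        have -> // : [set i | inl i \in inr ord0 |: s] = [set i | inl i \in s].
        by apply/setP => i; rewrite !inE.
      move: k0t; case: (split_ordP k0) => [i ->|k -> kt].
        by rewrite (forallP all).
      apply/neqT; exists (lift ord0 k); rewrite !inE negb_or.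
      apply/andP; split; first by apply/eqP => -[].
      by rewrite -rshift_star; apply: contra kt; apply: (subsetP st).
    + move=> s /andP[/neqT[i]]; rewrite inE => is1 _ e.
      by have := forallP all i; rewrite -e lshift_star (negPf is1).
  have n0 s : covc star_vertex s \subset t -> inr ord0 \notin s.
    move=> st; apply: contra i0t => h; apply: (subsetP st).
    by rewrite lshift_star h orbT.
  move: k1t; case: (split_ordP k1) => [i ->|k ->] kt.
    exists (inl i); split; first by rewrite sub1set.
      move=> s /andP[k1s k2s] st; apply/andP; split.
        apply/neqT; exists i0; rewrite !inE negb_or; apply/andP; split.
          by apply: contraNneq i0t => -[->].
        by apply: contra i0t => h; apply: (subsetP st); rewrite lshift_star h.
      have -> // : [set j | inr j \in inl i |: s] = [set j | inr j \in s].
      by apply/setP => j; rewrite !inE.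
    move=> s _ e; have := n0 s; rewrite e subxx => /(_ isT) h.
    by move: kt; rewrite -e lshift_star (negPf h) orbF.
  exists (inr (lift ord0 k)); split; first by rewrite /= liftK sub1set.
    move=> s /andP[k1s k2s] st; apply/andP; split.
      have -> // : [set i | inl i \in inr (lift ord0 k) |: s] = [set i | inl i \in s].
      by apply/setP => i; rewrite !inE.
    apply/neqT; exists ord0; rewrite !inE negb_or n0 // andbT.
  by move=> s _ e; rewrite -rshift_star e.
Qed.

Lemma sph_join (I1 I2 : finType) (K1 : pred {set I1}) (K2 : pred {set I2}) :
  sph R m K1 -> sph R n K2 -> sph R (m + n) (joinK K1 K2).
Proof. by move=> h1 h2; apply: chomeo_trans (chomeo_join h1 h2) bd_join. Qed.

End JoinSpheres.

(** Both maps preserve the coordinate sum, hence restrict to the slices at sum 1. A piece is sliced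
    by adding this equation as two inequalities, and its matrix is reused with zero constant
    term. *)
Lemma sph_pl_sphere (R : realType) (n : nat) (I : finType) (K : pred {set I})
    (X : {ffun I -> R} -> Prop) :
  (forall x, X x <-> cone K x /\ \sum_i x i = 1) -> sph R n K -> pl_sphere n X.
Proof.
have plmap (J L : finType) (Y : {ffun J -> R} -> Prop) (f : _ -> {ffun L -> R})
    (Z : {ffun J -> R} -> Prop) : cpl_map Y f ->
    (forall x, Z x <-> Y x /\ \sum_i x i = 1) -> pl_map Z f.
  move=> [cv [Yc fc]] ZY.
  pose one : {ffun J -> R} := [ffun=> 1].
  pose e (c : seq {ffun J -> R} * {ffun L -> {ffun J -> R}}) :
      seq ({ffun J -> R} * R) :=
    (one, 1) :: (- one, -1) :: [seq (h, 0) | h <- c.1].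
  have eE c x : convex_polyhedron (e c) x <-> cut c.1 x /\ \sum_i x i = 1.
    have oneE : \sum_i one i * x i = \sum_i x i.
      by apply: eq_bigr => i _; rewrite ffunE mul1r.
    have oneN : \sum_i (- one) i * x i = - \sum_i x i.
      by rewrite -sumrN; apply: eq_bigr => i _; rewrite !ffunE mulN1r.
    split=> [h|[h1 h2] h].
      split=> [k kc|].
        by have := h (k, 0); rewrite !inE (map_f (fun h => (h, 0 : R))) ?orbT //; apply.
      apply/eqP; rewrite eq_le -oneE.
      have := h (one, 1); rewrite inE eqxx => /(_ isT) /= ->.
      have := h (- one, -1); rewrite !inE eqxx orbT => /(_ isT) /=.
      by rewrite oneN lerN2 oneE.
    rewrite !inE => /or3P[/eqP->|/eqP->|/mapP[k kc ->]] /=.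
    - by rewrite oneE h2.
    - by rewrite oneN h2.
    - exact: h1.
  exists [seq e c | c <- cv]; split=> [x|s].
    split=> [/ZY[/Yc[c ci cx] x1]|[s /mapP[c ci ->] /eE[h1 h2]]].
      by exists (e c); [apply: map_f | apply/eE].
    by apply/ZY; split=> //; apply/Yc; exists c.
  case/mapP=> c ci ->; exists (fun j i => c.2 j i), (fun=> 0) => x /eE[h1 h2] j.
  by rewrite (fc _ ci _ h1) ffunE addr0.
move=> XK [f [g [cf cg fX gY s]]].
have bdE (y : {ffun 'I_n.+1 -> R}) :
    @simplex_boundary R n y <-> cone (@bd n) y /\ \sum_i y i = 1.
  split=> [[y0 y1 [i yi]]|[[y0 yn] y1]].
    do 2!split=> //; apply/eqP => /setP/(_ i).
    by rewrite !inE yi eqxx.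
  split=> //; move: yn; rewrite /bd -subTset => /subsetPn[i _].
  by rewrite inE negbK => /eqP; exists i.
exists f, g; split.
- exact: plmap cf XK.
- exact: plmap cg bdE.
- move=> x /XK[Kx x1]; have [h1 h2] := fX _ Kx; split=> //.
  by apply/bdE; rewrite s.
- move=> y /bdE[Ky y1]; have [h1 h2] := gY _ Ky; split=> //.
  by apply/XK; rewrite -s // h2.
Qed.

(** * Complexes of chains *)

Definition chainK (T : finType) (le : rel T) (A : pred T) : pred {set T} :=
  fun s => [forall x in s, A x && [forall y in s, le x y || le y x]].

Lemma chainKP (T : finType) (le : rel T) (A : pred T) (s : {set T}) :
  reflect ((forall x, x \in s -> A x) /\
           forall x y, x \in s -> y \in s -> le x y || le y x) (chainK le A s).
Proof.
apply: (iffP 'forall_implyP) => [h|[h1 h2] x xs].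
  split=> [x /h/andP[] //|x y /h/andP[_ /'forall_implyP]]; exact.
by rewrite h1 //=; apply/'forall_implyP => y; apply: h2.
Qed.

Lemma down_chain (T : finType) (le : rel T) (A : pred T) : down_closed (chainK le A).
Proof.
move=> s t /subsetP ts /chainKP[h1 h2]; apply/chainKP; split=> [x /ts/h1 //|x y xt yt].
by apply: h2; apply: ts.
Qed.

Lemma chain0 (T : finType) (le : rel T) (A : pred T) : chainK le A set0.
Proof. by apply/chainKP; split=> x; rewrite ?inE // => y; rewrite inE. Qed.

Lemma chain_max (T : finType) (le : rel T) (s : {set T}) :
  reflexive le -> transitive le ->
  (forall x y, x \in s -> y \in s -> le x y || le y x) -> s != set0 ->
  exists2 x, x \in s & forall y, y \in s -> le y x.
Proof.
move=> rf tr ch /set0Pn[x0 x0s].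
pose f x := #|[set y in s | le y x]|.
case: (arg_maxnP f x0s) => x xs xmax; exists x => // y ys.
have /orP[xy|//] := ch x y xs ys.
have sub : [set z in s | le z x] \subset [set z in s | le z y].
  by apply/subsetP => z; rewrite !inE => /andP[-> /= /tr]; apply.
have /eqP e : [set z in s | le z x] == [set z in s | le z y].
  by rewrite eqEcard sub; apply: xmax.
by have : y \in [set z in s | le z y] by [rewrite inE ys rf]; rewrite -e inE => /andP[].

Qed.

(** * Fiber products over a two-element chain *)

(* In the poset obtained by adding a bottom and a top, [None] stands for the
   bottom on the low side ([b = false]) and for the top on the high side. *)
Definition ole (T : finType) (le : rel T) (b : bool) (o : option T)
    (b' : bool) (o' : option T) : bool :=
  match o, o' with
  | Some x, Some y => le x y
  | None, None => b ==> b'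
  | None, Some _ => ~~ b
  | Some _, None => b'
  end.

Section Factor.
Variables (T : finType) (le : rel T) (A : pred T) (s : T -> bool).
Hypotheses (rf : reflexive le) (tr : transitive le) (asym : antisymmetric le).
Hypothesis mono : forall a b, A a -> A b -> le a b -> s a -> s b.

Definition compat (t : {set T}) (b : bool) (o : option T) : Prop :=
  forall a, o = Some a -> [/\ a \in t, A a & s a = b].

(* The element of [t] on the side [b] which is closest to the other side. *)
Lemma innermost (b : bool) (t : {set T}) : chainK le A t -> exists o,
  [/\ compat t b o, o = None -> forall a, a \in t -> s a = ~~ b,
      forall o', compat t b o' ->
        if b then ole le true o true o' else ole le false o' false o,
      forall o', compat t b o' -> (forall a, a \in t -> s a = b ->
        if b then ole le true o' true (Some a)
        else ole le false (Some a) false o') -> o' = o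
    & b = false -> forall o', compat t true o' -> ole le false o true o'].
Proof.
move=> /chainKP[tA ch]; pose d x y := if b then le y x else le x y.
have rd : reflexive d by rewrite /d => x; case: (b); apply: rf.
have td : transitive d.
  by rewrite /d => x y z; case: (b) => [h1 h2|]; [exact: tr h2 h1 | exact: tr].
have [e|ne] := eqVneq [set a in t | s a == b] set0.
  have tb a : a \in t -> s a = ~~ b.
    move=> at1; have := in_set0 a; rewrite -e inE at1 /=.
    by case: (s a) (b) => -[].
  exists None; split=> // [o'|o'|_ [] //]; case: o' => [a|] //.
  - by move=> /(_ a erefl)[/tb ->]; case: (b).
  - by case: (b).
  - by move=> /(_ a erefl)[/tb ->]; case: (b).
have [|a] := chain_max rd td _ ne.
  move=> x y; rewrite !inE => /andP[xt _] /andP[yt _]; have := ch x y xt yt.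
  by rewrite /d; case: (b); rewrite // orbC.
rewrite inE => /andP[at1 /eqP sa] amax; exists (Some a); split=> //.
- by move=> _ [<-]; split=> //; apply: tA.
- move=> [c|] co; last by case: (b).
  have [ct _ sc] := co c erefl.
  by have := amax c; rewrite inE ct sc eqxx /d => /(_ isT); case: (b).
- move=> [c|] co h; last by have := h a at1 sa; case: (b).
  have [ct _ sc] := co c erefl.
  have := amax c; rewrite inE ct sc eqxx /d => /(_ isT).
  have := h a at1 sa; case: (b) => /= h1 h2; congr Some; apply: asym.
    by rewrite h1 h2.
  by rewrite h1 h2.
- move=> b0 [c|] // co; have [ct Ac sc] := co c erefl.
  have /orP[//|ca] := ch a c at1 ct.
  by have := mono Ac (tA _ at1) ca; rewrite sc sa b0 => /(_ isT).
Qed.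

End Factor.

Section Fiber.
Variables (R : realType) (I I1 I2 : finType).
Variables (le : rel I) (le1 : rel I1) (le2 : rel I2).
Variables (A : pred I) (A1 : pred I1) (A2 : pred I2).
Variables (s : I -> bool) (s1 : I1 -> bool) (s2 : I2 -> bool).
Variables (p1 : I -> option I1) (p2 : I -> option I2).
Variable E : pred {set I1 + I2}.

(** A cell is sent to the barycenter of its one or two components; an absent component is an extreme
    element of a factor. The predicate [E] serves to cut the join down where not all pairs of
    components may occur together. *)
Definition comps (x : I) : {set I1 + I2} :=
  [set k | match k with inl a => p1 x == Some a | inr b => p2 x == Some b end].

Definition pr1 (t : {set I1 + I2}) : {set I1} := [set a | inl a \in t].
Definition pr2 (t : {set I1 + I2}) : {set I2} := [set a | inr a \in t].

Hypotheses (rf : reflexive le) (tr : transitive le).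
Hypotheses (rf1 : reflexive le1) (tr1 : transitive le1) (as1 : antisymmetric le1).
Hypotheses (rf2 : reflexive le2) (tr2 : transitive le2) (as2 : antisymmetric le2).
Hypothesis leE : forall x y, A x -> A y ->
  le x y = [&& s x ==> s y, ole le1 (s x) (p1 x) (s y) (p1 y)
             & ole le2 (s x) (p2 x) (s y) (p2 y)].
Hypothesis comp1 : forall x a, A x -> p1 x = Some a -> A1 a /\ s1 a = s x.
Hypothesis comp2 : forall x a, A x -> p2 x = Some a -> A2 a /\ s2 a = s x.
Hypothesis comp_neq0 : forall x, A x -> ~ (p1 x = None /\ p2 x = None).
Hypothesis mono1 : forall a b, A1 a -> A1 b -> le1 a b -> s1 a -> s1 b.
Hypothesis mono2 : forall a b, A2 a -> A2 b -> le2 a b -> s2 a -> s2 b.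
Hypothesis code_inj : forall x y, A x -> A y ->
  s x = s y -> p1 x = p1 y -> p2 x = p2 y -> x = y.
Hypothesis dE : down_closed E.
Hypothesis E_comps : forall t, chainK le A t -> E (covc comps t).
Hypothesis code_surj : forall t b o1 o2, E t ->
  compat A1 s1 (pr1 t) b o1 -> compat A2 s2 (pr2 t) b o2 ->
  ~ (o1 = None /\ o2 = None) ->
  exists x, [/\ A x, s x = b, p1 x = o1 & p2 x = o2].

Lemma in_comps1 (t : {set I}) a :
  reflect (exists2 x, x \in t & p1 x = Some a) (inl a \in covc comps t).
Proof.
apply: (iffP bigcupP) => [[x xt]|[x xt e]]; last by exists x; rewrite // inE e.
by rewrite inE => /eqP e; exists x.
Qed.

Lemma in_comps2 (t : {set I}) a :
  reflect (exists2 x, x \in t & p2 x = Some a) (inr a \in covc comps t).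
Proof.
apply: (iffP bigcupP) => [[x xt]|[x xt e]]; last by exists x; rewrite // inE e.
by rewrite inE => /eqP e; exists x.
Qed.

Lemma chain_comps t : chainK le A t ->
  joinK (chainK le1 A1) (chainK le2 A2) (covc comps t).
Proof.
move=> /chainKP[tA ch]; apply/andP; split; apply/chainKP; split=> [a|a b].
- by rewrite inE => /in_comps1[x /tA Ax /(comp1 Ax)[]].
- rewrite !inE => /in_comps1[x xt xa] /in_comps1[y yt yb].
  have := ch x y xt yt; rewrite !leE ?tA // xa yb /=.
  by case/orP => /and3P[_ -> _]; rewrite ?orbT.
- by rewrite inE => /in_comps2[x /tA Ax /(comp2 Ax)[]].
- rewrite !inE => /in_comps2[x xt xa] /in_comps2[y yt yb].
  have := ch x y xt yt; rewrite !leE ?tA // xa yb /=.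
  by case/orP => /and3P[_ _ ->]; rewrite ?orbT.
Qed.

(* A face of the join selects the pair of its innermost low components or, if
   it has none, of its innermost high components. *)
Lemma fiber_sel t : joinK (chainK le1 A1) (chainK le2 A2) t && E t -> t != set0 ->
  exists x, [/\ comps x \subset t,
    forall r, chainK le A r -> covc comps r \subset t -> chainK le A (x |: r)
    & forall r, chainK le A r -> covc comps r = t -> x \in r].
Proof.
move=> /andP[/andP[ch1 ch2] Et] t0.
pose sk (k : I1 + I2) := match k with inl a => s1 a | inr a => s2 a end.
(* The side to be used: the low one if [t] meets it, otherwise the high one. The value of [s1] and
   [s2] on that side is [~~ low]. *)
pose low := [exists k in t, ~~ sk k].
have [o1 [co1 no1 in1 un1 lh1]] := innermost rf1 tr1 as1 mono1 (~~ low) ch1.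
have [o2 [co2 no2 in2 un2 lh2]] := innermost rf2 tr2 as2 mono2 (~~ low) ch2.
(* Were both components absent, all of [t] would lie on the other side, against the choice of the
   side. *)
have o0 : ~ (o1 = None /\ o2 = None).
  move=> [/no1 n1 /no2 n2].
  have side k : k \in t -> sk k = low.
    by case: k => a at1; rewrite /sk ?n1 ?n2 ?negbK // inE.
  have [k kt] := set0Pn _ t0.
  have : low.
    apply: contraT => nl; move/negP: (nl); case.
    by rewrite /low; apply/exists_inP; exists k; rewrite // side.
  move=> l; have := l; rewrite {1}/low => /exists_inP[k' k't].
  by rewrite side // l.
have [x [Ax sx x1 x2]] := code_surj Et co1 co2 o0.
have ct1 y : A y -> comps y \subset t -> compat A1 s1 (pr1 t) (s y) (p1 y).
  move=> Ay /subsetP yt a ya; have [Aa sa] := comp1 Ay ya; split=> //.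
  by rewrite inE; apply: yt; rewrite inE ya.
have ct2 y : A y -> comps y \subset t -> compat A2 s2 (pr2 t) (s y) (p2 y).
  move=> Ay /subsetP yt a ya; have [Aa sa] := comp2 Ay ya; split=> //.
  by rewrite inE; apply: yt; rewrite inE ya.
have xt : comps x \subset t.
  apply/subsetP => -[a|a]; rewrite inE => /eqP e.
    by have [] := co1 a; rewrite -?x1 ?inE.
  by have [] := co2 a; rewrite -?x2 ?inE.
have highc y : A y -> comps y \subset t -> ~~ low -> s y.
  move=> Ay /subsetP yt; apply: contraR => sy.
  rewrite /low; apply/exists_inP; case y1: (p1 y) => [a|].
    exists (inl a); first by apply: yt; rewrite inE y1.
    by have [_ /= ->] := comp1 Ay y1.
  case y2: (p2 y) => [a|]; last by case: (comp_neq0 Ay).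
  exists (inr a); first by apply: yt; rewrite inE y2.
  by have [_ /= ->] := comp2 Ay y2.
clearbody low.
(* If [x] is low, it is the greatest low cell carried by [t] and lies below every high one; if
   nothing in [t] is low, [x] is the least high cell. *)
have xle y : A y -> comps y \subset t -> le x y || le y x.
  move=> Ay yt; have c1 := ct1 y Ay yt; have c2 := ct2 y Ay yt.
  rewrite !leE // sx x1 x2; case lowE: low lh1 lh2 in1 in2 => /= lh1 lh2 in1 in2.
    case sy: (s y) c1 c2 => c1 c2; first by rewrite /= lh1 // lh2.
    by apply/orP; right; rewrite /= in1 // in2.
  have sy : s y by apply: highc; rewrite ?lowE.
  by rewrite sy in c1 c2 *; rewrite /= in1 // in2.
exists x; split=> // r.
  move=> /chainKP[rA rch] rt; apply/chainKP.
  have yt y : y \in r -> comps y \subset t.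
    by move=> yr; apply: subset_trans rt; apply: bigcup_sup.
  split=> [y|y z]; rewrite !inE; first by case/predU1P => [->|/rA].
  case/predU1P => [->|yr]; case/predU1P => [->|zr]; rewrite ?rf //.
  - by apply: xle; [exact: rA | exact: yt].
  - by rewrite orbC; apply: xle; [exact: rA | exact: yt].
  - exact: rch.
move=> /chainKP[rA rch] rt.
have yt y : y \in r -> comps y \subset t by move=> yr; rewrite -rt; apply: bigcup_sup.
pose d y z := if low then le y z else le z y.
have rd : reflexive d by rewrite /d => y; case: ifP.
have td : transitive d.
  by rewrite /d => y z w; case: ifP => _ h1 h2; [exact: tr h1 h2 | exact: tr h2 h1].
have o1r a : inl a \in t -> s1 a = ~~ low -> exists y, [/\ y \in r, s y = ~~ low & p1 y = Some a].
  rewrite -rt => /in_comps1[y yr ya] sa; exists y; split=> //.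
  by have [_ <-] := comp1 (rA _ yr) ya.
have o2r a : inr a \in t -> s2 a = ~~ low -> exists y, [/\ y \in r, s y = ~~ low & p2 y = Some a].
  rewrite -rt => /in_comps2[y yr ya] sa; exists y; split=> //.
  by have [_ <-] := comp2 (rA _ yr) ya.
(* [m] is the cell of [r] on the selected side that is nearest to the other side. Every component on
   the selected side comes from a cell of [r] on that side, so it is no nearer than the component of
   [m]; uniqueness of the innermost components identifies [x] with [m]. *)
have [||m] := @chain_max _ d [set y in r | s y == ~~ low] rd td.
- move=> y z; rewrite !inE => /andP[yr _] /andP[zr _]; have := rch y z yr zr.
  by rewrite /d; case: ifP => // _; rewrite orbC.
- apply/set0Pn; case: (o1) co1 o0 => [a co _|_ o0].
    have [at1 _ sa] := co a erefl; rewrite inE in at1.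
    by have [y [yr sy _]] := o1r a at1 sa; exists y; rewrite inE yr sy eqxx.
  case: (o2) co2 o0 => [a co _|_ []//].
  have [at1 _ sa] := co a erefl; rewrite inE in at1.
  by have [y [yr sy _]] := o2r a at1 sa; exists y; rewrite inE yr sy eqxx.
rewrite inE => /andP[mr /eqP sm] mmax; have Am := rA _ mr.
have cmp y : y \in r -> s y = ~~ low -> d y m.
  by move=> yr sy; apply: mmax; rewrite inE yr sy eqxx.
suff -> : x = m by [].
apply: code_inj; rewrite ?sx ?x1 ?x2 ?sm //; apply/esym.
  apply: un1; first by rewrite -sm; apply: ct1; rewrite ?yt.
  move=> a; rewrite inE => at1 sa; have [y [yr sy ya]] := o1r a at1 sa.
  have := cmp y yr sy; rewrite /d !leE ?rA // sm sy ya; case: (low) => /=.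
    by case/andP.
  by case/andP.
apply: un2; first by rewrite -sm; apply: ct2; rewrite ?yt.
move=> a; rewrite inE => at1 sa; have [y [yr sy ya]] := o2r a at1 sa.
have := cmp y yr sy; rewrite /d !leE ?rA // sm sy ya; case: (low) => /=.
  by case/andP.
by case/andP.
Qed.

Lemma fiber_homeo : chomeo (cone (chainK le A) : {ffun I -> R} -> Prop)
  (cone (fun t => joinK (chainK le1 A1) (chainK le2 A2) t && E t)).
Proof.
apply: (@bary_homeo R _ _ _ _ comps).
- exact: down_chain.
- move=> u t tu /andP[h1 h2]; apply/andP; split; last exact: dE h2.
  by apply: down_join h1 => //; apply: down_chain.
- exact: chain0.
- move=> r x /chainKP[rA _] /rA Ax; apply/set0Pn.
  case y1: (p1 x) => [a|]; first by exists (inl a); rewrite inE y1.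
  case y2: (p2 x) => [a|]; first by exists (inr a); rewrite inE y2.
  by case: (comp_neq0 Ax).
- by move=> r rK; rewrite chain_comps // E_comps.
- exact: fiber_sel.
Qed.


End Fiber.

(** The case where each vertex goes to a single vertex. Only elements of [U] occur in faces, so
    index types may have idle elements, on which [f] is arbitrary. *)
Lemma relabel_homeo (R : realType) (I J : finType) (K : pred {set I})
    (L : pred {set J}) (U : pred I) (f : I -> J) :
  down_closed K -> down_closed L -> K set0 ->
  (forall s i, K s -> i \in s -> U i) -> {in U &, injective f} ->
  (forall s : {set I}, (forall i, i \in s -> U i) -> K s = L (f @: s)) ->
  (forall j, L [set j] -> exists2 i, U i & f i = j) ->
  chomeo (cone K : {ffun I -> R} -> Prop) (cone L).
Proof.
move=> dK dL K0 KU fi KL LU.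
have covE s : covc (fun i => [set f i]) s = f @: s.
  apply/setP => j; apply/bigcupP/imsetP => [[i is1]|[i is1 ->]].
    by rewrite inE => /eqP->; exists i.
  by exists i; rewrite // inE.
apply: (@bary_homeo R _ _ _ _ (fun i => [set f i])) => //.
- by move=> s i _ _; apply/set0Pn; exists (f i); rewrite inE.
- by move=> s Ks; rewrite covE -KL // => i; apply: KU.
- move=> t Lt /set0Pn[j jt].
  have [|i Ui ij] := LU j; first by apply: dL Lt; rewrite sub1set.
  exists i; split; first by rewrite sub1set ij.
    move=> r Kr; rewrite covE => rt; rewrite KL.
      apply: dL Lt; rewrite imsetU1 subUset sub1set ij jt; exact: rt.
    by move=> k; rewrite !inE => /predU1P[-> //|]; apply: KU.
  move=> r Kr; rewrite covE => rt; move: jt; rewrite -rt -ij => /imsetP[k kr].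
  by move/fi => -> //; apply: KU kr.
Qed.

Lemma sph_empty (R : realType) (I : finType) (K : pred {set I}) :
  (forall s, K s = (s == set0)) -> sph R 0 K.
Proof.
move=> KE; apply: (@relabel_homeo R _ _ _ _ pred0 (fun=> ord0)) => //.
- by move=> s t; rewrite !KE => + /eqP s0; rewrite s0 subset0.
- exact: down_bd.
- by rewrite KE.
- by move=> s i; rewrite KE => /eqP ->; rewrite inE.
- move=> s s0; have -> : s = set0 by apply/setP => i; rewrite inE; apply/negP => /s0.
  rewrite imset0 KE eqxx; apply/esym; rewrite /bd.
  by apply/eqP => /setP/(_ ord0); rewrite !inE.
- move=> j; rewrite /bd => /eqP[]; apply/setP => i; rewrite !inE.
  by rewrite (ord1 i) (ord1 j).
Qed.

Lemma chain_relabel (R : realType) (I J : finType) (leI : rel I) (leJ : rel J)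
    (A : pred I) (B : pred J) (f : I -> J) :
  {in A &, injective f} -> (forall x, A x -> B (f x)) ->
  (forall y, B y -> exists2 x, A x & f x = y) ->
  (forall x y, A x -> A y -> leJ (f x) (f y) = leI x y) ->
  chomeo (cone (chainK leI A) : {ffun I -> R} -> Prop) (cone (chainK leJ B)).
Proof.
move=> fi AB BA fle; apply: (@relabel_homeo R _ _ _ _ A f) => //.
- exact: down_chain.
- exact: down_chain.
- exact: chain0.
- by move=> s i /chainKP[h _]; apply: h.
- move=> s sA; apply/chainKP/chainKP => -[h1 h2]; split.
  + by move=> _ /imsetP[x xs ->]; apply/AB/sA.
  + by move=> _ _ /imsetP[x xs ->] /imsetP[y ys ->]; rewrite !fle ?sA //; apply: h2.
  + exact: sA.
  + move=> x y xs ys; have := h2 _ _ (imset_f f xs) (imset_f f ys).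
    by rewrite !fle ?sA.
- by move=> j /chainKP[h _]; apply: BA; apply: h; rewrite inE.
Qed.

(** * Sets as bit sequences, ordered by inclusion *)

Definition bsub (a b : bitseq) : bool := all2 implb a b.

Lemma bsub_refl : reflexive bsub.
Proof. by elim=> //= x a ->; rewrite implybb. Qed.

Lemma bsub_trans : transitive bsub.
Proof.
elim=> [|y b IH] [|x a] [|z c] //= /andP[xy ab] /andP[yz bc].
by rewrite (IH _ _ ab bc) andbT; case: x y z xy yz => [] [] [].
Qed.

Lemma bsub_anti : antisymmetric bsub.
Proof.
elim=> [|x a IH] [|y b] //= /andP[/andP[xy ab] /andP[yx ba]].
by rewrite (IH b) ?ab //; case: x y xy yx => [] [].
Qed.

Lemma bsub_size a b : bsub a b -> size a = size b.
Proof. by elim: a b => [|x a IH] [|y b] //= /andP[_ /IH ->]. Qed.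

Lemma bsub_cat a b c d : size a = size c ->
  bsub (a ++ b) (c ++ d) = bsub a c && bsub b d.
Proof. by elim: a c => [|x a IH] [|y c] //= [/IH ->]; rewrite andbA. Qed.

Lemma bsub0 a b : size a = size b -> true \notin a -> bsub a b.
Proof.
elim: a b => [|x a IH] [|y b] //= [/IH h]; rewrite inE negb_or => /andP[].
by case: x => // _ /h.
Qed.

Lemma bsub_true a b : bsub a b -> true \in a -> true \in b.
Proof.
elim: a b => [|x a IH] [|y b] //= /andP[xy /IH h]; rewrite !inE => /orP[/eqP e|/h ->].
  by move: xy; rewrite -e /= => ->.
by rewrite orbT.
Qed.

Lemma zero_eq a b : size a = size b -> true \notin a -> true \notin b -> a = b.
Proof. by move=> ab a0 b0; apply: bsub_anti; rewrite !bsub0. Qed.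

(** * Families whose lower intervals are spheres *)

Section Cellular.
Variable R : realType.
Implicit Types F : seq bitseq.

Definition le_in F : rel (seq_sub F) := relpre val bsub.

Definition opn F (p : bitseq) : pred (seq_sub F) :=
  fun x => [&& true \in val x, bsub (val x) p & val x != p].

Definition openK F (p : bitseq) : pred {set seq_sub F} :=
  chainK (@le_in F) (@opn F p).

(** Index [(rk p).-1] of [sph] is dimension rk p - 2: below an element of rank one lies the empty
    sphere. *)
Definition cellular F (rk : bitseq -> nat) : Prop :=
  forall p, p \in F -> true \in p -> sph R (rk p).-1 (@openK F p).

Lemma le_in_refl F : reflexive (@le_in F).
Proof. by move=> x; apply: bsub_refl. Qed.
Lemma le_in_trans F : transitive (@le_in F).
Proof. by move=> x y z; apply: bsub_trans. Qed.
Lemma le_in_anti F : antisymmetric (@le_in F).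
Proof. by move=> x y /bsub_anti/val_inj. Qed.

Definition monotone F (s : bitseq -> bool) : Prop :=
  forall a b, a \in F -> b \in F -> bsub a b -> s a -> s b.

Definition fiber F1 (s1 : bitseq -> bool) F2 (s2 : bitseq -> bool) : seq bitseq :=
  flatten [seq [seq a ++ b | b <- F2 & s1 a == s2 b] | a <- F1].

Lemma fiberP F1 s1 F2 s2 x :
  reflect (exists a b, [/\ a \in F1, b \in F2, s1 a = s2 b & x = a ++ b])
          (x \in fiber F1 s1 F2 s2).
Proof.
apply: (iffP flatten_mapP) => [[a aF /mapP[b]]|[a [b [aF bF sab ->]]]].
  by rewrite mem_filter => /andP[/eqP sab bF] ->; exists a, b.
by exists a => //; apply: map_f; rewrite mem_filter sab eqxx.
Qed.

Section FiberCellular.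
Variables (F1 F2 : seq bitseq) (m1 m2 : nat) (s1 s2 : bitseq -> bool).
Hypotheses (sz1 : forall a, a \in F1 -> size a = m1)
           (sz2 : forall a, a \in F2 -> size a = m2).
Hypotheses (b1 : nseq m1 false \in F1) (b2 : nseq m2 false \in F2).
Hypotheses (mono1 : monotone F1 s1) (mono2 : monotone F2 s2).
Hypotheses (s10 : s1 (nseq m1 false) = false) (s20 : s2 (nseq m2 false) = false).

Let F := fiber F1 s1 F2 s2.

Lemma zero1 m : true \notin nseq m false.
Proof. by rewrite mem_nseq andbF. Qed.

Lemma side_zero s m a : s (nseq m false) = false -> size a = m -> s a -> true \in a.
Proof.
move=> s0 sa; apply: contraTT => a0.
by rewrite (@zero_eq a (nseq m false)) ?size_nseq ?zero1 ?s0.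
Qed.

(* The code of an element [c] of a factor below [a], with [a] as the top. *)
Definition code (G : seq bitseq) (a : bitseq) (b : bool) (c : bitseq) :
    option (seq_sub G) :=
  if (if b then c == a else true \notin c) then None else insub c.

(** Erasing the extremes loses nothing of the order: on the low side only the empty set has no code,
    on the high side only [a], and [ole] treats the missing code as least, respectively greatest.
    Monotonicity excludes a high [c] below a low [d]. *)
Lemma code_ole (G : seq bitseq) (s : bitseq -> bool) a c d m :
  monotone G s -> (forall x, x \in G -> size x = m) ->
  s (nseq m false) = false -> a \in G -> c \in G -> d \in G ->
  bsub c a -> bsub d a ->
  bsub c d = (s c ==> s d) && ole (@le_in G) (s c) (code G a (s c) c)
                                             (s d) (code G a (s d) d).
Proof.
move=> mono sz s0 aG cG dG ca da.
have -> : bsub c d = (s c ==> s d) && bsub c d.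
  by have [/(mono _ _ cG dG)/implyP ->|] := boolP (bsub c d); rewrite ?andbF.
have szcd : size c = size d by rewrite !sz.
case: (boolP (s c ==> s d)) => //= /implyP scd; rewrite /code.
have nz x : x \in G -> s x -> true \in x by move=> /sz; apply: side_zero.
case sc: (s c) scd => scd.
  rewrite scd //; have [->|nca] := eqVneq c a.
    have [->|nda] := eqVneq d a; first by rewrite bsub_refl.
    rewrite insubT /=; apply: contraNF nda => ad.
    by apply/eqP/bsub_anti; rewrite da.
  have [->|nda] := eqVneq d a; first by rewrite ca insubT.
  by rewrite !insubT.
have [c0|c0] := boolP (true \in c) => /=; last first.
  rewrite bsub0 //; case: ifP => // _.
  by rewrite insubT.
rewrite insubT /=; case sd: (s d).
  have [->|nda] := eqVneq d a; first by rewrite ca.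
  by rewrite insubT.
have [d0|d0] := boolP (true \in d) => /=; first by rewrite insubT.
by apply: contraNF d0 => /bsub_true; apply.
Qed.

Lemma code_None G a b c : c \in G ->
  code G a b c = None -> if b then c = a else true \notin c.
Proof. by move=> cG; rewrite /code insubT; case: b; case: ifP => // /eqP. Qed.

Lemma code_Some G a b c x : code G a b c = Some x ->
  val x = c /\ (if b then c != a else true \in c).
Proof.
rewrite /code; case: b; case: ifP => // h; case: insubP => // u _ uc [<-].
  by split=> //; rewrite h.
by split=> //; apply: negbFE.
Qed.


Variables rk1 rk2 : bitseq -> nat.
Hypotheses (rk1_gt0 : forall a, a \in F1 -> true \in a -> (0 < rk1 a)%N)
           (rk2_gt0 : forall a, a \in F2 -> true \in a -> (0 < rk2 a)%N).
Hypotheses (rk1_0 : rk1 (nseq m1 false) = 0%N) (rk2_0 : rk2 (nseq m2 false) = 0%N).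
Hypotheses (cell1 : cellular F1 rk1) (cell2 : cellular F2 rk2).

(** Joins add the indices of [sph], so a high pair must satisfy rk - 1 = (rk1 - 1) + (rk2 - 1),
    while on the low side the extra 0-sphere contributes 1. The subtracted boolean is the
    difference. *)
Definition rkf (x : bitseq) : nat :=
  (rk1 (take m1 x) + rk2 (drop m1 x) - s1 (take m1 x))%N.

Lemma inF (x : seq_sub F) :
  [/\ take m1 (val x) \in F1, drop m1 (val x) \in F2
    & s1 (take m1 (val x)) = s2 (drop m1 (val x))].
Proof.
have /fiberP[a [b [aF bF sab ->]]] := valP x.
by rewrite -(sz1 aF) take_size_cat // drop_size_cat.
Qed.

Lemma cat_take_drop_inj (x y : seq_sub F) :
  take m1 (val x) = take m1 (val y) -> drop m1 (val x) = drop m1 (val y) -> x = y.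
Proof.
by move=> e1 e2; apply: val_inj; rewrite -(cat_take_drop m1 (val x)) e1 e2 cat_take_drop.
Qed.

Lemma le_inF a b (x : seq_sub F) : a \in F1 ->
  bsub (val x) (a ++ b) = bsub (take m1 (val x)) a && bsub (drop m1 (val x)) b.
Proof.
move=> aF; have [xF _ _] := inF x.
by rewrite -{1}(cat_take_drop m1 (val x)) bsub_cat // (sz1 aF) (sz1 xF).
Qed.

Lemma le_inFE (x y : seq_sub F) :
  le_in x y = bsub (take m1 (val x)) (take m1 (val y)) &&
              bsub (drop m1 (val x)) (drop m1 (val y)).
Proof. by have [yF _ _] := inF y; rewrite -le_inF // cat_take_drop. Qed.

(** A pair below [a ++ b] is determined by its side and two components, where a missing one is the
    empty set on the low side and the top on the high side. Both missing would give the empty set or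
    [a ++ b] itself, neither of which is in the open interval. Hence every face of the join occurs,
    and [E] is taken to be true. *)
Lemma sph_high a b : a \in F1 -> b \in F2 -> s1 a -> s2 b ->
  sph R ((rk1 a).-1 + (rk2 b).-1) (@openK F (a ++ b)).
Proof.
move=> aF bF sa sb.
have ta : true \in a by apply: side_zero (sz1 aF) sa.
have tb : true \in b by apply: side_zero (sz2 bF) sb.
apply: chomeo_trans (sph_join (cell1 aF ta) (cell2 bF tb)).
pose s (x : seq_sub F) := s1 (take m1 (val x)).
pose p1 (x : seq_sub F) := code F1 a (s x) (take m1 (val x)).
pose p2 (x : seq_sub F) := code F2 b (s x) (drop m1 (val x)).
have -> : joinK (@openK F1 a) (@openK F2 b) =
    (fun t => joinK (@openK F1 a) (@openK F2 b) t && true).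
  by apply: funext => t; rewrite andbT.
have below (x : seq_sub F) : opn (a ++ b) x ->
    bsub (take m1 (val x)) a /\ bsub (drop m1 (val x)) b.
  by case/and3P=> _; rewrite le_inF // => /andP.
apply: (@fiber_homeo R _ _ _ _ _ _ _ _ _ s (s1 \o val) (s2 \o val) p1 p2).
- exact: le_in_refl.
- exact: le_in_trans.
- exact: le_in_refl.
- exact: le_in_trans.
- exact: le_in_anti.
- exact: le_in_refl.
- exact: le_in_trans.
- exact: le_in_anti.
- move=> x y /below[xa xb] /below[ya yb].
  have [x1 x2 sx] := inF x; have [y1 y2 sy] := inF y.
  rewrite le_inFE (code_ole mono1 sz1 s10 aF x1 y1 xa ya).
  rewrite (code_ole mono2 sz2 s20 bF x2 y2 xb yb) -sx -sy.
  by rewrite andbACA andbb.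
- move=> x c Ax /code_Some[vc h]; have [xa xb] := below _ Ax; have [x1 _ _] := inF x.
  rewrite /= vc; split=> //; rewrite /opn vc xa /=.
  case sx: (s x) h => h; first by rewrite h andbT (side_zero s10 (sz1 x1)).
  by rewrite h /=; apply: contraFneq sx => e; rewrite /s e.
- move=> x c Ax /code_Some[vc h]; have [xa xb] := below _ Ax; have [_ x2 sx'] := inF x.
  rewrite /= vc -sx'; split=> //; rewrite /opn vc xb /=.
  case sx: (s x) h => h; first by rewrite h andbT (side_zero s20 (sz2 x2)) // -sx'.
  by rewrite h /=; apply: contraFneq sx => e; rewrite /s sx' e.
- move=> x Ax [/code_None h1 /code_None h2].
  have [x1 x2 sx] := inF x; have /and3P[nz _ np] := Ax.
  move: h1 h2; case: (s x) => h1 h2.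
    by case/negP: np; rewrite -(cat_take_drop m1 (val x)) h1 // h2.
  by case/negP: (h1 x1); move: nz; rewrite -{1}(cat_take_drop m1 (val x)) mem_cat (negPf (h2 x2)) orbF.
- by move=> c d _ _ /(mono1 (valP c) (valP d)).
- by move=> c d _ _ /(mono2 (valP c) (valP d)).
- move=> x y Ax Ay sxy e1 e2.
  have [x1 x2 _] := inF x; have [y1 y2 _] := inF y.
  have codeI G g m u v c : (forall w, w \in G -> size w = m) ->
      u \in G -> v \in G -> code G g c u = code G g c v -> u = v.
    move=> szG uG vG; case e: (code G g c v) => [w|] e'.
      by have [<- _] := code_Some e'; have [<- _] := code_Some e.
    have := code_None uG e'; have := code_None vG e.
    case: c {e e'} => [-> -> //|h1 h2]; apply: zero_eq => //; by rewrite !szG.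
  apply: cat_take_drop_inj; first by apply: (codeI F1 a m1 _ _ (s x)) => //; rewrite -/(p1 x) e1 /p1 sxy.
  by apply: (codeI F2 b m2 _ _ (s x)) => //; rewrite -/(p2 x) e2 /p2 sxy.
- by [].
- by [].
- move=> t c o1 o2 _ co1 co2 o0.
  pose u := if o1 is Some x then val x else if c then a else nseq m1 false.
  pose v := if o2 is Some x then val x else if c then b else nseq m2 false.
  have [u1 su ua] : [/\ u \in F1, s1 u = c & bsub u a].
    rewrite /u; case: o1 co1 {o0 u} => [x|] co.
      by have [_ /and3P[_ xa _] sx] := co x erefl; rewrite (valP x).
    case: c co {co2 v} => _; first by rewrite bsub_refl.
    by rewrite b1 s10 bsub0 // ?zero1 // size_nseq (sz1 aF).
  have [v1 sv vb] : [/\ v \in F2, s2 v = c & bsub v b].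
    rewrite /v; case: o2 co2 {o0 v} => [x|] co.
      by have [_ /and3P[_ xa _] sx] := co x erefl; rewrite (valP x).
    case: c co {co1 u u1 su ua} => _; first by rewrite bsub_refl.
    by rewrite b2 s20 bsub0 // ?zero1 // size_nseq (sz2 bF).
  have xF : u ++ v \in F by apply/fiberP; exists u, v; rewrite su sv.
  exists (SeqSub xF); rewrite /p1 /p2 /s /= -(sz1 u1) take_size_cat // drop_size_cat // su.
  split=> //.
  + apply/and3P; split; rewrite /= ?bsub_cat ?ua ?vb ?(sz1 u1) ?(sz1 aF) //.
      rewrite mem_cat; case cE: c.
        by rewrite (side_zero s10 (sz1 u1)) // su.
      case o1E: o1 o0 => [x|].
        by have [_ /and3P[xnz _ _] _] := co1 _ o1E; rewrite /u o1E xnz.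
      case o2E: o2 => [x|] h; last by case: h.
      by have [_ /and3P[xnz _ _] _] := co2 _ o2E; rewrite /v o2E xnz orbT.
    rewrite eqseq_cat ?(sz1 u1) ?(sz1 aF) //; apply/negP => /andP[/eqP uE /eqP vE].
    have cE : c by rewrite -su uE.
    apply: o0; split.
      case o1E: o1 => [x|] //; have [_ /and3P[_ _]] := co1 _ o1E.
      by rewrite -uE /u o1E eqxx.
    case o2E: o2 => [x|] //; have [_ /and3P[_ _]] := co2 _ o2E.
    by rewrite -vE /v o2E eqxx.
  + rewrite /code /u; case o1E: o1 => [x|]; last first.
      by case: (c); rewrite ?eqxx // zero1.
    have [_ /and3P[xnz _ xa] _] := co1 _ o1E.
    by rewrite (negPf xa) xnz /= if_same valK.
  + rewrite /code /v; case o2E: o2 => [x|]; last first.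
      by case: (c); rewrite ?eqxx // zero1.
    have [_ /and3P[xnz _ xa] _] := co2 _ o2E.
    by rewrite (negPf xa) xnz /= if_same valK.
Qed.

Definition below (G : seq bitseq) (a : bitseq) : pred (seq_sub G) :=
  fun x => (true \in val x) && bsub (val x) a.

(* The product of the two closed intervals, without its least and greatest
   elements, is the join of the two half-open intervals, without the edge
   joining their tops; separating these tops leaves a 0-sphere. *)
Definition split_tops (a b : bitseq) (k : seq_sub F1 + seq_sub F2) :
    'I_2 + (seq_sub F1 + seq_sub F2) :=
  match k with
  | inl x => if val x == a then inl ord0 else inr (inl x)
  | inr x => if val x == b then inl ord_max else inr (inr x)
  end.

Definition not_both_tops (a b : bitseq) : pred {set seq_sub F1 + seq_sub F2} :=
  fun t => ~~ ([exists x, (inl x \in t) && (val x == a)] &&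
               [exists x, (inr x \in t) && (val x == b)]).

Lemma split_tops_homeo a b : a \in F1 -> b \in F2 -> true \in a -> true \in b ->
  chomeo (cone (fun t => joinK (chainK (@le_in F1) (@below F1 a))
                           (chainK (@le_in F2) (@below F2 b)) t
                         && not_both_tops a b t) : {ffun _ -> R} -> Prop)
    (cone (joinK (@bd 1) (joinK (@openK F1 a) (@openK F2 b)))).
Proof.
move=> aF bF ta tb.
pose U : pred (seq_sub F1 + seq_sub F2) :=
  fun k => match k with inl x => below a x | inr x => below b x end.
have d_nbt : down_closed (not_both_tops a b).
  move=> s t /subsetP ts; apply: contra => /andP[/existsP[x /andP[xt xa]]].
  move=> /existsP[y /andP[yt yb]]; apply/andP; split; apply/existsP.
    by exists x; rewrite ts.
  by exists y; rewrite ts.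
have chain_top (G : seq bitseq) (c : bitseq) (r : {set seq_sub G}) : (forall x, x \in r -> below c x) ->
    chainK (@le_in G) (@below G c) r =
    chainK (@le_in G) (@opn G c) [set x in r | val x != c].
  move=> rb; apply/chainKP/chainKP => -[h1 h2]; split.
  - move=> x; rewrite inE => /andP[/h1/andP[x1 x2] x3].
    by rewrite /opn x1 x2 x3.
  - by move=> x y; rewrite !inE => /andP[xr _] /andP[yr _]; apply: h2.
  - exact: rb.
  move=> x y xr yr; have /andP[_ xc] := rb x xr; have /andP[_ yc] := rb y yr.
  have [ex|nx] := eqVneq (val x) c; first by rewrite /le_in /= ex yc orbT.
  have [ey|ny] := eqVneq (val y) c; first by rewrite /le_in /= ey xc.
  by apply: h2; rewrite inE ?xr ?yr.
apply: (@relabel_homeo R _ _ _ _ U (split_tops a b)).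
- move=> s t st /andP[h1 h2]; apply/andP; split; last exact: d_nbt h2.
  by apply: down_join h1 => //; apply: down_chain.
- by apply: down_join; [exact: down_bd | apply: down_join; exact: down_chain].
- apply/andP; split.
    by apply/andP; split; apply/chainKP; split=> x; rewrite !inE // => y; rewrite !inE.
  by apply/negP => /andP[/existsP[x]]; rewrite inE.
- move=> s [x|x] /andP[/andP[/chainKP[h1 _] /chainKP[h2 _]] _] xs.
    by apply: h1; rewrite inE.
  by apply: h2; rewrite inE.
- move=> [x|x] [y|y] _ _ /=.
  + case: eqP => [xa|_]; case: eqP => [ya|_] //; last by case=> ->.
    by move=> _; congr inl; apply: val_inj; exact: etrans xa (esym ya).
  + by case: eqP => _; case: eqP.
  + by case: eqP => _; case: eqP.
  + case: eqP => [xa|_]; case: eqP => [ya|_] //; last by case=> ->.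
    by move=> _; congr inr; apply: val_inj; exact: etrans xa (esym ya).
- move=> s sU.
  have s_l x : inl x \in s -> below a x by move/sU.
  have s_r x : inr x \in s -> below b x by move/sU.
  have top0 : (inl ord0 \in split_tops a b @: s) = [exists x, (inl x \in s) && (val x == a)].
    apply/imsetP/existsP => [[[x|x] xs /=]|[x /andP[xs xa]]].
    - by case: ifP => // xa _; exists x; rewrite xs.
    - by case: ifP.
    - by exists (inl x); rewrite //= xa.
  have top1 : (inl ord_max \in split_tops a b @: s) = [exists x, (inr x \in s) && (val x == b)].
    apply/imsetP/existsP => [[[x|x] xs /=]|[x /andP[xs xa]]].
    - by case: ifP.
    - by case: ifP => // xa _; exists x; rewrite xs.
    - by exists (inr x); rewrite //= xa.
  rewrite /joinK chain_top; last by move=> x; rewrite inE; exact: s_l.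
  rewrite chain_top; last by move=> x; rewrite inE; exact: s_r.
  rewrite andbC; congr (_ && (_ && _)).
  + rewrite /not_both_tops -top0 -top1 /bd -subTset.
    apply/idP/subsetPn => [|[i _]].
      rewrite negb_and => /orP[h|h]; first by exists ord0; rewrite !inE.
      by exists ord_max; rewrite !inE.
    rewrite inE negb_and; case: (unliftP ord0 i) => [j ->|->]; last by move=> ->.
    by rewrite (_ : lift ord0 j = ord_max) => [->|]; rewrite ?orbT //; apply: val_inj; case: j => -[].
  + congr chainK; apply/setP => x; rewrite !inE.
    apply/andP/imsetP => [[xs xa]|[[y|y] ys /=]].
    * by exists (inl x); rewrite //= (negPf xa).
    * by case: ifP => // ya [->]; rewrite ya.
    * by case: ifP.
  + congr chainK; apply/setP => x; rewrite !inE.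
    apply/andP/imsetP => [[xs xa]|[[y|y] ys /=]].
    * by exists (inr x); rewrite //= (negPf xa).
    * by case: ifP.
    * by case: ifP => // ya [->]; rewrite ya.
- move=> [i|[x|x]] /and3P[h1 /chainKP[h2 _] /chainKP[h3 _]].
  + case: (unliftP ord0 i) => [j ->|->].
      exists (inr (SeqSub bF)); first by rewrite /U /below tb bsub_refl.
      by rewrite /= eqxx; congr inl; apply: val_inj; case: j => -[].
    exists (inl (SeqSub aF)); first by rewrite /U /below ta bsub_refl.
    by rewrite /= eqxx.
  + have /and3P[x1 x2 x3] : opn a x by apply: h2; rewrite !inE.
    by exists (inl x); rewrite /= ?(negPf x3) // /below x1.
  + have /and3P[x1 x2 x3] : opn b x by apply: h3; rewrite !inE.
    by exists (inr x); rewrite /= ?(negPf x3) // /below x1.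
Qed.

(** By monotonicity everything below a low pair is low, so the fiber condition is void there and the
    interval is that of an ordinary product. With [xpred0] as the side only the empty set loses its
    code; the tops [a] and [b] stay as vertices, subject to [not_both_tops]. *)
Lemma sph_low a b : a \in F1 -> b \in F2 -> s1 a = false -> s2 b = false ->
  true \in a -> true \in b ->
  sph R (1 + ((rk1 a).-1 + (rk2 b).-1)) (@openK F (a ++ b)).
Proof.
move=> aF bF sa sb ta tb.
have bd1 : sph R 1 (@bd 1).
  apply: (@relabel_homeo R _ _ _ _ predT id) => //.
  - exact: down_bd.
  - exact: down_bd.
  - by rewrite /bd; apply: contraTneq isT => /setP/(_ ord0); rewrite !inE.
  - by move=> s _; rewrite imset_id.
  - by move=> j _; exists j.
apply: chomeo_trans (sph_join bd1 (sph_join (cell1 aF ta) (cell2 bF tb))).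
apply: chomeo_trans (split_tops_homeo aF bF ta tb).
pose p1 (x : seq_sub F) := code F1 a false (take m1 (val x)).
pose p2 (x : seq_sub F) := code F2 b false (drop m1 (val x)).
have below_p (x : seq_sub F) : opn (a ++ b) x ->
    bsub (take m1 (val x)) a /\ bsub (drop m1 (val x)) b.
  by case/and3P=> _; rewrite le_inF // => /andP.
apply: (@fiber_homeo R _ _ _ _ _ _ _ _ _ xpred0 xpred0 xpred0 p1 p2).
- exact: le_in_refl.
- exact: le_in_trans.
- exact: le_in_refl.
- exact: le_in_trans.
- exact: le_in_anti.
- exact: le_in_refl.
- exact: le_in_trans.
- exact: le_in_anti.
- move=> x y /below_p[xa xb] /below_p[ya yb].
  have [x1 x2 _] := inF x; have [y1 y2 _] := inF y.
  rewrite le_inFE (@code_ole F1 xpred0 a _ _ m1) // (@code_ole F2 xpred0 b _ _ m2) //.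
- move=> x c Ax /code_Some[vc h]; have [xa xb] := below_p _ Ax.
  by rewrite /below vc h xa.
- move=> x c Ax /code_Some[vc h]; have [xa xb] := below_p _ Ax.
  by rewrite /below vc h xb.
- move=> x Ax [/code_None h1 /code_None h2].
  have [x1 x2 _] := inF x; have /and3P[nz _ _] := Ax.
  by case/negP: (h1 x1); move: nz; rewrite -{1}(cat_take_drop m1 (val x)) mem_cat (negPf (h2 x2)) orbF.
- by [].
- by [].
- move=> x y Ax Ay _ e1 e2.
  have [x1 x2 _] := inF x; have [y1 y2 _] := inF y.
  have codeI G g m u v : (forall w, w \in G -> size w = m) ->
      u \in G -> v \in G -> code G g false u = code G g false v -> u = v.
    move=> szG uG vG; case e: (code G g false v) => [w|] e'.
      by have [<- _] := code_Some e'; have [<- _] := code_Some e.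
    have := code_None uG e'; have := code_None vG e.
    by move=> h1 h2; apply: zero_eq => //; rewrite !szG.
  apply: cat_take_drop_inj; first by apply: (codeI F1 a m1).
  by apply: (codeI F2 b m2).
- move=> s t /subsetP ts; apply: contra => /andP[/existsP[x /andP[xt xa]]].
  move=> /existsP[y /andP[yt yb]]; apply/andP; split; apply/existsP.
    by exists x; rewrite ts.
  by exists y; rewrite ts.
(* If both tops occurred in a chain, the larger of the two cells carrying them would be [a ++ b],
   which is not in the open interval. *)
- move=> t /chainKP[tA ch]; apply/negP => /andP[/existsP[c /andP[+ /eqP ca]]].
  move=> /in_comps1[x xt /code_Some[cx _]].
  move=> /existsP[d /andP[+ /eqP db]] => /in_comps2[y yt /code_Some[dy _]].
  have [xa xb] := below_p _ (tA x xt); have [ya yb] := below_p _ (tA y yt).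
  have /and3P[_ _ xp] := tA x xt; have /and3P[_ _ yp] := tA y yt.
  have := ch x y xt yt; rewrite !le_inFE -cx ca -dy db => /orP[] /andP[h1 h2].
    case/negP: yp; rewrite -(cat_take_drop m1 (val y)) -dy db.
    by rewrite (_ : take m1 _ = a) //; apply: bsub_anti; rewrite ya.
  case/negP: xp; rewrite -(cat_take_drop m1 (val x)) -cx ca.
  by rewrite (_ : drop m1 _ = b) //; apply: bsub_anti; rewrite xb.
- move=> t c o1 o2 Et co1 co2 o0.
  have cE : c = false.
    case: c co1 co2 => // co1 co2; case: o0.
    split; first by case o1E: o1 => [x|] //; have [] := co1 _ o1E.
    by case o2E: o2 => [x|] //; have [] := co2 _ o2E.
  pose u := if o1 is Some x then val x else nseq m1 false.
  pose v := if o2 is Some x then val x else nseq m2 false.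
  have [u1 ua] : u \in F1 /\ bsub u a.
    rewrite /u; case: o1 co1 {o0 u} => [x|] co.
      by have [_ /andP[_ xa] _] := co x erefl; rewrite (valP x).
    by rewrite b1 bsub0 // ?zero1 // size_nseq (sz1 aF).
  have [v1 vb] : v \in F2 /\ bsub v b.
    rewrite /v; case: o2 co2 {o0 v} => [x|] co.
      by have [_ /andP[_ xa] _] := co x erefl; rewrite (valP x).
    by rewrite b2 bsub0 // ?zero1 // size_nseq (sz2 bF).
  have su : s1 u = false by apply: contraFF sa => /(mono1 u1 aF ua).
  have sv : s2 v = false by apply: contraFF sb => /(mono2 v1 bF vb).
  have xF : u ++ v \in F by apply/fiberP; exists u, v; rewrite su sv.
  exists (SeqSub xF); rewrite /p1 /p2 /= -(sz1 u1) take_size_cat // drop_size_cat //.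
  split=> //.
  + apply/and3P; split; rewrite /= ?bsub_cat ?ua ?vb ?(sz1 u1) ?(sz1 aF) //.
      rewrite mem_cat; case o1E: o1 o0 => [x|].
        by have [_ /andP[xnz _] _] := co1 _ o1E; rewrite /u o1E xnz.
      case o2E: o2 => [x|] h; last by case: h.
      by have [_ /andP[xnz _] _] := co2 _ o2E; rewrite /v o2E xnz orbT.
    rewrite eqseq_cat ?(sz1 u1) ?(sz1 aF) //; apply/negP => /andP[/eqP uE /eqP vE].
    move/negP: Et; apply; apply/andP; split; apply/existsP.
      case o1E: o1 => [x|].
        have [xt _ _] := co1 _ o1E; exists x; rewrite inE in xt; rewrite xt.
        by rewrite -uE /u o1E eqxx.
      by move: ta; rewrite -uE /u o1E (negPf (zero1 m1)).
    case o2E: o2 => [x|].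
      have [xt _ _] := co2 _ o2E; exists x; rewrite inE in xt; rewrite xt.
      by rewrite -vE /v o2E eqxx.
    by move: tb; rewrite -vE /v o2E (negPf (zero1 m2)).
  + rewrite /code /u; case o1E: o1 => [x|]; last by rewrite zero1.
    by have [_ /andP[xnz _] _] := co1 _ o1E; rewrite xnz /= valK.
  + rewrite /code /v; case o2E: o2 => [x|]; last by rewrite zero1.
    by have [_ /andP[xnz _] _] := co2 _ o2E; rewrite xnz /= valK.
Qed.

Lemma sph_low_l a : a \in F1 -> s1 a = false -> true \in a ->
  sph R (rk1 a).-1 (@openK F (a ++ nseq m2 false)).
Proof.
move=> aF sa ta; apply: chomeo_trans (cell1 aF ta).
pose f (x : seq_sub F) : seq_sub F1 := let: And3 xF _ _ := inF x in SeqSub xF.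
have fE x : val (f x) = take m1 (val x) by rewrite /f; case: (inF x).
have low0 (x : seq_sub F) : opn (a ++ nseq m2 false) x -> drop m1 (val x) = nseq m2 false.
  have [_ x2 _] := inF x; case/and3P=> _; rewrite le_inF // => /andP[_ h] _.
  apply: zero_eq; rewrite ?size_nseq ?(sz2 x2) ?zero1 //.
  by apply: contra (zero1 m2) => /(bsub_true h).
apply: (@chain_relabel R _ _ _ _ _ _ f).
- move=> x y Ax Ay e; apply: cat_take_drop_inj; last by rewrite !low0.
  by rewrite -!fE e.
- move=> x Ax; have x0 := low0 x Ax; case/and3P: Ax; rewrite le_inF // => nz /andP[xa _] ne.
  rewrite /opn fE xa /=; move: nz ne.
  rewrite -{1 2}(cat_take_drop m1 (val x)) x0 mem_cat (negPf (zero1 _)) orbF => -> /=.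
  by apply: contra => /eqP ->.
- move=> y /and3P[y0 ya yna]; have sya : size (val y) = size a by rewrite !sz1 // (valP y).
  have xF : val y ++ nseq m2 false \in F.
    apply/fiberP; exists (val y), (nseq m2 false); split=> //; first exact: valP y.
    by rewrite s20; apply: contraFF sa => /(mono1 (valP y) aF ya).
  exists (SeqSub xF); last first.
    by apply: val_inj; rewrite fE /= take_size_cat // sz1 // (valP y).
  rewrite /opn /= mem_cat y0 bsub_cat // ya bsub_refl eqseq_cat // negb_and yna.
  by [].
- move=> x y Ax Ay; rewrite le_inFE !low0 // bsub_refl andbT.
  by rewrite /le_in /= !fE.
Qed.

Lemma sph_low_r b : b \in F2 -> s2 b = false -> true \in b ->
  sph R (rk2 b).-1 (@openK F (nseq m1 false ++ b)).
Proof.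
move=> bF sb tb; apply: chomeo_trans (cell2 bF tb).
pose f (x : seq_sub F) : seq_sub F2 := let: And3 _ xF _ := inF x in SeqSub xF.
have fE x : val (f x) = drop m1 (val x) by rewrite /f; case: (inF x).
have low0 (x : seq_sub F) : opn (nseq m1 false ++ b) x -> take m1 (val x) = nseq m1 false.
  have [x1 _ _] := inF x; case/and3P=> _; rewrite le_inF // => /andP[h _] _.
  apply: zero_eq; rewrite ?size_nseq ?(sz1 x1) ?zero1 //.
  by apply: contra (zero1 m1) => /(bsub_true h).
have sn (y : bitseq) : size (nseq m1 false) = size (nseq m1 false) by [].
apply: (@chain_relabel R _ _ _ _ _ _ f).
- move=> x y Ax Ay e; apply: cat_take_drop_inj; first by rewrite !low0.
  by rewrite -!fE e.
- move=> x Ax; have x0 := low0 x Ax; case/and3P: Ax; rewrite le_inF // => nz /andP[_ xb] ne.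
  rewrite /opn fE xb /=; move: nz ne.
  rewrite -{1 2}(cat_take_drop m1 (val x)) x0 mem_cat (negPf (zero1 _)) /= => -> /=.
  by apply: contra => /eqP ->.
- move=> y /and3P[y0 yb ynb].
  have xF : nseq m1 false ++ val y \in F.
    apply/fiberP; exists (nseq m1 false), (val y); split=> //; first exact: valP y.
    by rewrite s10; apply/esym; apply: contraFF sb => /(mono2 (valP y) bF yb).
  exists (SeqSub xF); last first.
    by apply: val_inj; rewrite fE /= drop_size_cat // size_nseq.
  by rewrite /opn /= mem_cat y0 orbT bsub_cat // yb bsub_refl eqseq_cat // eqxx.
- move=> x y Ax Ay; rewrite le_inFE !low0 // bsub_refl /=.
  by rewrite /le_in /= !fE.
Qed.

Lemma fiber_cellular : cellular F rkf.
Proof.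
move=> p /fiberP[a [b [aF bF sab ->]]]; rewrite mem_cat /rkf.
rewrite -(sz1 aF) take_size_cat // drop_size_cat //.
case sa: (s1 a) sab => /esym sb tab.
  have ta := side_zero s10 (sz1 aF) sa; have tb := side_zero s20 (sz2 bF) sb.
  have -> : (rk1 a + rk2 b - true).-1 = ((rk1 a).-1 + (rk2 b).-1)%N.
    by have := rk1_gt0 aF ta; have := rk2_gt0 bF tb; lia.
  exact: sph_high.
rewrite subn0; have [ta|na] := boolP (true \in a); last first.
  rewrite (negPf na) /= in tab.
  have -> : a = nseq m1 false by apply: zero_eq; rewrite ?size_nseq ?sz1 ?zero1.
  by rewrite rk1_0; apply: sph_low_r.
have [tb|nb] := boolP (true \in b); last first.
  have -> : b = nseq m2 false by apply: zero_eq; rewrite ?size_nseq ?sz2 ?zero1.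
  by rewrite rk2_0 addn0; apply: sph_low_l.
have -> : (rk1 a + rk2 b).-1 = (1 + ((rk1 a).-1 + (rk2 b).-1))%N.
  by have := rk1_gt0 aF ta; have := rk2_gt0 bF tb; lia.
exact: sph_low.
Qed.
End FiberCellular.

(** * Ranked families, their fiber products and the Boolean cubes *)

Record ranked_cells (m : nat) F (rk : bitseq -> nat) : Prop := RankedCells {
  rc_size : forall a, a \in F -> size a = m;
  rc_bot : nseq m false \in F;
  rc_rk0 : rk (nseq m false) = 0%N;
  rc_rk_gt0 : forall a, a \in F -> true \in a -> (0 < rk a)%N;
  rc_cell : cellular F rk }.

Lemma ranked_cells_ext m F rk rk' : {in F, rk =1 rk'} ->
  ranked_cells m F rk -> ranked_cells m F rk'.
Proof.
move=> e [h1 h2 h3 h4 h5]; split=> //; first by rewrite -e.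
  by move=> a aF; rewrite -e //; apply: h4.
by move=> p pF tp; rewrite -e //; apply: h5.
Qed.

Lemma fiber_ranked m1 F1 rk1 s1 m2 F2 rk2 s2 :
  ranked_cells m1 F1 rk1 -> ranked_cells m2 F2 rk2 ->
  monotone F1 s1 -> monotone F2 s2 ->
  s1 (nseq m1 false) = false -> s2 (nseq m2 false) = false ->
  ranked_cells (m1 + m2) (fiber F1 s1 F2 s2) (rkf m1 s1 rk1 rk2).
Proof.
move=> [sz1 b1 r1 p1 c1] [sz2 b2 r2 p2 c2] mo1 mo2 s10 s20.
have szn : size (nseq m1 false) = m1 by rewrite size_nseq.
split.
- by move=> x /fiberP[a [b [/sz1 <- /sz2 <- _ ->]]]; rewrite size_cat.
- by apply/fiberP; exists (nseq m1 false), (nseq m2 false); split; rewrite ?s10 ?nseqD.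
- by rewrite /rkf nseqD take_size_cat // drop_size_cat // s10 r1 r2.
- move=> x /fiberP[a [b [aF bF sab ->]]]; rewrite mem_cat /rkf.
  rewrite -(sz1 a) // take_size_cat // drop_size_cat //.
  case sa: (s1 a) sab => /esym sb.
    have := p1 a aF (side_zero s10 (sz1 a aF) sa).
    by have := p2 b bF (side_zero s20 (sz2 b bF) sb); lia.
  by case/orP => [/(p1 a aF)|/(p2 b bF)]; lia.
- exact: (fiber_cellular sz1 sz2 b1 b2 mo1 mo2 s10 s20 p1 p2 r1 r2 c1 c2).
Qed.

Definition bit : seq bitseq := [:: [:: false]; [:: true]].

Lemma bit_ranked : ranked_cells 1 bit (count id).
Proof.
split=> //; try by move=> a; rewrite !inE => /orP[] /eqP->.
move=> p pF tp; have {pF tp} -> : p = [:: true].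
  by move: pF tp; rewrite !inE => /orP[] /eqP->.
have none (i : seq_sub bit) : ~~ opn [:: true] i.
  have := valP i; rewrite /opn /= !inE.
  by move: (ssval i) => a /orP[] /eqP->.
apply: sph_empty => s; apply/idP/eqP => [/chainKP[h _]|->]; last exact: chain0.
by apply/setP => i; rewrite inE; apply/negP => /h; rewrite (negPf (none i)).
Qed.

(** Over constant functions the fiber product is the plain product, so the boundary of the simplex
    also comes out of [fiber_ranked]. *)
Fixpoint cube n : seq bitseq :=
  if n is n'.+1 then fiber bit xpred0 (cube n') xpred0 else [:: [::]].

Lemma cube_ranked n : ranked_cells n (cube n) (count id).
Proof.
elim: n => [|n IH]; first by split=> // a; rewrite inE => /eqP->.
have := @fiber_ranked 1 bit (count id) xpred0 n (cube n) (count id) xpred0 bit_ranked IH.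
move=> /(_ (fun _ _ _ _ _ h => h) (fun _ _ _ _ _ h => h) erefl erefl).
apply: ranked_cells_ext => x _; rewrite /rkf subn0 -count_cat.
by rewrite cat_take_drop.
Qed.

End Cellular.

(** * Stellar exchanges *)

(* A simplicial complex on 'I_n is given by the list of its facets, each one
   represented by its characteristic sequence. *)
Definition facets_of (n : nat) (l : seq bitseq) : pred {set 'I_n} :=
  fun s => has (fun f => [forall i in s, nth false f (val i)]) l.

Definition put (i : nat) (b : bool) (f : bitseq) : bitseq := set_nth false f i b.

Definition has_face (t : seq nat) (f : bitseq) : bool := all (nth false f) t.

(* The stellar subdivision at the face t, with new vertex v. *)
Definition star (v : nat) (t : seq nat) (l : seq bitseq) : seq bitseq :=
  [seq f <- l | ~~ has_face t f] ++
  flatten [seq [seq put v true (put x false f) | x <- t] | f <- l & has_face t f].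

Lemma facets_ofP n l (s : {set 'I_n}) :
  reflect (exists2 f, f \in l & forall i, i \in s -> nth false f i)
          (facets_of l s).
Proof.
apply: (iffP hasP) => [[f fl /forall_inP h]|[f fl h]]; exists f => //.
exact/forall_inP.
Qed.

Lemma down_facets n l : down_closed (@facets_of n l).
Proof.
move=> s t /subsetP ts /facets_ofP[f fl h]; apply/facets_ofP.
by exists f => // i /ts/h.
Qed.

Lemma eq_facets n l l' : l =i l' -> @facets_of n l =1 @facets_of n l'.
Proof. by move=> e s; apply: eq_has_r. Qed.

Lemma nth_put i b f j : nth false (put i b f) j = if j == i then b else nth false f j.
Proof. by rewrite nth_set_nth. Qed.

Lemma starP v t l f : reflect
  (f \in l /\ ~~ has_face t f \/
   exists g x, [/\ g \in l, has_face t g, x \in t & f = put v true (put x false g)])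
  (f \in star v t l).
Proof.
rewrite mem_cat mem_filter; apply: (iffP orP) => [[/andP[h fl]|]|].
- by left.
- move=> /flatten_mapP[g]; rewrite mem_filter => /andP[tg gl] /mapP[x xt ->].
  by right; exists g, x.
- case=> [[-> ->]|[g [x [gl tg xt ->]]]]; first by left.
  right; apply/flatten_mapP; exists g; first by rewrite mem_filter tg.
  exact: map_f.
Qed.

(** The subdivision maps to the complex by sending [v] to the barycenter of [t] and fixing the other
    vertices. A face containing [t] selects [v], since no face of the subdivision contains all of
    [t]; the preimages of any other face avoid [v], and it selects any of its own vertices. *)
Lemma star_homeo (R : realType) n v t l : (v < n)%N -> all (fun x => x < n)%N t ->
  t != [::] -> v \notin t -> all (fun f => ~~ nth false f v) l -> l != [::] ->
  chomeo (cone (@facets_of n (star v t l)) : {ffun 'I_n -> R} -> Prop)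
         (cone (@facets_of n l)).
Proof.
move=> vn /allP tn t0 vt /allP vl l0.
pose T : {set 'I_n} := [set i | val i \in t].
pose c (i : 'I_n) := if i == Ordinal vn then T else [set i].
have ht : head 0%N t \in t by move: t0; case: (t) => //= x r _; rewrite mem_head.
have tT x : x \in t -> exists2 i : 'I_n, i \in T & val i = x.
  by move=> xt; exists (Ordinal (tn _ xt)); rewrite ?inE.
have hasT f : has_face t f <-> forall i, i \in T -> nth false f (val i).
  split=> [/allP h i|h]; first by rewrite inE => /h.
  by apply/allP => x /tT[i /h + <-].
have vT : Ordinal vn \notin T by rewrite inE.
have [T1 T1T] : exists i, i \in T.
  by have [i iT _] := tT _ ht; exists i.
have inc (s : {set 'I_n}) i : i \in s -> i != Ordinal vn -> i \in covc c s.
  by move=> is1 iv; apply/bigcupP; exists i; rewrite // /c (negPf iv) inE.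
have inT (s : {set 'I_n}) i : Ordinal vn \in s -> i \in T -> i \in covc c s.
  by move=> vs iT; apply/bigcupP; exists (Ordinal vn); rewrite // /c eqxx.
have cin (s : {set 'I_n}) i : i \in covc c s -> (i \in s /\ i != Ordinal vn) \/ (Ordinal vn \in s /\ i \in T).
  move=> /bigcupP[k ks]; rewrite /c; case: eqP => [e iT|/eqP kv].
    by right; rewrite -e.
  by rewrite inE => /eqP->; left.
have facev (s : {set 'I_n}) f : f \in l -> (forall i, i \in s -> nth false f (val i)) -> Ordinal vn \notin s.
  by move=> fl h; apply/negP => /h; rewrite /= (negPf (vl f fl)).
have noT (s : {set 'I_n}) : facets_of (star v t l) s -> exists2 i, i \in T & i \notin s.
  move=> /facets_ofP[f /starP[[fl tf]|[g [x [gl tg xt ->]]]] h].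
    have [k kT kf] : exists2 k, k \in T & ~~ nth false f (val k).
      by move/allPn: tf => [x /tT[k kT <-] kf]; exists k.
    by exists k => //; apply: contra kf => /h.
  have [k kT kx] := tT x xt; exists k => //; apply/negP => /h.
  by rewrite !nth_put kx eqxx; case: eqP => // xv; rewrite -xv xt in vt.
apply: (@bary_homeo R _ _ _ _ c).
- exact: down_facets.
- exact: down_facets.
- case: l l0 {vl facev noT} => // f l _; have [h|h] := boolP (has_face t f).
    apply/facets_ofP; exists (put v true (put (head 0%N t) false f)) => [|i]; last by rewrite inE.
    by apply/starP; right; exists f, (head 0%N t); rewrite !inE !eqxx.
  apply/facets_ofP; exists f => [|i]; last by rewrite inE.
  by apply/starP; left; rewrite inE eqxx.
- move=> s i _ _; rewrite /c; case: ifP => _; apply/set0Pn; first by exists T1.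
  by exists i; rewrite inE.
- move=> s /facets_ofP[f /starP[[fl tf]|[g [x [gl tg xt ->]]]] h].
    apply/facets_ofP; exists f => // i /cin[[/h //]|[vs]].
    by case/negP: (facev s f fl h).
  apply/facets_ofP; exists g => // i /cin[[is1 iv]|[_]]; last by move/(hasT g).1: tg; apply.
  have := h i is1; rewrite !nth_put ifN //.
  by case: eqP.
- move=> r Lr /set0Pn[j jr]; have /facets_ofP[f fl rf] := Lr.
  have jv : j != Ordinal vn by apply: contraNneq (facev r f fl rf) => <-.
  have [Tr|nTr] := boolP (T \subset r).
    exists (Ordinal vn); split; first by rewrite /c eqxx.
      move=> s sK sr; have [k kT ks] := noT s sK.
      apply/facets_ofP; exists (put v true (put (val k) false f)).
        apply/starP; right; exists f, (val k); split=> //.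
          by apply/hasT => i /(subsetP Tr)/rf.
        by rewrite inE in kT.
      move=> i; rewrite !inE !nth_put -val_eqE /=; case: (altP eqP) => //= iv is1.
      case: eqP => [e|_]; first by rewrite -(val_inj e) is1 in ks.
      by apply: rf; apply: (subsetP sr); apply: inc.
    move=> s sK sr; have [k kT ks] := noT s sK.
    have := subsetP Tr k kT; rewrite -sr => /cin[[ks' _]|[]//].
    by rewrite ks' in ks.
  have nv (s : {set 'I_n}) : covc c s \subset r -> Ordinal vn \notin s.
    move=> sr; apply: contra nTr => vs; apply/subsetP => i iT.
    by apply: (subsetP sr); apply: inT.
  exists j; split; first by rewrite /c (negPf jv) sub1set.
    move=> s sK sr; have vs := nv s sr.
    have js : j |: s \subset r.
      apply/subsetP => i; rewrite !inE => /predU1P[-> //|is1].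
      by apply: (subsetP sr); apply: inc => //; apply: contraNneq vs => <-.
    apply: (down_facets js); apply/facets_ofP.
    have [h|h] := boolP (has_face t f); last by exists f => //; apply/starP; left.
    have [k kT kr] := subsetPn nTr.
    exists (put v true (put (val k) false f)).
      by apply/starP; right; exists f, (val k); rewrite inE in kT.
    move=> i ir; rewrite !nth_put; case: eqP => // _; case: eqP => [e|_]; last exact: rf.
    by rewrite (val_inj e) (negPf kr) in ir.
  move=> s sK sr; have vs : Ordinal vn \notin s by apply: nv; rewrite sr.
  by move: jr; rewrite -sr => /cin[[]|[]] //; rewrite (negPf vs).
Qed.

(* The complexes before and after a stellar exchange of the face r for the face
   t have a common stellar subdivision. *)
Definition exchange (n v : nat) (l : seq bitseq) (m : seq nat * seq nat) :
    option (seq bitseq) :=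
  let l1 := star v m.1 l in
  let old := [seq f <- l1 | ~~ nth false f v] in
  let lnk := [seq f <- l1 | nth false f v] in
  let x0 := head 0%N m.2 in
  let new := [seq put v false (put x0 true f) | f <- lnk & ~~ nth false f x0] in
  let back := flatten [seq [seq put v true (put x false f) | x <- m.2] | f <- new] in
  let ok := [&& all (fun t => [&& t != [::], v \notin t & all (fun x => x < n)%N t])
                    [:: m.1; m.2],
                all (fun f => ~~ nth false f v) l, l != [::],
                new != [::], all (fun f => ~~ has_face m.2 f) old,
                all (has_face m.2) new, all (mem back) lnk & all (mem lnk) back] in
  if ok then Some (old ++ new) else None.

(** The list [new] is a guess: a facet of [lnk] without the vertex [x0] of [m.2] should come from
    the facet with [x0] in place of [v]. The test that starring the result at [m.2] returns exactly
    the facets of [l1] validates the guess, so nothing has to be proved about links. *)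
Lemma exchange_homeo (R : realType) n v l m l' : (v < n)%N ->
  exchange n v l m = Some l' ->
  chomeo (cone (@facets_of n l) : {ffun 'I_n -> R} -> Prop) (cone (@facets_of n l')).
Proof.
rewrite /exchange; set l1 := star v _ l; set old := [seq f <- l1 | ~~ nth false f v].
set lnk := [seq f <- l1 | nth false f v]; set x0 := head _ _; set new := map _ _.
set back := flatten _ => vn; case: ifP => // ok [<-].
have /and4P[/= /and3P[/and3P[m1 v1 n1] /and3P[m2 v2 n2] _] vl l0 /and5P[new0 olds news bl lb]] := ok.
have e : l1 =i star v m.2 (old ++ new).
  rewrite /star !filter_cat; rewrite (all_filterP olds) (all_filterP news).
  have -> : [seq f <- old | has_face m.2 f] = [::].
    by apply/eqP; rewrite -[_ == _]negbK -has_filter; apply/hasPn => f /(allP olds).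
  have -> : [seq f <- new | ~~ has_face m.2 f] = [::].
    apply/eqP; rewrite -[_ == _]negbK -has_filter; apply/hasPn => f /(allP news).
    by rewrite negbK.
  rewrite cats0 cat0s -/back => f; rewrite [RHS]mem_cat.
  have -> : (f \in back) = (f \in lnk).
    by apply/idP/idP => [/(allP lb)|/(allP bl)].
  by rewrite !mem_filter -andb_orl orNb.
apply: chomeo_trans (chomeo_sym (star_homeo R vn n1 m1 v1 vl l0)) _.
rewrite -/l1 (_ : facets_of l1 = facets_of (star v m.2 (old ++ new))); last first.
  by apply: funext => s; apply: eq_facets.
apply: star_homeo => //; last by case: (old) => // ? ?.
rewrite all_cat; apply/andP; split; first exact: filter_all.
by apply/allP => _ /mapP[f _ ->]; rewrite nth_put eqxx.
Qed.

Fixpoint exchanges (n v : nat) (l : seq bitseq) (ms : seq (seq nat * seq nat)) :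
    option (seq bitseq) :=
  if ms is m :: ms' then obind (fun l' => exchanges n v l' ms') (exchange n v l m)
  else Some l.

Lemma exchanges_homeo (R : realType) n v ms l l' : (v < n)%N -> l != [::] ->
  exchanges n v l ms = Some l' ->
  chomeo (cone (@facets_of n l) : {ffun 'I_n -> R} -> Prop) (cone (@facets_of n l')).
Proof.
move=> vn; elim: ms l => [|m ms IH] l l0 /=; last first.
  case e: (exchange n v l m) => [l1|//] /= /IH h.
  apply: chomeo_trans (exchange_homeo R vn e) (h _).
  move: e; rewrite /exchange; case: ifP => // /and4P[_ _ _ /andP[n0 _]] [<-].
  by case: [seq f <- _ | _].
move=> [<-]; apply: (@relabel_homeo R _ _ _ _ (fun i => facets_of l [set i]) id) => //.
- exact: down_facets.
- exact: down_facets.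
- by case: l l0 => // f l _; apply/facets_ofP; exists f => [|i]; rewrite inE ?eqxx.
- by move=> s i sK is1; apply: down_facets sK; rewrite sub1set.
- by move=> s _; rewrite imset_id.
- by move=> j Lj; exists j.
Qed.

(** [w] lists the vertices that occur. At [k = 0] the only face is empty and no vertex occurs, so
    this case has a form of its own. *)
Definition is_boundary (n k : nat) (l : seq bitseq) : bool :=
  let w := [seq i <- iota 0 n | has (nth false ^~ i) l] in
  let fs := [seq [seq (i \in w) && (i != x) | i <- iota 0 n] | x <- w] in
  if k == 0%N then l == [:: nseq n false]
  else [&& size w == k.+1, all (mem l) fs & all (mem fs) l].

Lemma boundary_sph (R : realType) n k l : is_boundary n k l -> sph R k (@facets_of n l).
Proof.
rewrite /is_boundary; case: eqP => [->|_].
  move=> /eqP->; apply: sph_empty => s; apply/facets_ofP/eqP => [[f]|->].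
    rewrite inE => /eqP-> h; apply/setP => i; rewrite inE; apply/negP => /h.
    by rewrite nth_nseq if_same.
  by exists (nseq n false) => [|i]; rewrite inE.
set w := filter _ _; set fs := map _ w.
move=> /and3P[/eqP wk fsl lfs].
have lE : l =i fs by move=> f; apply/idP/idP => [/(allP lfs)|/(allP fsl)].
have wn x : x \in w -> (x < n)%N by rewrite mem_filter mem_iota => /andP[_].
have uw : uniq w by rewrite filter_uniq ?iota_uniq.
have ixw i : i \in w -> (index i w < k.+1)%N by rewrite -wk index_mem.
have LP (s : {set 'I_n}) : reflect
    (exists2 x, x \in w & forall i, i \in s -> val i \in w /\ val i != x) (facets_of l s).
  rewrite (eq_facets lE); apply: (iffP (facets_ofP _ _)).
    move=> [_ /mapP[x xw ->] h]; exists x => // i /h.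
    by rewrite (nth_map 0%N) ?size_iota // nth_iota // add0n => /andP[].
  move=> [x xw h]; exists [seq (i \in w) && (i != x) | i <- iota 0 n]; first exact: map_f.
  move=> i /h[h1 h2]; rewrite (nth_map 0%N) ?size_iota // nth_iota // add0n h1.
  exact: h2.
pose f (i : 'I_n) : 'I_k.+1 := inord (index (val i) w).
have w0 : exists x, x \in w by exists (nth 0%N w 0); rewrite mem_nth ?wk.
have fE (i : 'I_n) : val i \in w -> val (f i) = index (val i) w.
  by move=> iw; rewrite /= inordK ?ixw.
apply: (@relabel_homeo R _ _ _ _ (fun i => val i \in w) f) => //.
- exact: down_facets.
- exact: down_bd.
- by have [x xw] := w0; apply/LP; exists x => // i; rewrite inE.
- by move=> s i /LP[x xw h] /h[].
- move=> i j iw jw /(congr1 val); rewrite !fE // => e.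
  by apply: val_inj; rewrite /= -(nth_index 0%N iw) e nth_index.
- move=> s sw; apply/LP/idP => [[x xw h]|].
    rewrite /bd; apply/eqP => /setP/(_ (inord (index x w))); rewrite inE.
    move=> /imsetP[i is1 /(congr1 val)]; have [iw] := h i is1.
    rewrite fE // /= inordK ?ixw // => ix /(congr1 (nth 0%N w)).
    by rewrite !nth_index // => e; rewrite e eqxx in ix.
  rewrite /bd -subTset => /subsetPn[j _ js].
  exists (nth 0%N w j); first by rewrite mem_nth ?wk.
  move=> i is1; split; first exact: sw.
  apply: contraNneq js => e; apply/imsetP; exists i => //.
  by apply: val_inj; rewrite fE ?sw // e index_uniq ?wk.
- move=> j _; have jw : nth 0%N w j \in w by rewrite mem_nth ?wk.
  exists (Ordinal (wn _ jw)) => //; apply: val_inj.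
  by rewrite fE // index_uniq ?wk.
Qed.

(** * Lower intervals as complexes of maximal flags *)

Section Flags.
Variables (F : seq bitseq) (rk : bitseq -> nat).

Let elt (i : nat) : bitseq := nth [::] F i.

Definition opn_idx (p : bitseq) (i : nat) : bool :=
  [&& true \in elt i, bsub (elt i) p & elt i != p].

Definition coatoms (p : bitseq) : seq nat :=
  [seq i <- iota 0 (size F) | opn_idx p i & (rk (elt i)).+1 == rk p].

Fixpoint flags (k : nat) (p : bitseq) : seq bitseq :=
  if k is k'.+1 then
    let cs := coatoms p in
    if cs is [::] then [:: nseq (size F) false]
    else flatten [seq [seq put i true f | f <- flags k' (elt i)] | i <- cs]
  else [:: nseq (size F) false].

(** Strictly increasing rank bounds the recursion of [flags]; a coatom above every nonempty member
    strictly below [p] lets each chain be extended to one through a coatom. *)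
Definition rank_ok : bool :=
  all (fun p => let cs := [seq elt j | j <- coatoms p] in
    all (fun a => [&& true \in a, bsub a p & a != p] ==>
           ((rk a < rk p)%N && has (bsub a) cs)) F) F.

Lemma rank_okP a b : rank_ok -> a \in F -> b \in F ->
  true \in a -> bsub a b -> a != b ->
  (rk a < rk b)%N /\ exists2 j, j \in coatoms b & bsub a (elt j).
Proof.
move=> /allP ok aF bF ta ab nab; have /= /allP/(_ a aF) := ok b bF.
rewrite ta ab nab /= => /andP[lt /hasP[_ /mapP[j jb ->] aj]].
by split=> //; exists j.
Qed.

Let n := size F.

Lemma coatomsP p j : j \in coatoms p ->
  [/\ (j < n)%N, opn_idx p j & (rk (elt j)).+1 = rk p].
Proof.
by rewrite mem_filter mem_iota /= => /andP[/andP[h /eqP e] jn].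
Qed.

Definition chain_idx (p : bitseq) : pred {set 'I_n} :=
  chainK (fun i j => bsub (elt (val i)) (elt (val j))) (fun i => opn_idx p (val i)).

(** A nonempty chain strictly below [p] has a greatest element, which lies under some coatom [c];
    without [c], the chain is strictly below [c]. Ranks drop at each step, so fuel [rk p]
    suffices. *)
Lemma flagsP k p s : uniq F -> rank_ok -> p \in F -> (rk p <= k)%N ->
  facets_of (flags k p) s = chain_idx p s.
Proof.
move=> uF ok; elim: k p s => [|k IH] p s pF rkp.
  have no (i : 'I_n) : ~~ opn_idx p (val i).
    apply/negP => /and3P[h1 h2 h3].
    by have [] := rank_okP ok (mem_nth _ (ltn_ord i)) pF h1 h2 h3; lia.
  apply/facets_ofP/chainKP => [[f]|[h _]].
    rewrite inE => /eqP-> h.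
    by split=> [i /h|i j /h]; rewrite nth_nseq ltn_ord.
  exists (nseq (size F) false); first by rewrite inE.
  by move=> i /h; rewrite (negPf (no i)).
have below (i : 'I_n) : opn_idx p (val i) ->
    exists2 c : 'I_n, val c \in coatoms p & bsub (elt (val i)) (elt (val c)).
  move=> /and3P[h1 h2 h3].
  have [_ [c cp ic]] := rank_okP ok (mem_nth _ (ltn_ord i)) pF h1 h2 h3.
  by have [cn _ _] := coatomsP cp; exists (Ordinal cn).
have coP := @coatomsP p.
rewrite /=; case cE: (coatoms p) => [|c0 cs].
  have no (i : 'I_n) : ~~ opn_idx p (val i).
    by apply/negP => /below[c]; rewrite cE.
  apply/facets_ofP/chainKP => [[f]|[h _]].
    rewrite inE => /eqP-> h.
    by split=> [i /h|i j /h]; rewrite nth_nseq ltn_ord.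
  exists (nseq (size F) false); first by rewrite inE.
  by move=> i /h; rewrite (negPf (no i)).
rewrite -cE.
have IHc (c : 'I_n) : val c \in coatoms p ->
    (exists2 f, f \in flags k (elt (val c)) & forall i, i \in s -> nth false (put (val c) true f) (val i))
    <-> chain_idx (elt (val c)) (s :\ c).
  move=> /coP[_ _ rc]; rewrite -IH; last 2 first.
  - by rewrite mem_nth // ltn_ord.
  - by move: rkp; rewrite -rc; lia.
  split=> [[f fl h]|/facets_ofP[f fl h]].
    apply/facets_ofP; exists f => // i; rewrite !inE => /andP[ic /h].
    by rewrite nth_put -val_eqE /= in ic *; rewrite (negPf ic).
  exists f => // i is1; rewrite nth_put; case: eqP => // /eqP ic.
  by apply: h; rewrite !inE is1 andbT -val_eqE.
transitivity ([exists c : 'I_n, (val c \in coatoms p) && chain_idx (elt (val c)) (s :\ c)]).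
  apply/facets_ofP/existsP => [[g /flatten_mapP[c cp /mapP[f fl ->]] h]|[c /andP[cp h]]].
    have [cn _ _] := coP c cp; exists (Ordinal cn); rewrite cp.
    by apply/(IHc (Ordinal cn)) => //; exists f.
  have [f fl hf] := (IHc c cp).2 h; exists (put (val c) true f) => //.
  by apply/flatten_mapP; exists (val c) => //; apply: map_f.
apply/existsP/chainKP => [[c /andP[cp /chainKP[h1 h2]]]|[h1 h2]].
  have [_ oc _] := coP _ cp; have /and3P[c1 c2 c3] := oc.
  have belc i : i \in s -> i = c \/ opn_idx (elt (val c)) (val i).
    move=> is1; have [->|ic] := eqVneq i c; first by left.
    by right; apply: h1; rewrite !inE ic.
  split=> [i /belc[->//|/and3P[i1 i2 i3]]|i j is1 js].
    rewrite /opn_idx i1 (bsub_trans i2 c2) /=; apply: contraNneq c3 => e.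
    by apply/eqP/bsub_anti; rewrite c2 -e.
  have [->|/and3P[_ i2 _]] := belc i is1; have [->|/and3P[_ j2 _]] := belc j js.
  - by rewrite bsub_refl.
  - by rewrite j2 orbT.
  - by rewrite i2.
  have [->|ij] := eqVneq i c; first by rewrite j2 orbT.
  have [->|jc] := eqVneq j c; first by rewrite i2.
  by apply: h2; rewrite !inE ?ij ?jc.
have [c cp sc] : exists2 c : 'I_n, val c \in coatoms p &
    forall i, i \in s -> bsub (elt (val i)) (elt (val c)).
  have [s0|s0] := eqVneq s set0.
    have c0p : c0 \in coatoms p by rewrite cE mem_head.
    by have [cn _ _] := coP _ c0p; exists (Ordinal cn) => // i; rewrite s0 inE.
  have [||t ts tmax] := chain_max _ _ h2 s0.
  - by move=> i; apply: bsub_refl.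
  - by move=> i j r; apply: bsub_trans.
  have [c cp tc] := below t (h1 t ts).
  by exists c => // i /tmax it; apply: bsub_trans it tc.
exists c; rewrite cp /=; apply/chainKP; split=> [i|i j]; last first.
  by rewrite !inE => /andP[_ is1] /andP[_ js]; apply: h2.
rewrite !inE => /andP[ic is1]; have /and3P[i1 _ _] := h1 i is1.
rewrite /opn_idx i1 sc //=; by apply: contra ic; rewrite nth_uniq.
Qed.

Lemma flags_sph (R : realType) (v : nat) ms p l : uniq F -> rank_ok -> p \in F ->
  (v < size F)%N ->
  exchanges (size F) v (flags (rk p) p) ms = Some l -> is_boundary (size F) (rk p).-1 l ->
  sph R (rk p).-1 (@openK F p).
Proof.
move=> uF ok pF vn ex bl.
apply: chomeo_trans (boundary_sph R bl).
have fl0 : flags (rk p) p != [::].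
  apply/eqP => e; have := flagsP set0 uF ok pF (leqnn _).
  by rewrite e /chain_idx chain0.
apply: chomeo_trans (exchanges_homeo R vn fl0 ex).
have -> : facets_of (flags (rk p) p) = chain_idx p.
  by apply: funext => s; apply: flagsP.
pose f (x : seq_sub F) : 'I_n := Ordinal (etrans (index_mem (val x) F) (valP x)).
have fE x : elt (val (f x)) = val x by rewrite /elt /= nth_index ?(valP x).
apply: (@chain_relabel R _ _ _ _ _ _ f).
- by move=> x y _ _ e; apply: val_inj; rewrite -!fE e.
- by move=> x; rewrite /opn_idx fE.
- move=> i oi; have xF : elt (val i) \in F by apply: mem_nth; apply: ltn_ord.
  by exists (SeqSub xF) => //; apply: val_inj; exact: (index_uniq [::] (ltn_ord i) uF).
- by move=> x y _ _; rewrite !fE.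
Qed.

Definition ranked_check (m v : nat) (moves : seq (seq (seq nat * seq nat))) : bool :=
  [&& [&& uniq F, (v < size F)%N, size moves == size F & rank_ok],
    [&& all (fun a => size a == m) F, nseq m false \in F, rk (nseq m false) == 0%N &
        all (fun a => (true \in a) ==> (0 < rk a)%N) F] &
    all (fun pm => (true \in pm.1) ==>
      if exchanges (size F) v (flags (rk pm.1) pm.1) pm.2 is Some l
      then is_boundary (size F) (rk pm.1).-1 l else false) (zip F moves)].

Lemma ranked_checkP (R : realType) m v moves :
  ranked_check m v moves -> ranked_cells R m F rk.
Proof.
move=> /and3P[/and4P[uF vF /eqP sm rok] /and4P[/allP szF bot /eqP rk0 /allP gt0] /allP ms].
split=> //; [by move=> a /szF/eqP | by move=> a /gt0/implyP | move=> p pF tp].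
have pi : (index p F < size F)%N by rewrite index_mem.
have := ms (nth ([::], [::]) (zip F moves) (index p F)).
rewrite mem_nth ?size_zip ?sm ?minnn // => /(_ isT).
rewrite nth_zip ?sm //= nth_index // tp /=.
case e: (exchanges _ _ _ _) => [l|//] bl.
exact: (flags_sph R uF rok pF vF e bl).
Qed.

End Flags.

(** * An eight-vertex 4-sphere *)

(* Weighted majority; positions outside w have weight 0, and nothing wins for
   w = [::]. *)
Definition wins (w : seq nat) (x : bitseq) : bool :=
  (sumn w < (sumn (mask x w)).*2)%N.

(** Two majority conditions at once: {0,1,2} against {3,4,5,6} with weights 1,1,1,2, and {0,3,4}
    against {1,2,5,6,7} with weights 1,1,1,1,3. All four totals are odd, so there are no ties and
    complements stay in the family. *)
Definition P8 : seq bitseq :=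
  [seq x <- cube 8 | (wins [:: 1; 1; 1] x == wins [:: 0; 0; 0; 1; 1; 1; 2] x)%N
    & (wins [:: 1; 0; 0; 1; 1] x == wins [:: 0; 1; 1; 0; 0; 1; 1; 3] x)%N].

(** Each of the two conditions lowers the rank by one on its high side, as in [rkf]. *)
Definition rk8 (x : bitseq) : nat :=
  (count id x - wins [:: 1; 1; 1] x - wins [:: 1; 0; 0; 1; 1] x)%N.

(* For each member of P8, in the order of P8, the exchanges that turn the order
   complex of its lower interval into the boundary of a simplex; vertices are
   positions in P8.  Position 0 holds the empty set, which is in no interval, and
   serves as the new vertex of the subdivisions. *)
Definition P8_moves : seq (seq (seq nat * seq nat)) := (
  [:: [::]; [::]; [::]; [::]; [::]; [::]; [::]; [::]; [::]; [::]; [::]; [::]; [::];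
  [::]; [::([:: 10], [:: 13; 12]); ([:: 4], [:: 6; 13]); ([:: 3], [:: 6; 12])]; [::];
  [::([:: 10], [:: 12; 15]); ([:: 7], [:: 15; 9]); ([:: 3], [:: 12; 9])]; [::([:: 10],
  [:: 13; 15]); ([:: 7], [:: 15; 8]); ([:: 4], [:: 13; 5]); ([:: 1], [:: 8; 5]); ([::
  15], [:: 13; 8])]; [::]; [::]; [::]; [::]; [::([:: 18], [:: 21; 20]); ([:: 4], [:: 6;
  21]); ([:: 3], [:: 6; 20])]; [::]; [::([:: 18], [:: 20; 23]); ([:: 7], [:: 23; 9]);
  ([:: 3], [:: 20; 9])]; [::([:: 18], [:: 21; 23]); ([:: 7], [:: 23; 8]); ([:: 4], [::
  21; 5]); ([:: 1], [:: 8; 5]); ([:: 23], [:: 21; 8])]; [::([:: 18], [:: 19; 21]); ([::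
  10], [:: 13; 11]); ([:: 4], [:: 13; 21]); ([:: 2], [:: 19; 11]); ([:: 21], [:: 19;
  13])]; [::([:: 18], [:: 19; 23]); ([:: 10], [:: 15; 11]); ([:: 7], [:: 23; 15]); ([::
  2], [:: 19; 11]); ([:: 23], [:: 19; 15])]; [::([:: 2], [:: 27; 26]); ([:: 1], [:: 8;
  5]); ([:: 23], [:: 7; 18]); ([:: 21], [:: 25; 26]); ([:: 19], [:: 18; 27; 26]); ([::
  18], [:: 7; 26]); ([:: 15], [:: 17; 27]); ([:: 13], [:: 17; 26]); ([:: 10], [:: 17;
  11]); ([:: 4], [:: 17; 25]); ([:: 11], [:: 17; 27; 26]); ([:: 8], [:: 7; 5]); ([:: 5],
  [:: 7; 17; 25]); ([:: 7], [:: 27; 25])]; [::([:: 1], [:: 8; 5]); ([:: 23], [:: 24;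
  25]); ([:: 21], [:: 22; 25]); ([:: 18], [:: 20; 25]); ([:: 20], [:: 3; 25]); ([:: 15],
  [:: 16; 17]); ([:: 13], [:: 14; 17]); ([:: 10], [:: 12; 17]); ([:: 12], [:: 3; 17]);
  ([:: 9], [:: 7; 3]); ([:: 8], [:: 17; 25]); ([:: 6], [:: 3; 4]); ([:: 5], [:: 17; 4;
  25]); ([:: 24], [:: 3; 7; 25]); ([:: 7], [:: 16; 25]); ([:: 22], [:: 3; 4; 25]); ([::
  4], [:: 14; 25]); ([:: 3], [:: 16; 14])]; [::([:: 2], [:: 27; 26]); ([:: 23], [:: 24;
  27]); ([:: 21], [:: 22; 26]); ([:: 20], [:: 24; 22]); ([:: 19], [:: 18; 27; 26]); ([::
  18], [:: 24; 26]); ([:: 15], [:: 16; 27]); ([:: 7], [:: 9; 27]); ([:: 13], [:: 14;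
  26]); ([:: 4], [:: 14; 22]); ([:: 12], [:: 3; 10]); ([:: 11], [:: 10; 27; 26]); ([::
  9], [:: 24; 16]); ([:: 6], [:: 3; 14; 22]); ([:: 22], [:: 3; 26]); ([:: 24], [:: 3;
  27]); ([:: 16], [:: 3; 10; 27]); ([:: 10], [:: 14; 27])]; [::([:: 3], [:: 29; 30]);
  ([:: 2], [:: 28; 30]); ([:: 1], [:: 17; 25]); ([:: 23], [:: 7; 18]); ([:: 21], [:: 18;
  4]); ([:: 20], [:: 24; 22]); ([:: 19], [:: 18; 28; 30]); ([:: 15], [:: 7; 10]); ([::
  13], [:: 10; 4]); ([:: 12], [:: 10; 29; 30]); ([:: 11], [:: 27; 26]); ([:: 9], [:: 24;
  16]); ([:: 8], [:: 7; 17; 25]); ([:: 6], [:: 29; 4; 30]); ([:: 5], [:: 17; 4; 25]);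
  ([:: 22], [:: 24; 4]); ([:: 16], [:: 24; 10]); ([:: 14], [:: 10; 29; 4; 30]); ([::
  25], [:: 29; 28]); ([:: 17], [:: 10; 29; 28]); ([:: 7], [:: 10; 18]); ([:: 24], [::
  18; 29; 30]); ([:: 4], [:: 29; 26]); ([:: 10], [:: 29; 27]); ([:: 18], [:: 29; 28;
  30])]; [::]; [::]; [::]; [::]; [::([:: 32], [:: 33; 35]); ([:: 4], [:: 6; 5]); ([::
  3], [:: 6; 35]); ([:: 1], [:: 33; 5]); ([:: 35], [:: 6; 33])]; [::([:: 32], [:: 33;
  35]); ([:: 7], [:: 9; 8]); ([:: 3], [:: 9; 35]); ([:: 1], [:: 33; 8]); ([:: 35], [::
  33; 9])]; [::([:: 32], [:: 34; 35]); ([:: 10], [:: 12; 11]); ([:: 3], [:: 12; 35]);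
  ([:: 2], [:: 34; 11]); ([:: 35], [:: 12; 34])]; [::([:: 32], [:: 33; 34]); ([:: 10],
  [:: 13; 11]); ([:: 4], [:: 13; 5]); ([:: 2], [:: 34; 11]); ([:: 1], [:: 33; 5]); ([::
  34], [:: 33; 11]); ([:: 33], [:: 11; 5])]; [::([:: 2], [:: 34; 11]); ([:: 1], [:: 33;
  5]); ([:: 35], [:: 38; 36]); ([:: 34], [:: 32; 11]); ([:: 33], [:: 32; 5]); ([:: 13],
  [:: 39; 14]); ([:: 12], [:: 38; 14]); ([:: 10], [:: 14; 11]); ([:: 3], [:: 36; 14]);
  ([:: 11], [:: 39; 38]); ([:: 32], [:: 39; 36]); ([:: 6], [:: 36; 14; 4]); ([:: 4], [::
  14; 5]); ([:: 5], [:: 39; 36; 14])]; [::([:: 32], [:: 33; 34]); ([:: 10], [:: 15;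
  11]); ([:: 7], [:: 15; 8]); ([:: 2], [:: 34; 11]); ([:: 1], [:: 33; 8]); ([:: 34], [::
  33; 11]); ([:: 33], [:: 8; 11])]; [::([:: 2], [:: 34; 11]); ([:: 1], [:: 33; 8]); ([::
  35], [:: 38; 37]); ([:: 34], [:: 32; 11]); ([:: 33], [:: 8; 32]); ([:: 15], [:: 16;
  41]); ([:: 12], [:: 16; 38]); ([:: 10], [:: 38; 41]); ([:: 3], [:: 16; 37]); ([:: 11],
  [:: 38; 41; 32]); ([:: 32], [:: 37; 41]); ([:: 9], [:: 7; 16; 37]); ([:: 7], [:: 16;
  8]); ([:: 8], [:: 16; 37; 41])]; [::([:: 32], [:: 39; 41]); ([:: 7], [:: 15; 8]); ([::
  4], [:: 39; 17]); ([:: 2], [:: 34; 11]); ([:: 34], [:: 39; 41; 11]); ([:: 33], [:: 39;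
  41; 1]); ([:: 15], [:: 10; 8]); ([:: 13], [:: 39; 10; 17]); ([:: 11], [:: 39; 10;
  41]); ([:: 10], [:: 39; 8]); ([:: 8], [:: 17; 41]); ([:: 1], [:: 41; 5])]; [::([::
  32], [:: 36; 37]); ([:: 35], [:: 3; 36; 37]); ([:: 33], [:: 36; 37; 1]); ([:: 15], [::
  16; 17]); ([:: 13], [:: 14; 17]); ([:: 10], [:: 12; 17]); ([:: 12], [:: 3; 17]); ([::
  9], [:: 16; 37]); ([:: 7], [:: 37; 17]); ([:: 8], [:: 37; 17; 1]); ([:: 1], [:: 37;
  5]); ([:: 6], [:: 3; 4]); ([:: 5], [:: 37; 4]); ([:: 16], [:: 3; 37; 17]); ([:: 14],
  [:: 3; 4; 17]); ([:: 4], [:: 36; 17])]; [::([:: 2], [:: 34; 11]); ([:: 35], [:: 3;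
  32]); ([:: 34], [:: 32; 11]); ([:: 33], [:: 32; 1]); ([:: 15], [:: 7; 10]); ([:: 13],
  [:: 10; 4]); ([:: 12], [:: 3; 10]); ([:: 11], [:: 10; 32]); ([:: 9], [:: 16; 37]);
  ([:: 8], [:: 7; 1]); ([:: 6], [:: 36; 14]); ([:: 5], [:: 4; 1]); ([:: 16], [:: 3; 7]);
  ([:: 14], [:: 10; 36]); ([:: 4], [:: 10; 1]); ([:: 38], [:: 3; 10; 32]); ([:: 37], [::
  7; 32]); ([:: 36], [:: 3; 1]); ([:: 17], [:: 43; 44]); ([:: 41], [:: 43; 42]); ([::
  7], [:: 42; 44]); ([:: 39], [:: 43; 40]); ([:: 10], [:: 3; 43]); ([:: 44], [:: 3; 42;
  1]); ([:: 32], [:: 40; 42])]; [::([:: 32], [:: 34; 35]); ([:: 18], [:: 19; 20]); ([::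
  3], [:: 20; 35]); ([:: 2], [:: 19; 34]); ([:: 35], [:: 20; 34])]; [::([:: 32], [:: 33;
  34]); ([:: 18], [:: 19; 21]); ([:: 4], [:: 21; 5]); ([:: 2], [:: 19; 34]); ([:: 1],
  [:: 33; 5]); ([:: 34], [:: 19; 33]); ([:: 33], [:: 19; 5])]; [::([:: 2], [:: 46; 47]);
  ([:: 1], [:: 36; 47]); ([:: 35], [:: 46; 36]); ([:: 34], [:: 46; 32; 47]); ([:: 32],
  [:: 33; 46]); ([:: 33], [:: 46; 36; 47]); ([:: 21], [:: 22; 47]); ([:: 20], [:: 46;
  22]); ([:: 18], [:: 19; 22]); ([:: 3], [:: 6; 46]); ([:: 19], [:: 46; 22; 47]); ([::
  6], [:: 36; 22]); ([:: 4], [:: 22; 5]); ([:: 5], [:: 36; 22; 47])]; [::([:: 32], [::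
  33; 34]); ([:: 18], [:: 19; 23]); ([:: 7], [:: 23; 8]); ([:: 2], [:: 19; 34]); ([::
  1], [:: 33; 8]); ([:: 34], [:: 19; 33]); ([:: 33], [:: 19; 8])]; [::([:: 2], [:: 46;
  49]); ([:: 1], [:: 33; 8]); ([:: 35], [:: 46; 37]); ([:: 34], [:: 46; 49; 32]); ([::
  32], [:: 37; 49]); ([:: 33], [:: 37; 49; 8]); ([:: 23], [:: 24; 49]); ([:: 20], [::
  46; 24]); ([:: 18], [:: 19; 24]); ([:: 3], [:: 46; 9]); ([:: 19], [:: 46; 49; 24]);
  ([:: 9], [:: 24; 37]); ([:: 7], [:: 24; 8]); ([:: 8], [:: 24; 37; 49])]; [::([:: 32],
  [:: 49; 47]); ([:: 7], [:: 23; 8]); ([:: 4], [:: 21; 5]); ([:: 2], [:: 19; 34]); ([::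
  34], [:: 19; 49; 47]); ([:: 33], [:: 47; 49; 1]); ([:: 23], [:: 18; 8]); ([:: 21], [::
  25; 47]); ([:: 19], [:: 18; 49; 47]); ([:: 18], [:: 49; 25]); ([:: 8], [:: 25; 49;
  1]); ([:: 1], [:: 49; 5])]; [::([:: 32], [:: 36; 37]); ([:: 35], [:: 3; 36; 37]); ([::
  33], [:: 36; 37; 1]); ([:: 23], [:: 24; 25]); ([:: 21], [:: 18; 4]); ([:: 20], [:: 24;
  22]); ([:: 18], [:: 24; 4]); ([:: 9], [:: 24; 37]); ([:: 7], [:: 37; 25]); ([:: 8],
  [:: 37; 25; 1]); ([:: 1], [:: 37; 5]); ([:: 6], [:: 3; 4]); ([:: 5], [:: 37; 4]); ([::
  22], [:: 3; 24; 4]); ([:: 3], [:: 24; 36]); ([:: 4], [:: 36; 25])]; [::([:: 2], [::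
  19; 34]); ([:: 35], [:: 3; 32]); ([:: 34], [:: 19; 32]); ([:: 33], [:: 32; 1]); ([::
  23], [:: 7; 18]); ([:: 21], [:: 18; 4]); ([:: 20], [:: 3; 18]); ([:: 19], [:: 18;
  32]); ([:: 9], [:: 7; 3]); ([:: 8], [:: 7; 1]); ([:: 6], [:: 36; 22]); ([:: 5], [:: 4;
  1]); ([:: 24], [:: 50; 52]); ([:: 22], [:: 36; 18]); ([:: 4], [:: 18; 1]); ([:: 46],
  [:: 48; 50]); ([:: 37], [:: 3; 1]); ([:: 36], [:: 48; 52]); ([:: 25], [:: 51; 52]);
  ([:: 49], [:: 51; 50]); ([:: 47], [:: 18; 32; 1]); ([:: 51; 32], [:: 18; 50; 1]); ([::
  51], [:: 7; 18; 1]); ([:: 7], [:: 50; 52; 1]); ([:: 18; 32], [:: 48; 50; 1]); ([::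
  32], [:: 3; 48; 1]); ([:: 18], [:: 48; 50; 52])]; [::([:: 32], [:: 39; 47]); ([:: 18],
  [:: 47; 26]); ([:: 10], [:: 13; 11]); ([:: 1], [:: 33; 5]); ([:: 34], [:: 39; 2; 47]);
  ([:: 33], [:: 39; 5; 47]); ([:: 21], [:: 47; 4; 26]); ([:: 19], [:: 47; 2; 26]); ([::
  2], [:: 47; 11]); ([:: 13], [:: 4; 11]); ([:: 11], [:: 39; 26]); ([:: 4], [:: 26;
  5])]; [::([:: 32], [:: 34; 35]); ([:: 35], [:: 3; 34]); ([:: 34], [:: 3; 2]); ([::
  21], [:: 18; 4]); ([:: 20], [:: 46; 22]); ([:: 19], [:: 18; 2]); ([:: 13], [:: 14;
  26]); ([:: 12], [:: 38; 14]); ([:: 10], [:: 38; 26]); ([:: 11], [:: 38; 2; 26]); ([::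
  6], [:: 14; 22]); ([:: 4], [:: 22; 26]); ([:: 18], [:: 2; 22]); ([:: 14], [:: 38;
  22]); ([:: 3], [:: 46; 38]); ([:: 2], [:: 46; 26])]; [::([:: 1], [:: 33; 5]); ([::
  35], [:: 3; 32]); ([:: 34], [:: 2; 32]); ([:: 33], [:: 32; 5]); ([:: 21], [:: 18; 4]);
  ([:: 20], [:: 46; 22]); ([:: 19], [:: 18; 2]); ([:: 13], [:: 10; 4]); ([:: 12], [::
  38; 14]); ([:: 11], [:: 10; 2]); ([:: 6], [:: 3; 4]); ([:: 5], [:: 4; 32]); ([:: 22],
  [:: 46; 4]); ([:: 18], [:: 2; 4]); ([:: 14], [:: 3; 10]); ([:: 46], [:: 3; 2]); ([::
  38], [:: 10; 32]); ([:: 36], [:: 3; 4; 32]); ([:: 26], [:: 55; 54]); ([:: 47], [:: 48;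
  54]); ([:: 39], [:: 40; 54]); ([:: 10], [:: 55; 40]); ([:: 4], [:: 3; 54]); ([:: 55],
  [:: 3; 40; 2]); ([:: 32], [:: 40; 48])]; [::([:: 32], [:: 41; 49]); ([:: 18], [:: 49;
  27]); ([:: 10], [:: 41; 27]); ([:: 1], [:: 33; 8]); ([:: 34], [:: 2; 41; 49]); ([::
  33], [:: 8; 41; 49]); ([:: 23], [:: 7; 49; 27]); ([:: 19], [:: 2; 49; 27]); ([:: 2],
  [:: 49; 11]); ([:: 15], [:: 7; 41; 27]); ([:: 7], [:: 27; 8]); ([:: 11], [:: 49; 41;
  27])]; [::([:: 32], [:: 34; 35]); ([:: 35], [:: 3; 34]); ([:: 34], [:: 3; 2]); ([::
  23], [:: 24; 27]); ([:: 20], [:: 46; 24]); ([:: 18], [:: 19; 24]); ([:: 19], [:: 24;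
  2]); ([:: 15], [:: 16; 27]); ([:: 7], [:: 9; 27]); ([:: 12], [:: 3; 10]); ([:: 11],
  [:: 38; 27]); ([:: 10], [:: 16; 38]); ([:: 9], [:: 24; 16]); ([:: 16], [:: 24; 38]);
  ([:: 3], [:: 46; 38]); ([:: 2], [:: 46; 27])]; [::([:: 1], [:: 33; 8]); ([:: 35], [::
  3; 32]); ([:: 34], [:: 2; 32]); ([:: 33], [:: 8; 32]); ([:: 23], [:: 7; 18]); ([::
  20], [:: 46; 24]); ([:: 19], [:: 18; 2]); ([:: 15], [:: 7; 10]); ([:: 12], [:: 16;
  38]); ([:: 11], [:: 10; 2]); ([:: 9], [:: 7; 3]); ([:: 8], [:: 7; 32]); ([:: 24], [::
  3; 18]); ([:: 16], [:: 3; 10]); ([:: 46], [:: 50; 58]); ([:: 38], [:: 3; 2]); ([::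
  10], [:: 7; 2]); ([:: 37], [:: 50; 42]); ([:: 27], [:: 7; 18; 2]); ([:: 49], [:: 18;
  32]); ([:: 41], [:: 42; 57]); ([:: 57], [:: 7; 2; 32]); ([:: 42], [:: 7; 32; 3]); ([::
  7; 50], [:: 3; 18; 32]); ([:: 18], [:: 7; 50]); ([:: 32], [:: 3; 2; 50])]; [::([::
  32], [:: 33; 34]); ([:: 34], [:: 33; 2]); ([:: 33], [:: 2; 1]); ([:: 23], [:: 7; 18]);
  ([:: 21], [:: 18; 4]); ([:: 19], [:: 18; 2]); ([:: 15], [:: 7; 10]); ([:: 13], [:: 10;
  4]); ([:: 11], [:: 10; 2]); ([:: 8], [:: 7; 1]); ([:: 5], [:: 4; 1]); ([:: 27], [::
  28; 57]); ([:: 26], [:: 2; 4]); ([:: 25], [:: 18; 1]); ([:: 17], [:: 10; 1]); ([::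
  49], [:: 51; 57]); ([:: 47], [:: 51; 54]); ([:: 41], [:: 43; 57]); ([:: 39], [:: 43;
  54]); ([:: 57], [:: 7; 2]); ([:: 28], [:: 10; 18]); ([:: 10; 54], [:: 43; 2; 4]); ([::
  10], [:: 7; 4]); ([:: 2], [:: 7; 54]); ([:: 18], [:: 7; 51; 4]); ([:: 7], [:: 43;
  51])]; [::([:: 32], [:: 36; 37]); ([:: 18], [:: 29; 52]); ([:: 10], [:: 29; 44]); ([::
  35], [:: 52; 44]); ([:: 33], [:: 36; 37; 1]); ([:: 23], [:: 24; 25]); ([:: 21], [::
  29; 52; 4]); ([:: 20], [:: 3; 29; 52]); ([:: 15], [:: 16; 17]); ([:: 13], [:: 29; 4;
  44]); ([:: 12], [:: 3; 29; 44]); ([:: 9], [:: 7; 3]); ([:: 8], [:: 7; 1]); ([:: 6],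
  [:: 3; 4]); ([:: 5], [:: 4; 1]); ([:: 24], [:: 7; 29; 52]); ([:: 22], [:: 3; 4; 29;
  52]); ([:: 16], [:: 3; 17]); ([:: 14], [:: 3; 29; 4; 44]); ([:: 25], [:: 29; 52; 1]);
  ([:: 7], [:: 3; 1]); ([:: 37], [:: 52; 44; 1]); ([:: 36], [:: 4; 52; 44]); ([:: 1],
  [:: 52; 17]); ([:: 4], [:: 29; 52; 44])]; [::([:: 32], [:: 46; 38]); ([:: 7], [:: 58;
  30]); ([:: 4], [:: 55; 30]); ([:: 35], [:: 3; 46; 38]); ([:: 34], [:: 55; 58]); ([::
  23], [:: 24; 27]); ([:: 21], [:: 55; 18; 30]); ([:: 20], [:: 3; 18]); ([:: 19], [::
  18; 2]); ([:: 15], [:: 16; 27]); ([:: 13], [:: 55; 10; 30]); ([:: 12], [:: 3; 10]);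
  ([:: 11], [:: 10; 2]); ([:: 9], [:: 3; 58; 30]); ([:: 6], [:: 14; 22]); ([:: 24], [::
  18; 58; 30]); ([:: 22], [:: 18; 14]); ([:: 16], [:: 3; 27]); ([:: 14], [:: 3; 55;
  30]); ([:: 26], [:: 55; 2; 30]); ([:: 10], [:: 3; 2]); ([:: 38], [:: 3; 55; 58]); ([::
  46], [:: 55; 18; 58]); ([:: 2], [:: 55; 27]); ([:: 18], [:: 55; 58; 30])]; [::([::
  35], [:: 3; 32]); ([:: 34], [:: 2; 32]); ([:: 33], [:: 32; 1]); ([:: 23], [:: 7; 18]);
  ([:: 21], [:: 18; 4]); ([:: 20], [:: 3; 18]); ([:: 19], [:: 18; 2]); ([:: 15], [:: 7;
  10]); ([:: 13], [:: 10; 4]); ([:: 12], [:: 3; 10]); ([:: 11], [:: 10; 2]); ([:: 9],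
  [:: 7; 3]); ([:: 8], [:: 7; 1]); ([:: 6], [:: 3; 4]); ([:: 5], [:: 4; 1]); ([:: 24],
  [:: 3; 18; 7]); ([:: 22], [:: 3; 18; 4]); ([:: 16], [:: 3; 10; 7]); ([:: 14], [:: 3;
  10; 4]); ([:: 46], [:: 3; 2]); ([:: 38], [:: 10; 32]); ([:: 37], [:: 7; 32]); ([::
  36], [:: 3; 1]); ([:: 27], [:: 7; 2]); ([:: 26], [:: 2; 4]); ([:: 25], [:: 18; 1]);
  ([:: 17], [:: 10; 1]); ([:: 58], [:: 59; 62]); ([:: 57], [:: 59; 60]); ([:: 55], [::
  56; 62]); ([:: 54], [:: 56; 60]); ([:: 52], [:: 61; 53]); ([:: 51], [:: 53; 60]); ([::
  49], [:: 50; 60]); ([:: 47], [:: 48; 60]); ([:: 50], [:: 59; 53]); ([:: 48], [:: 3;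
  60]); ([:: 44], [:: 61; 45]); ([:: 43], [:: 45; 60]); ([:: 41], [:: 59; 45]); ([::
  39], [:: 40; 60]); ([:: 40], [:: 45; 56]); ([:: 30], [:: 62; 31]); ([:: 29], [:: 7;
  4]); ([:: 28], [:: 2; 1]); ([:: 31], [:: 10; 18]); ([:: 42; 1], [:: 7; 59; 45; 32]);
  ([:: 2; 42], [:: 59; 10; 45; 32]); ([:: 42], [:: 7; 10; 32]); ([:: 18; 56; 62], [:: 3;
  2; 4]); ([:: 18; 56], [:: 3; 2; 4; 60]); ([:: 61; 53; 4], [:: 3; 18; 1]); ([:: 53; 4],
  [:: 3; 18; 60; 1]); ([:: 61; 45; 4], [:: 3; 10; 1]); ([:: 61], [:: 7; 1; 3]); ([:: 7;
  4], [:: 3; 10; 18; 1]); ([:: 59; 45; 1], [:: 7; 60; 32]); ([:: 10; 2; 62; 32], [:: 59;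
  56]); ([:: 59; 56], [:: 10; 2; 62; 32]); ([:: 59; 1], [:: 7; 53; 60; 32]); ([:: 53],
  [:: 18; 32]); ([:: 59; 2; 3], [:: 62; 18; 32]); ([:: 7; 45; 3], [:: 10; 32; 1]); ([::
  59; 45; 7], [:: 10; 60; 32]); ([:: 59; 45], [:: 10; 2; 60; 32]); ([:: 2; 45], [:: 10;
  56; 32; 60]); ([:: 56], [:: 4; 32]); ([:: 3; 45], [:: 10; 4; 32; 1]); ([:: 45], [:: 7;
  4]); ([:: 7; 4], [:: 10; 60; 32; 1]); ([:: 59; 10; 60], [:: 7; 2; 32]); ([:: 59; 60],
  [:: 7; 18; 2; 32]); ([:: 59], [:: 7; 32; 62]); ([:: 10], [:: 7; 4]); ([:: 3], [:: 18;
  4; 32]); ([:: 1], [:: 7; 18; 4; 60]); ([:: 32], [:: 60; 62])]])%N.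

(** An exchange whose first face is a single vertex removes that vertex; exchanges of larger faces
    come in between. In rank at least two, the boundary of a simplex is reached with as many
    vertices left as the rank of the cell. *)
Lemma P8_ranked (R : realType) : ranked_cells R 8 P8 rk8.
Proof.
apply: (@ranked_checkP P8 rk8 R 8%N 0%N P8_moves).
by vm_compute.
Qed.

(** * Families of sets as dichotomial spheres *)

Definition proper_part (F : seq bitseq) : seq bitseq :=
  [seq x <- F | (true \in x) && (false \in x)].

Definition cells (F : seq bitseq) := seq_sub (proper_part F).

HB.instance Definition _ F := Finite.on (cells F).
HB.instance Definition _ F := Order.Le_isPOrder.Build (Order.Disp tt tt) (cells F)
  (@le_in_refl (proper_part F)) (@le_in_anti (proper_part F)) (@le_in_trans (proper_part F)).

Definition cell_poset (F : seq bitseq) : finPOrderType (Order.Disp tt tt) := cells F.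

Lemma bsubP (a b : bitseq) : size a = size b ->
  reflect (forall i, nth false a i -> nth false b i) (bsub a b).
Proof.
elim: a b => [|x a IH] [|y b] //=; first by constructor; case.
move=> [/IH{}IH]; apply: (iffP andP) => [[xy /IH ab] [|i] //=|h].
- by move=> hx; rewrite hx in xy.
- exact: ab.
split; first by apply/implyP => hx; apply: (h 0%N).
by apply/IH => i; apply: (h i.+1).
Qed.

Definition unit_at (m i : nat) : bitseq := mkseq (fun j => j == i) m.

Lemma size_unit m i : size (unit_at m i) = m.
Proof. by rewrite size_mkseq. Qed.

Lemma nth_unit m i j : (i < m)%N -> nth false (unit_at m i) j = (j == i).
Proof.
move=> im; have [jm|jm] := ltnP j m; first by rewrite nth_mkseq.
rewrite nth_default ?size_unit //; apply/esym/negbTE; apply: contraTneq jm => ->.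
by rewrite -ltnNge.
Qed.

Lemma unit_sub m i x : size x = m -> (i < m)%N -> bsub (unit_at m i) x = nth false x i.
Proof.
move=> sx im; apply/bsubP/idP; rewrite ?size_unit // => h.
  by apply: h; rewrite nth_unit ?eqxx.
by move=> j; rewrite nth_unit // => /eqP->.
Qed.

Lemma true_unit m i : (i < m)%N -> true \in unit_at m i.
Proof.
move=> im; have <- : nth false (unit_at m i) i = true by rewrite nth_unit ?eqxx.
by rewrite mem_nth ?size_unit.
Qed.

Lemma trueP (x : bitseq) : reflect (exists2 i, (i < size x)%N & nth false x i) (true \in x).
Proof.
apply: (iffP (nthP false)) => [[i im e]|[i im e]]; exists i => //.
Qed.

Lemma falseP (x : bitseq) :
  reflect (exists2 i, (i < size x)%N & ~~ nth false x i) (false \in x).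
Proof.
apply: (iffP (nthP false)) => [[i im e]|[i im e]]; exists i => //; first by rewrite e.
exact: negbTE.
Qed.

(** With all singletons in the family, the atoms of the poset are the singletons and a cell is
    determined by its atoms. This gives atomisticity and the uniqueness of the opposite cell, whose
    existence is closure under complement. The bound on [m] makes the singletons proper. *)
Definition dichotomial_check (m : nat) (F : seq bitseq) (rk : bitseq -> nat) : bool :=
  [&& (1 < m)%N, uniq F,
      all (fun i => (unit_at m i \in F) && (rk (unit_at m i) == 1)%N) (iota 0 m),
      all (fun x => map negb x \in F) F & rank_ok F rk].

Section Dichotomial.
Variables (R : realType) (m : nat) (F : seq bitseq) (rk : bitseq -> nat).
Hypothesis rc : ranked_cells R m F rk.
Hypothesis chk : dichotomial_check m F rk.

Let P := cell_poset F.
Implicit Types x y p : P.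

Let m_gt1 : (1 < m)%N. Proof. by case/and5P: chk. Qed.
Let uF : uniq F. Proof. by case/and5P: chk. Qed.
Let rok : rank_ok F rk. Proof. by case/and5P: chk. Qed.

Lemma unitF i : (i < m)%N -> unit_at m i \in F.
Proof. by case/and5P: chk => _ _ /allP/(_ i); rewrite mem_iota => h _ _ /h/andP[]. Qed.
Lemma rk_unit i : (i < m)%N -> rk (unit_at m i) = 1%N.
Proof. by case/and5P: chk => _ _ /allP/(_ i); rewrite mem_iota => h _ _ /h/andP[_ /eqP]. Qed.
Lemma negF a : a \in F -> map negb a \in F.
Proof. by case/and5P: chk => _ _ _ /allP h _ /h. Qed.

Lemma proper_inP (a : bitseq) :
  reflect [/\ a \in F, true \in a & false \in a] (a \in proper_part F).
Proof.
by rewrite mem_filter; apply: (iffP andP) => [[/andP[]]|[]] //; split=> //; apply/andP.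
Qed.

Lemma cellP x : [/\ val x \in F, true \in val x, false \in val x & size (val x) = m].
Proof. by have /proper_inP[h1 h2 h3] := valP x; split=> //; apply: (rc_size rc). Qed.

Lemma cell_leE x y : (x <= y)%O = bsub (val x) (val y).
Proof. by []. Qed.

Lemma cell_ltE x y : (x < y)%O = (val x != val y) && bsub (val x) (val y).
Proof. by rewrite lt_neqAle cell_leE -val_eqE. Qed.

Lemma rk_lt a b : a \in F -> b \in F -> true \in a -> bsub a b -> a != b ->
  (rk a < rk b)%N.
Proof.
by move=> aF bF ta ab nab; have [] := rank_okP rok aF bF ta ab nab.
Qed.

Lemma rk_coatom a b : a \in F -> b \in F -> true \in a -> bsub a b -> a != b ->
  exists2 c, [/\ c \in F, true \in c, bsub c b & c != b] & (rk c).+1 = rk b.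
Proof.
move=> aF bF ta ab nab.
have [_ [j /coatomsP[jF /and3P[h1 h2 h3] rE] _]] := rank_okP rok aF bF ta ab nab.
by exists (nth [::] F j); rewrite ?mem_nth.
Qed.

Lemma rk_ltP x y : (x < y)%O -> (rk (val x) < rk (val y))%N.
Proof.
rewrite cell_ltE => /andP[xy le]; have [xF tx _ _] := cellP x; have [yF _ _ _] := cellP y.
exact: rk_lt.
Qed.

Lemma chain_card (C : {set P}) n : is_chain C ->
  (forall x, x \in C -> (rk (val x) <= n)%N) -> (#|C| <= n)%N.
Proof.
move=> /forall_inP ch Cn.
have inj : {in enum C &, injective (fun x : P => rk (val x))}.
  move=> x y; rewrite !mem_enum => xC yC e; apply/eqP.
  have /forall_inP/(_ y yC) := ch x xC; rewrite /Order.comparable !le_eqVlt.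
  by case/orP => /predU1P[->//|/rk_ltP]; rewrite e ltnn.
have us : uniq [seq rk (val x) | x <- enum C] by rewrite map_inj_in_uniq ?enum_uniq.
have sub : {subset [seq rk (val x) | x <- enum C] <= iota 1 n}.
  move=> r /mapP[x]; rewrite mem_enum => xC ->; rewrite mem_iota add1n ltnS.
  by have [xF tx _ _] := cellP x; rewrite (rc_rk_gt0 rc) // Cn.
by have := uniq_leq_size us sub; rewrite size_map size_iota -cardE.
Qed.

Lemma sub_full a b : bsub a b -> false \in b -> false \in a.
Proof.
move=> ab; have sab := bsub_size ab; move/falseP=> [i ib nb]; apply/falseP.
exists i; first by rewrite sab.
by apply: contra nb; apply/bsubP.
Qed.

Lemma proper_below a b : bsub a b -> a != b -> false \in a.
Proof.
move=> ab; apply: contraR => na; apply/eqP/bsub_anti; rewrite ab /=.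
have sab := bsub_size ab; apply/bsubP => // i bi.
have [ia|ia] := ltnP i (size a); last by rewrite nth_default // -sab in bi.
by apply: contraR na => nai; apply/falseP; exists i.
Qed.

Lemma chain_ex p : exists C : {set P},
  [/\ is_chain C, C \subset down p & #|C| = rk (val p)].
Proof.
have [n] := ubnP (rk (val p)); elim: n p => // n IH p pn.
have [pF tp _ sp] := cellP p.
have rest : exists C : {set P}, [/\ is_chain C, forall x, x \in C -> (x < p)%O
    & (#|C|).+1 = rk (val p)].
  have /trueP[i im pi] := tp; rewrite sp in im.
  have up : bsub (unit_at m i) (val p) by rewrite unit_sub.
  have [e|ne] := eqVneq (unit_at m i) (val p).
    exists set0; split; first by apply/forall_inP => x; rewrite inE.
      by move=> x; rewrite inE.
    by rewrite cards0 -e rk_unit.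
  have [c [cF tc cp ncp] rc1] := rk_coatom (unitF im) pF (true_unit im) up ne.
  have cP : c \in proper_part F by apply/proper_inP; split=> //; exact: proper_below cp ncp.
  have [|C [ch sC Cc]] := IH (SeqSub cP : P); first by rewrite /= -ltnS rc1.
  exists C; split=> //; last by rewrite Cc.
  move=> x /(subsetP sC); rewrite inE => xc; apply: le_lt_trans xc _.
  by rewrite cell_ltE /= ncp.
have [C [/forall_inP ch Cp Cc]] := rest; exists (p |: C); split.
- apply/forall_inP => x; rewrite !inE => xC; apply/forall_inP => y; rewrite !inE => yC.
  case/predU1P: xC => [->|xC]; case/predU1P: yC => [->|yC].
  + exact: comparablexx.
  + by rewrite /Order.comparable (ltW (Cp y yC)) orbT.
  + by rewrite /Order.comparable (ltW (Cp x xC)).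
  + by have /forall_inP/(_ y yC) := ch x xC.
- by apply/subsetP => x; rewrite !inE => /predU1P[->//|/Cp/ltW].
- rewrite cardsU1 -Cc; case: (boolP (p \in C)) => // /Cp.
  by rewrite ltxx.
Qed.

Lemma rk_leP x y : (x <= y)%O -> (rk (val x) <= rk (val y))%N.
Proof. by rewrite le_eqVlt => /predU1P[->//|/rk_ltP/ltnW]. Qed.

Lemma poset_dimE (A : {set P}) n :
  (forall x, x \in A -> (rk (val x) <= n)%N) ->
  (exists2 x, down x \subset A & rk (val x) = n) -> poset_dim A = n%:Z - 1.
Proof.
move=> An [x xA xn]; rewrite /poset_dim; congr (Posz _ - 1).
apply/eqP; rewrite eqn_leq; apply/andP; split.
  apply/bigmax_leqP => C /andP[ch CA]; apply: chain_card ch _ => y /(subsetP CA).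
  exact: An.
have [C [ch sC Cx]] := chain_ex x; rewrite -xn -Cx.
by apply: (@leq_bigmax_cond _ _ _ C); rewrite ch (subset_trans sC).
Qed.

Lemma dim_down p : poset_dim (down p) = (rk (val p))%:Z - 1.
Proof.
by apply: poset_dimE => [x|]; [rewrite inE; apply: rk_leP | exists p].
Qed.

Lemma in_skeleton k p : (p \in skeleton P k) = (rk (val p) <= k.+1)%N.
Proof. by rewrite inE dim_down; lia. Qed.

Let top := nseq m true.

Lemma topF : top \in F.
Proof. by have := negF (rc_bot rc); rewrite map_nseq. Qed.

Lemma sub_top a : size a = m -> bsub a top.
Proof.
move=> sa; apply/bsubP => [|i ai]; first by rewrite size_nseq.
rewrite nth_nseq; case: ltnP => // h.
by rewrite nth_default ?sa in ai.
Qed.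

Lemma dim_total : poset_dim [set: P] = (rk top).-1%:Z - 1.
Proof.
have nt : false \notin top by rewrite mem_nseq andbF.
apply: poset_dimE => [x _|].
  have [xF tx fx sx] := cellP x.
  suff: (rk (val x) < rk top)%N by lia.
  by apply: rk_lt; rewrite ?topF ?sub_top //; apply: contraTneq fx => ->.
have m0 : (0 < m)%N by exact: ltnW.
have [||c [cF tc ct nct] rE] := rk_coatom (unitF m0) topF (true_unit m0).
- by rewrite sub_top ?size_unit.
- apply/eqP => /(congr1 (nth false ^~ 1%N)).
  by rewrite nth_unit // nth_nseq m_gt1.
have cP : c \in proper_part F by apply/proper_inP; split=> //; apply: proper_below ct nct.
by exists (SeqSub cP : P); rewrite ?subsetT // -rE.
Qed.

Lemma order_complexE (A : {set P}) (x : {ffun P -> R}) :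
  order_complex R A x <-> cone (chainK <=%O (mem A)) x /\ \sum_i x i = 1.
Proof.
split=> [[x0 x1 xA /forall_inP ch]|[[x0 /chainKP[h1 h2]] x1]].
  split=> //; split=> //; apply/chainKP; split; first by move=> y /(subsetP xA).
  by move=> y z ys zs; have /forall_inP/(_ z zs) := ch y ys.
split=> //; first by apply/subsetP => y /h1.
by apply/forall_inP => y ys; apply/forall_inP => z zs; apply: h2.
Qed.

(** Used twice: with [p] a cell, for its boundary, and with [p] the whole ground set, for the order
    complex of the poset. *)
Lemma opn_sphere (p : bitseq) (A : {set P}) : p \in F -> true \in p ->
  (forall x, (x \in A) = bsub (val x) p && (val x != p)) ->
  pl_sphere (rk p).-1 (order_complex R A).
Proof.
move=> pF tp AE; apply: (sph_pl_sphere (order_complexE A)).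
apply: chomeo_trans ((rc_cell rc) p pF tp).
have inF x : val x \in F by case: (cellP x).
apply: (@chain_relabel R _ _ _ _ _ _ (fun x : P => SeqSub (inF x))) => //.
- by move=> x y _ _ [] /val_inj.
- move=> x xA; have : x \in A by []; rewrite AE => h; have [_ tx _ _] := cellP x.
  by rewrite /opn /= tx.
- move=> y /and3P[ty yp nyp].
  have yP : val y \in proper_part F.
    by apply/proper_inP; split; [exact: valP | | exact: proper_below yp nyp].
  exists (SeqSub yP : P); first by rewrite -[mem A _]/(_ \in A) AE /= yp.
  exact: val_inj.
Qed.

Lemma atomP x : reflect (exists2 i, (i < m)%N & val x = unit_at m i)
  (x \in atoms [set: P]).
Proof.
have [xF tx fx sx] := cellP x.
rewrite inE inE andTb; apply: (iffP forall_inP) => [h|[i im xi] y _].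
  have /trueP[i] := tx; rewrite sx => im xi; exists i => //.
  have ux : bsub (unit_at m i) (val x) by rewrite unit_sub.
  have uP : unit_at m i \in proper_part F.
    apply/proper_inP; split; [exact: unitF | exact: true_unit | exact: sub_full ux fx].
  have := h (SeqSub uP : P); rewrite inE cell_ltE /= ux andbT negbK => /(_ isT)/eqP //.
have [yF ty _ sy] := cellP y; rewrite cell_ltE xi; apply/negP => /andP[nyx yx].
case/negP: nyx; apply/eqP/bsub_anti; rewrite yx unit_sub //=.
have /trueP[j _ yj] := ty.
have /bsubP h := yx; have := h _ j yj; rewrite size_unit => /(_ sy).
by rewrite nth_unit // => /eqP <-.
Qed.

Lemma atoms_downE p : atoms (down p) = atoms [set: P] :&: down p.
Proof.
apply/setP => x; rewrite !inE /=; apply/andP/andP => [[xp /forall_inP h]|[/forall_inP h xp]].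
  split=> //; apply/forall_inP => y _; apply/negP => yx.
  by have := h y; rewrite inE yx (le_trans (ltW yx) xp) => /(_ isT).
by split=> //; apply/forall_inP => y _; apply: h; rewrite inE.
Qed.

Lemma in_atoms_down p i (im : (i < m)%N) (uP : unit_at m i \in proper_part F) :
  ((SeqSub uP : P) \in atoms (down p)) = nth false (val p) i.
Proof.
have [pF tp fp sp] := cellP p.
rewrite atoms_downE in_setI [X in X && _](introT (atomP _)) /=; last by exists i.
by rewrite inE cell_leE unit_sub.
Qed.

Lemma unitP i p : (i < m)%N -> nth false (val p) i -> unit_at m i \in proper_part F.
Proof.
move=> im pi; have [pF tp fp sp] := cellP p.
apply/proper_inP; split; [exact: unitF | exact: true_unit |].
by apply: sub_full fp; rewrite unit_sub.
Qed.

Lemma atomisticP : atomistic P.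
Proof.
move=> p; exists (atoms (down p)); first by rewrite atoms_downE subsetIl.
split=> [a|q h]; first by rewrite atoms_downE !inE => /andP[_].
have [pF tp fp sp] := cellP p; have [qF tq fq sq] := cellP q.
rewrite cell_leE; apply/bsubP => [|i pi]; first by rewrite sp.
have im : (i < m)%N by rewrite ltnNge; apply: contraL pi => h'; rewrite nth_default ?sp.
have uP := unitP im pi.
have := h (SeqSub uP : P); rewrite in_atoms_down // => /(_ pi).
by rewrite cell_leE unit_sub.
Qed.

Lemma cell_complexP : cell_complex P R.
Proof.
move=> p; exists (rk (val p)).-1; have [pF tp _ _] := cellP p.
by apply: opn_sphere => // x; rewrite inE cell_ltE andbC.
Qed.

Lemma complementP p : exists! q,
  atoms (down q) = atoms [set: P] :\: atoms (down p).
Proof.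
have [pF tp fp sp] := cellP p.
have qP : map negb (val p) \in proper_part F.
  apply/proper_inP; split; first exact: negF.
    by apply/mapP; exists false.
  by apply/mapP; exists true.
have nthq i : (i < m)%N -> nth false (map negb (val p)) i = ~~ nth false (val p) i.
  by move=> im; rewrite (nth_map false) // sp.
have eqA (q : P) : (forall i, (i < m)%N -> nth false (val q) i = ~~ nth false (val p) i) ->
    atoms (down q) = atoms [set: P] :\: atoms (down p).
  move=> h; have [_ _ _ sq] := cellP q; apply/setP => x.
  rewrite !atoms_downE in_setI in_setD in_setI.
  case xA: (x \in atoms [set: P]); rewrite /= ?andbF // andbT.
  have /atomP[i im xi] := xA.
  by rewrite !inE !cell_leE xi !unit_sub // h.
exists (SeqSub qP : P); split; first by apply: eqA => i im /=; rewrite nthq.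
move=> q qE; have [qF tq fq sq] := cellP q.
apply: val_inj; apply: (@eq_from_nth _ false); first by rewrite /= size_map sp sq.
rewrite /= size_map sp => i im; rewrite nthq //.
have uP : unit_at m i \in proper_part F.
  have [pi|npi] := boolP (nth false (val p) i); first exact: unitP pi.
  have := @unitP i (SeqSub qP : P) im; rewrite /= nthq //; exact.
have := congr1 (fun A : {set P} => (SeqSub uP : P) \in A) qE.
rewrite /= in_setD !in_atoms_down // => ->.
rewrite [X in _ && X](introT (atomP _)) ?andbT //.
by exists i.
Qed.

(** The ground set is not a cell: its rank is one more than that of the cells of top dimension, and
    the dimension of a cell is one less than its rank. Hence the shift by two. *)
Lemma dichotomial_sphereP n : rk top = n.+2 -> dichotomial_sphere P R n.
Proof.
move=> rt; split.
- by split; [exact: cell_complexP | exact: atomisticP | exact: complementP].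
- by rewrite dim_total rt /=; lia.
- have -> : n.+1 = (rk top).-1 by rewrite rt.
  apply: opn_sphere; first exact: topF.
    by rewrite mem_nseq eqxx andbT; apply: ltnW.
  move=> x; rewrite inE; have [_ _ fx sx] := cellP x.
  rewrite sub_top //; apply/esym; apply: contraTneq fx => ->.
  by rewrite mem_nseq andbF.
Qed.

End Dichotomial.

(** * Skeleta *)

(** The inner sum is the size of the upper set of [x], which an isomorphism preserves; any function
    [G] of it may be summed to give a numerical invariant. *)
Lemma rel_iso_sum (S T : finType) (A : {set S}) (B : {set T}) leS leT
    (G : (nat -> nat)) : rel_isomorphic A B leS leT ->
  (\sum_(x in A) G (\sum_(y in A) leS x y)%N =
   \sum_(x in B) G (\sum_(y in B) leT x y)%N)%N.
Proof.
move=> [f [bf fle]]; rewrite [LHS]big_sub [RHS]big_sub.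
rewrite [RHS](reindex f); last exact: onW_bij.
apply: eq_bigr => u _; congr G; rewrite [LHS]big_sub [RHS]big_sub.
rewrite [RHS](reindex f); last exact: onW_bij.
by apply: eq_bigr => v _; rewrite fle.
Qed.

Lemma simplicial_down (disp : Order.disp_t) (P : finPOrderType disp)
    (A : {set P}) p : simplicial A -> p \in A ->
  exists k, (\sum_(q in A) (q <= p)%O = (2 ^ k).-1)%N.
Proof.
move=> [V [K [[K0 Kd] [f [bf fle]]]]] pA.
pose s := val (f (exist _ p pA)).
exists #|s|; rewrite big_sub.
transitivity (\sum_(t in K) (t \subset s))%N.
  rewrite [RHS]big_sub [RHS](reindex f); last exact: onW_bij.
  by apply: eq_bigr => u _; rewrite fle.
rewrite -big_mkcondr /= sum1_card -card_powerset.
rewrite [in RHS](cardsD1 finset.set0) powersetE finset.sub0set add1n /=.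
apply: eq_card => t; rewrite -[LHS]/((t \in K) && (t \subset s)) !inE.
apply/andP/andP => [[tK ts]|[t0 ts]]; split=> //.
  by apply: contraNneq K0 => <-.
by apply: Kd ts t0; apply: valP.
Qed.

Definition skel (F : seq bitseq) (rk : bitseq -> nat) (k : nat) : seq bitseq :=
  [seq x <- proper_part F | (rk x <= k.+1)%N].

(** On a 1-skeleton a vertex of degree d contributes (d + 1)^3 and an edge contributes 1. Squares in
    place of cubes would not separate the thirteen graphs: the fourth and the fifth family both give
    366. *)
Definition up_cubes (L : seq bitseq) : nat :=
  sumn [seq (count (bsub x) L ^ 3)%N | x <- L].

(* A quadrangle has 9 faces, itself included, while a simplex has 2 ^ k - 1. *)
Definition has_quadrangle (L : seq bitseq) : bool :=
  has (fun p => count (bsub^~ p) L == 9)%N L.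

Definition all_simplices (m : nat) (L : seq bitseq) : bool :=
  all (fun p => all (fun q => (true \in q) && bsub q p ==> (q \in L)) (cube m)) L.

Lemma mem_cube m x : (x \in cube m) = (size x == m).
Proof.
elim: m x => [|m IH] x; first by rewrite inE; case: x.
apply/fiberP/eqP => [[a [b [aF]]]|].
  rewrite IH => /eqP bm _ ->; rewrite size_cat bm.
  by move: aF; rewrite !inE => /orP[] /eqP->.
case: x => // b x [xm]; exists [:: b], x; rewrite IH xm eqxx.
by split=> //; case: b.
Qed.

Section Skeleta.
Variables (R : realType) (m : nat) (F : seq bitseq) (rk : bitseq -> nat).
Hypothesis rc : ranked_cells R m F rk.
Hypothesis chk : dichotomial_check m F rk.
Let P := cell_poset F.

Lemma sum_skeleton k (G : bitseq -> nat) :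
  (\sum_(x in skeleton P k) G (val x) = \sum_(x <- skel F rk k) G x)%N.
Proof.
have uP : uniq (proper_part F) by rewrite filter_uniq //; case/and5P: chk.
rewrite big_filter; under eq_bigl => x do rewrite (in_skeleton rc chk).
rewrite -(big_map val (fun a => rk a <= k.+1)%N G); apply: perm_big.
apply: uniq_perm => //; first by rewrite map_inj_uniq ?index_enum_uniq //; apply: val_inj.
move=> a; apply/mapP/idP => [[x _ ->]|aP]; first exact: valP.
by exists (SeqSub aP : P); rewrite ?mem_index_enum.
Qed.

Lemma skeleton_up_cubes k :
  (\sum_(x in skeleton P k) (\sum_(y in skeleton P k) (x <= y)%O) ^ 3
   = up_cubes (skel F rk k))%N.
Proof.
rewrite /up_cubes sumnE big_map -sum_skeleton; apply: eq_bigr => x _; congr (_ ^ _)%N.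
by rewrite -sum1_count [RHS]big_mkcond /= -sum_skeleton; apply: eq_bigr => y _; rewrite cell_leE; case: bsub.
Qed.

Lemma not_simplicial : has_quadrangle (skel F rk 2) -> ~ simplicial (skeleton P 2).
Proof.
case/hasP=> a aL /eqP c9 sP.
move: (aL); rewrite mem_filter => /andP[ra aP].
have pS : (SeqSub aP : P) \in skeleton P 2 by rewrite (in_skeleton rc chk).
have [k] := simplicial_down sP pS.
have -> : (\sum_(q in skeleton P 2) (q <= SeqSub aP :> P)%O = 9)%N.
  rewrite -c9 -sum1_count [RHS]big_mkcond /= -sum_skeleton.
  by apply: eq_bigr => y _; rewrite cell_leE; case: bsub.
by case: k => [|[|[|[|k]]]] //; rewrite !expnS; have := expn_gt0 2 k; lia.
Qed.

(** The check says that the skeleton is closed under nonempty subsets, so its cells, read as sets of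
    vertices, already form a simplicial complex. *)
Lemma simplicialP : all_simplices m (skel F rk 2) -> simplicial (skeleton P 2).
Proof.
move=> /allP all_s.
pose bits (a : bitseq) : {set 'I_m} := [set i | nth false a (val i)].
pose K : {set {set 'I_m}} := [set bits (val x) | x in skeleton P 2].
have skelE (x : P) : (x \in skeleton P 2) = (val x \in skel F rk 2).
  by rewrite (in_skeleton rc chk) mem_filter (valP x) andbT.
have szP (x : P) : size (val x) = m by have [] := cellP rc x.
have bitsS (a b : bitseq) : size a = m -> size b = m -> (bits a \subset bits b) = bsub a b.
  move=> sa sb; apply/subsetP/bsubP => [|h i ai|h i]; first by rewrite sa.
    have im : (i < m)%N by rewrite ltnNge; apply: contraL ai => h'; rewrite nth_default ?sa.
    by have := h (Ordinal im); rewrite !inE; apply.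
  by rewrite !inE; apply: h.
have bitsK (x : {x | x \in skeleton P 2}) : bits (val (val x)) \in K.
  by apply: imset_f; apply: valP.
exists 'I_m, K; split; first split.
- apply/imsetP => -[x xS /esym/setP e]; have [_ /trueP[i im xi] _ _] := cellP rc x.
  rewrite szP in im; have := e (Ordinal im); by rewrite !inE xi.
- move=> s t /imsetP[x xS ->] ts t0.
  pose q := mkseq (fun i => if insub i is Some j then j \in t else false) m.
  have tq : t = bits q.
    apply/setP => i; rewrite inE nth_mkseq //; last exact: ltn_ord.
    by rewrite (_ : insub (val i) = Some i) // valK.
  have sq : size q = m by rewrite size_mkseq.
  have qL : q \in skel F rk 2.
    move: (xS); rewrite skelE => /all_s/allP/(_ q); rewrite mem_cube sq eqxx => /(_ isT).
    move/implyP; apply; rewrite -bitsS // -tq ts andbT.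
    have [i it] := set0Pn _ t0; apply/trueP; exists (val i); first by rewrite sq ltn_ord.
    by move: it; rewrite tq inE.
  move: (qL); rewrite mem_filter => /andP[_ qP].
  by rewrite tq; apply/imsetP; exists (SeqSub qP : P); rewrite ?skelE.
- pose f (x : {x | x \in skeleton P 2}) : {y | y \in K} :=
      exist (fun y : {set 'I_m} => y \in K) _ (bitsK x).
  exists f; split; last first.
    by move=> x y; rewrite cell_leE -bitsS ?szP.
  apply: inj_card_bij.
    move=> x y /(congr1 val) /= e; apply: val_inj; apply: val_inj; apply: bsub_anti.
    by rewrite -!bitsS ?szP // e subxx.
  by rewrite !card_sig (leq_trans (leq_imset_card _ _)).
Qed.

End Skeleta.

(** * The thirteen spheres *)

Lemma wins_mono w a b : bsub a b -> wins w a -> wins w b.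
Proof.
move=> ab; have : (sumn (mask a w) <= sumn (mask b w))%N.
  elim: a b w ab => [|x a IH] [|y b] [|k w] //= /andP[xy ab].
  have := IH b w ab; case: x y xy => -[] //= _; lia.
by rewrite /wins; lia.
Qed.

Lemma wins_bot w m : wins w (nseq m false) = false.
Proof. by rewrite /wins mask_false ltn0. Qed.

Record family := Family {
  ground : nat;
  members : seq bitseq;
  rank : bitseq -> nat }.

Definition valid (R : realType) (f : family) : Prop :=
  ranked_cells R (ground f) (members f) (rank f).

Definition simplex n := Family n (cube n) (count id).

Definition amalgam (f : family) (w : seq nat) (g : family) (w' : seq nat) :=
  Family (ground f + ground g)
    (fiber (members f) (wins w) (members g) (wins w'))
    (rkf (ground f) (wins w) (rank f) (rank g)).

Definition petersen8 := Family 8 P8 rk8.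

Lemma simplex_valid R n : valid R (simplex n).
Proof. exact: cube_ranked. Qed.

Lemma amalgam_valid R f w g w' : valid R f -> valid R g -> valid R (amalgam f w g w').
Proof.
move=> vf vg; apply: fiber_ranked vf vg _ _ _ _; rewrite ?wins_bot //.
  by move=> a b _ _; apply: wins_mono.
by move=> a b _ _; apply: wins_mono.
Qed.

Lemma petersen8_valid R : valid R petersen8.
Proof. exact: P8_ranked. Qed.

(** Rank 7 of the ground set means dimension 5. The three members with simplicial 2-skeleta are
    expected at the head of the list. *)
Definition families_check (fs : seq family) : bool :=
  [&& all (fun f => dichotomial_check (ground f) (members f) (rank f) &&
                    (rank f (nseq (ground f) true) == 7)) fs,
      uniq [seq up_cubes (skel (members f) (rank f) 1) | f <- fs],
      all (fun f => all_simplices (ground f) (skel (members f) (rank f) 2)) (take 3 fs)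
    & all (fun f => has_quadrangle (skel (members f) (rank f) 2)) (drop 3 fs)]%N.

Lemma checked_families (R : realType) (fs : seq family) :
  size fs = 13%N -> List.Forall (valid R) fs -> families_check fs ->
  exists B : 'I_13 -> finPOrderType (Order.Disp tt tt),
    (forall i : 'I_13, dichotomial_sphere (B i) R 5) /\
    (forall i j : 'I_13, i <> j ->
       ~ poset_isomorphic (skeleton (B i) 1) (skeleton (B j) 1)) /\
    (exists S : {set 'I_13},
       #|S| = 10%N /\
       forall i : 'I_13, i \in S <-> ~ simplicial (skeleton (B i) 2)).
Proof.
move=> szf vfs /and4P[/(all_nthP (simplex 0)) dich upU simp quad].
pose fam i := nth (simplex 0) fs i.
have lt i : (i < 13)%N -> (i < size fs)%N by rewrite szf.
have val i : valid R (fam i).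
  rewrite /fam; elim: fs i vfs {szf dich upU simp quad fam lt} => [|f l IH] [|i] /=.
  - by move=> _; exact: (simplex_valid R 0).
  - by move=> _; exact: (simplex_valid R 0).
  - by case/List.Forall_cons_iff.
  - by case/List.Forall_cons_iff => _ /IH.
have dichP (i : 'I_13) : dichotomial_check (ground (fam i)) (members (fam i)) (rank (fam i)).
  by have /andP[] := dich i (lt i (ltn_ord i)).
have topP (i : 'I_13) : rank (fam i) (nseq (ground (fam i)) true) = 7%N.
  by have /andP[_ /eqP] := dich i (lt i (ltn_ord i)).
exists (fun i => cell_poset (members (fam i))); split; last split.
- by move=> i; apply: (dichotomial_sphereP (val i) (dichP i)); apply: topP.
- move=> i j ij /(rel_iso_sum (fun k => k ^ 3)%N).
  rewrite (skeleton_up_cubes (val i) (dichP i)) (skeleton_up_cubes (val j) (dichP j)) => e.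
  case: ij; apply: val_inj; apply: (uniqP 0%N upU); rewrite ?inE ?size_map ?lt ?ltn_ord //.
  by rewrite !(nth_map (simplex 0)) ?lt ?ltn_ord.
exists [set i : 'I_13 | (3 <= i)%N]; split.
  by rewrite -sum1_card big_mkcond /= !big_ord_recl big_ord0 !inE.
move=> i; rewrite inE; have [i3|i3] := leqP 3 i.
  split=> // _; apply: (not_simplicial (val i) (dichP i)).
  have /(all_nthP (simplex 0))/(_ (i - 3)%N) := quad.
  rewrite size_drop szf nth_drop subnKC //; apply.
  by rewrite ltn_sub2r.
split=> // ns; case: ns; apply: (simplicialP (val i) (dichP i)).
have /(all_nthP (simplex 0))/(_ (nat_of_ord i)) := simp.
by rewrite size_take szf nth_take //; apply.
Qed.

Definition triangle := simplex 3.
Definition maj : seq nat := [:: 1; 1; 1]%N.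
(** The 3-sphere whose 1-skeleton is the complete bipartite graph on two triples; its 2-cells are
    the nine quadrangles. *)
Definition K33 := amalgam triangle maj triangle maj.

(** The first three have as 2-skeleta the 2-skeleton of the 6-simplex, the join of three points with
    the 1-skeleton of the 4-simplex, and the join of three triples of points. The four weightings of
    [K33], in the order listed, differ from the common majority of its two triples on 0, 1, 2 and 3
    complementary pairs of cells. Two of them have an even total, but no member of [K33] attains
    half of it, so they are self-dual there. *)
Definition families : seq family := ([::
  simplex 7;
  amalgam triangle maj (simplex 5) [:: 1; 1; 1; 1; 1];
  amalgam K33 maj triangle maj;
  amalgam triangle maj (simplex 5) [:: 1; 1; 1];
  amalgam triangle maj (simplex 5) [:: 2; 1; 1; 1];
  amalgam triangle maj (simplex 5) [:: 3; 1; 1; 1; 1];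
  amalgam triangle maj (simplex 5) [:: 2; 2; 1; 1; 1];
  amalgam triangle maj (simplex 5) [:: 3; 2; 2; 1; 1];
  amalgam (simplex 4) [:: 2; 1; 1; 1] (simplex 4) [:: 2; 1; 1; 1];
  amalgam K33 [:: 3; 1; 1; 3; 1; 1] triangle maj;
  amalgam K33 [:: 5; 1; 1; 3; 3; 1] triangle maj;
  amalgam K33 [:: 4; 1; 1; 1; 1; 1] triangle maj;
  amalgam petersen8 [::] (simplex 1) [::]])%N.

Lemma families_checkE : families_check families.
Proof. by vm_compute. Qed.

Lemma families_valid R : List.Forall (valid R) families.
Proof.
have s n : valid R (simplex n) by exact: simplex_valid.
have a f w g w' : valid R f -> valid R g -> valid R (amalgam f w g w').
  exact: amalgam_valid.
have k : valid R K33 := a _ _ _ _ (s 3) (s 3).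
have p : valid R (amalgam petersen8 [::] (simplex 1) [::]).
  exact: a (petersen8_valid R) (s 1).
pose c := @List.Forall_cons family (valid R).
exact: (c _ _ (s 7) (c _ _ (a _ _ _ _ (s 3) (s 5)) (c _ _ (a _ _ _ _ k (s 3))
  (c _ _ (a _ _ _ _ (s 3) (s 5)) (c _ _ (a _ _ _ _ (s 3) (s 5))
  (c _ _ (a _ _ _ _ (s 3) (s 5)) (c _ _ (a _ _ _ _ (s 3) (s 5))
  (c _ _ (a _ _ _ _ (s 3) (s 5)) (c _ _ (a _ _ _ _ (s 4) (s 4))
  (c _ _ (a _ _ _ _ k (s 3)) (c _ _ (a _ _ _ _ k (s 3)) (c _ _ (a _ _ _ _ k (s 3))
  (c _ _ p (@List.Forall_nil _ _)))))))))))))).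
Qed.

Local Close Scope ring_scope.

Theorem corollary2p9 (R : realType) :
  exists B : 'I_13 -> finPOrderType (Order.Disp tt tt),
    (forall i : 'I_13, dichotomial_sphere (B i) R 5) /\
    (forall i j : 'I_13, i <> j ->
       ~ poset_isomorphic (skeleton (B i) 1) (skeleton (B j) 1)) /\
    (exists S : {set 'I_13},
       #|S| = 10 /\
       forall i : 'I_13, i \in S <-> ~ simplicial (skeleton (B i) 2)).
Proof.
exact: (@checked_families R families (erefl _) (families_valid R) families_checkE).
Qed.
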